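(* Let $N\in\mathbb{N}$, let $X_1,\dots,X_N,Y_1,\dots,Y_N$ be Polish spaces, $X=\prod_t X_t$, $Y=\prod_t Y_t$, and let $\mu\in\mathcal P(X)$, $\nu\in\mathcal P(Y)$ both satisfy the continuous disintegration assumption. Then the set $\mathrm{Cpl}_{bc}(\mu,\nu)\cap\mathrm{Cpl}_{biM}(\mu,\nu)$ of biadapted Monge couplings is weakly dense in $\mathrm{Cpl}_{bc}(\mu,\nu)$, i.e. its weak closure equals $\mathrm{Cpl}_{bc}(\mu,\nu)$. Moreover, if $p\in[1,\infty)$ and $\mu,\nu$ have finite $p$-th moments with respect to compatible metrics $d_X,d_Y$, then $\mathrm{Cpl}_{bc}(\mu,\nu)\cap\mathrm{Cpl}_{biM}(\mu,\nu)$ is also dense in $\mathrm{Cpl}_{bc}(\mu,\nu)$ with respect to $\mathcal W_p$ (for the product metric $d_{X\times Y}^p=d_X^p+d_Y^p$).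
   Context: Continuous disintegration assumption: $\mu$ admits a disintegration $d\mu(x_{1:N})=d\mu_1(x_1)\,d\mu^{x_1}(x_2)\cdots d\mu^{x_{1:N-1}}(x_N)$ with Borel kernels $x_{1:t}\mapsto\mu^{x_{1:t}}\in\mathcal P(X_{t+1})$ such that $\mu_1$ is continuous (no atoms) and $\mu^{x_{1:t}}$ is continuous for every $t<N$ and every $x_{1:t}\in X_1\times\dots\times X_t$. $\mathrm{Cpl}_{biM}(\mu,\nu)=\{(\mathrm{id},T)_\ast\mu: T:X\to Y \text{ Borel bijection}, T_\ast\mu=\nu\}$. For $t<N$, $\mathcal F^X_t$ (resp. $\mathcal F^Y_t$) is the $\sigma$-algebra generated by the first $t$ coordinates. $\pi\in\mathrm{Cpl}(\mu,\nu)$ with disintegration $\pi(dx,dy)=\mu(dx)\pi^x(dy)$ is causal if for all $t<N$, $B\in\mathcal F^Y_t$, $x\mapsto\pi^x(B)$ is $\mathcal F^X_t$-measurable; bicausal if also its image under $(x,y)\mapsto(y,x)$ is causal from $\nu$ to $\mu$; $\mathrm{Cpl}_{bc}(\mu,\nu)$ is the set of bicausal couplings. $\mathcal W_p$ is the $p$-Wasserstein distance $\mathcal W_p^p(\alpha,\beta)=\inf_{\gamma\in\mathrm{Cpl}(\alpha,\beta)}\int d^p\,d\gamma$. *)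

(* Defs.v *)
From HB Require Import structures.
From mathcomp Require Import all_boot all_order all_algebra.
From mathcomp Require Import all_classical all_reals all_analysis.
From mathcomp Require Import measurable_realfun.
Set Implicit Arguments. Unset Strict Implicit. Unset Printing Implicit Defensive.
Import Order.TTheory GRing.Theory Num.Theory.
Import numFieldNormedType.Exports.
Local Open Scope classical_set_scope.
Local Open Scope ring_scope.

Definition prodsp (N : nat) (X : 'I_N -> ptopologicalType) := prod_topology X.
Arguments prodsp {N}.
HB.instance Definition _ (N : nat) (X : 'I_N -> ptopologicalType) :=
  Topological.on (prodsp X).
HB.instance Definition _ (N : nat) (X : 'I_N -> ptopologicalType) :=
  Pointed.copy (prodsp X) (forall i, X i).

Definition pairsp (A B : ptopologicalType) := (A * B)%type.
HB.instance Definition _ (A B : ptopologicalType) := Topological.on (pairsp A B).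
HB.instance Definition _ (A B : ptopologicalType) :=
  Pointed.copy (pairsp A B) (A * B)%type.

Definition borel (T : ptopologicalType) := g_sigma_algebraType (@open T).
Definition Borel (T : ptopologicalType) (A : set T) : Prop := <<s @open T >> A.
Definition Prob (R : realType) (T : ptopologicalType) := probability (borel T) R.

Definition Borel_fun (R : realType) (T : ptopologicalType) (f : T -> \bar R) :=
  forall C : set (\bar R), measurable C -> Borel (f @^-1` C).

Definition atomless (R : realType) (T : ptopologicalType) (P : Prob R T) :=
  forall x : T, P [set x] = 0%E.

Section Metric.
Context (R : realType).

Definition is_metric (T : Type) (d : T -> T -> R) :=
  [/\ forall x y, 0 <= d x y, forall x y, d x y = 0 <-> x = y,
      forall x y, d x y = d y x &
      forall x y z, d x z <= d x y + d y z].

Definition compatible_metric (T : topologicalType) (d : T -> T -> R) :=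
  is_metric d /\
  forall A : set T, open A <->
    (forall x, A x -> exists2 e : R, 0 < e & [set y | d x y < e] `<=` A).

Definition complete_metric (T : Type) (d : T -> T -> R) :=
  forall u : nat -> T,
    (forall e : R, 0 < e -> exists n, forall m k, (n <= m)%N -> (n <= k)%N ->
       d (u m) (u k) < e) ->
    exists l, forall e : R, 0 < e -> exists n, forall m, (n <= m)%N -> d (u m) l < e.

Definition separable_space (T : topologicalType) :=
  exists D : set T, countable D /\ closure D = setT.

Definition polish (T : topologicalType) :=
  separable_space T /\
  exists d : T -> T -> R, compatible_metric d /\ complete_metric d.

End Metric.

Section Filtration.
Context (R : realType) (N : nat) (X : 'I_N -> ptopologicalType).

(* F_t : sigma-algebra on X generated by the first t coordinates
   (coordinates are indexed 0, ..., N-1) *)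
Definition Ft (t : nat) : set (set (prodsp X)) :=
  <<s [set A | exists s : 'I_N, (s < t)%N /\
          exists B : set (X s), Borel B /\ A = (fun x : prodsp X => x s) @^-1` B] >>.

Definition Ft_fun (t : nat) (f : prodsp X -> \bar R) :=
  forall C : set (\bar R), measurable C -> Ft t (f @^-1` C).

(* iterated integral  int mu_1(dx_1) int k^{x_1}(dx_2) ... f(x_1..x_N)
   where k t x is the law of the coordinate t given the coordinates < t *)
Definition iter_int (k : forall t : 'I_N, prodsp X -> Prob R (X t))
  (f : prodsp X -> \bar R) : prodsp X -> \bar R :=
  foldr (fun t g => fun x : prodsp X =>
           (\int[k t x]_y g (@dfwith _ (fun i => X i) x t y))%E)
        f (enum 'I_N).

(* continuous disintegration assumption: kernels k t (t = 0..N-1) with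
   k t x depending Borel-measurably on the first t coordinates of x only
   (k 0 is mu_1), all atomless, and mu = mu_1 (x) k_1 (x) ... (x) k_{N-1} *)
Definition cont_disint (mu : Prob R (prodsp X)) :=
  exists k : forall t : 'I_N, prodsp X -> Prob R (X t),
    [/\ forall (t : 'I_N) (B : set (X t)), Borel B -> Ft_fun t (fun x => k t x B),
        forall (t : 'I_N) (x : prodsp X), atomless (k t x) &
        forall A : set (prodsp X), Borel A -> forall x0 : prodsp X,
          mu A = iter_int k (fun x => (\1_A x)%:E) x0].

End Filtration.
Arguments Ft {N} X t.
Arguments Ft_fun {R N} X t f.

Section Couplings.
Context (R : realType).

Definition is_cpl (A B : ptopologicalType) (P : Prob R A) (Q : Prob R B)
  (g : Prob R (pairsp A B)) :=
  (forall U : set A, Borel U -> g (U `*` setT) = P U) /\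
  (forall V : set B, Borel V -> g (setT `*` V) = Q V).

Context (N : nat) (X Y : 'I_N -> ptopologicalType).

Definition causal (mu : Prob R (prodsp X))
  (pi : set (pairsp (prodsp X) (prodsp Y)) -> \bar R) :=
  exists K : prodsp X -> Prob R (prodsp Y),
    [/\ forall B : set (prodsp Y), Borel B -> Borel_fun (fun x => K x B),
        forall S : set (pairsp (prodsp X) (prodsp Y)), Borel S ->
          pi S = (\int[mu]_x K x [set y | S (x, y)])%E &
        forall (t : 'I_N) (B : set (prodsp Y)), Ft Y t B ->
          Ft_fun X t (fun x => K x B)].

End Couplings.

Section Bicausal.
Context (R : realType) (N : nat) (X Y : 'I_N -> ptopologicalType).
Context (mu : Prob R (prodsp X)) (nu : Prob R (prodsp Y)).

Definition swap_set (S : set (pairsp (prodsp Y) (prodsp X))) :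
  set (pairsp (prodsp X) (prodsp Y)) := [set z | S (z.2, z.1)].

Definition bicausal (pi : Prob R (pairsp (prodsp X) (prodsp Y))) :=
  causal mu (fun S => pi S) /\ causal nu (fun S => pi (swap_set S)).

Definition Cpl_bc : set (Prob R (pairsp (prodsp X) (prodsp Y))) :=
  [set pi | is_cpl mu nu pi /\ bicausal pi].

Definition Cpl_biM : set (Prob R (pairsp (prodsp X) (prodsp Y))) :=
  [set pi | exists T : prodsp X -> prodsp Y,
     [/\ bijective T,
         forall B : set (prodsp Y), Borel B -> Borel (T @^-1` B),
         forall B : set (prodsp Y), Borel B -> mu (T @^-1` B) = nu B &
         forall S : set (pairsp (prodsp X) (prodsp Y)), Borel S ->
           pi S = mu [set x | S (x, T x)]]].

End Bicausal.

Section Weak.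
Context (R : realType) (T : ptopologicalType).

Definition bounded_continuous (f : T -> R) :=
  continuous f /\ exists M : R, forall z, `|f z| <= M.

(* closure in the weak topology (topology generated by pi |-> int f dpi,
   f bounded continuous), via its basic neighbourhoods *)
Definition weak_closure (S : set (Prob R T)) : set (Prob R T) :=
  [set pi : Prob R T | forall (k : nat) (f : 'I_k -> T -> R),
     (forall i, bounded_continuous (f i)) ->
     forall eps : R, 0 < eps ->
       exists2 pi', S pi' &
         forall i, (`| \int[pi']_z (f i z)%:E - \int[pi]_z (f i z)%:E | < eps%:E)%E].

(* W_p(P, Q) for the cost c = d^p *)
Definition Wp (p : R) (c : T -> T -> R) (P Q : Prob R T) : \bar R :=
  poweR (ereal_inf [set (\int[g]_w (c w.1 w.2)%:E)%E
                    | g in [set g : Prob R (pairsp T T) | is_cpl P Q g]]) p^-1.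

Definition finite_moment (p : R) (d : T -> T -> R) (P : Prob R T) :=
  exists x0 : T, (\int[P]_x ((d x0 x) `^ p)%:E < +oo)%E.

End Weak.

Definition prod_cost (R : realType) (A B : ptopologicalType) (p : R)
  (dA : A -> A -> R) (dB : B -> B -> R) (z w : pairsp A B) : R :=
  dA z.1 w.1 `^ p + dB z.2 w.2 `^ p.

(* Main.v *)
(* The continuous disintegration of [mu] yields an adapted bijection [Phi] of [X] onto R^N,
   with adapted inverse, that carries [mu] to N independent uniform variables (the
   innovations); likewise for [nu]. A coupling is causal iff the innovations of [x] from time
   [t] on are independent of the first [t] coordinates of [x] and [y].

   Density. Divide [0, 1) into M equal cells. By the two innovation conditions the conditional
   law of the pair of time-t cells, given the past cells, is a matrix with row and column sums
   1/M, hence is realised by an interval exchange of [0, 1). Composing these exchanges along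
   time gives a biadapted bijection transporting [mu] to [nu] whose coupling [pi'] gives
   every cell exactly the mass that [pi] gives it. Coupling [pi'] and [pi] independently inside
   each cell gives pairs that are close in probability as M grows, since cells approximate all
   Borel sets; weak convergence and, by uniform integrability, W_p convergence follow.

   Closedness. The innovation conditions only involve masses of Borel rectangles, and these
   pass to weak limits because the marginals are fixed and bounded continuous functions are
   dense in L^1. Conversely the innovation condition yields an everywhere adapted kernel. *)
Require Import Defs.
From HB Require Import structures.
From mathcomp Require Import all_boot all_order all_algebra.
From mathcomp Require Import all_classical all_reals all_analysis.
From mathcomp Require Import measurable_realfun.
From mathcomp Require Import ring lra.
Set Implicit Arguments. Unset Strict Implicit. Unset Printing Implicit Defensive.
Import Order.TTheory GRing.Theory Num.Theory.
Import numFieldNormedType.Exports.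
Local Open Scope classical_set_scope.
Local Open Scope ring_scope.

(** * Finite products and adapted maps *)

(** Two demands rule out the usual almost-sure arguments: a Monge coupling needs a Borel map that is
    bijective at every point, and causality needs kernels that are adapted at every point. Quantile
    and distribution functions of an atomless kernel are mutually inverse only up to null sets. Each
    is made a genuine Borel injection by moving the exceptional points into a null set that holds a
    copy of the line; such a copy exists because the codes of the points of a Polish space lie in
    the ternary Cantor set. A measurable Schroeder-Bernstein argument, with the past as a parameter,
    then glues the two injections into a bijection that still carries one law to the other. For
    kernels, the conditional laws of y given t and given t + 1 coordinates of x agree on F_t for
    almost every x only. The first time of disagreement is visible one step later, so stopping there
    does not destroy adaptedness. The number of cells has to be fixed before the approximating
    coupling is built. The closeness estimates are therefore uniform over all couplings with the
    given marginals, and valid for every large number of cells, so that one number serves both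
    factors. *)

Lemma measurable_mem d (T : measurableType d) (D : set T) : measurable D ->
  measurable_fun setT (fun x : T => x \in D).
Proof.
move=> mD; apply: (measurable_fun_bool true); rewrite setTI.
by rewrite (_ : _ @^-1` _ = D)//; apply/seteqP; split => x /=; [exact: set_mem|exact: mem_set].
Qed.

Lemma measurable_preim d1 d2 (T1 : measurableType d1) (T2 : measurableType d2)
  (f : T1 -> T2) (B : set T2) :
  measurable_fun setT f -> measurable B -> measurable [set x | B (f x)].
Proof. by move=> mf mB; rewrite -[X in measurable X]setTI; exact: mf. Qed.

Lemma measurable_eqset d (T : measurableType d) d' (A : measurableType d')
  (h1 h2 : T -> A) : measurable [set p : A * A | p.1 = p.2] ->
  measurable_fun setT h1 -> measurable_fun setT h2 ->
  measurable [set t | h1 t = h2 t].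
Proof.
move=> mA m1 m2.
by apply: (measurable_preim (f := fun t => (h1 t, h2 t)) (B := [set p | p.1 = p.2]) _ mA);
  apply: measurable_fun_pair.
Qed.

(** The diagonal of an abstract measurable space need not be measurable; a measurable injection into
    the line pulls it back from the diagonal of the line. *)
Lemma measurable_diag_inj (R : realType) d (A : measurableType d) (c : A -> R) :
  measurable_fun setT c -> injective c -> measurable [set p : A * A | p.1 = p.2].
Proof.
move=> mc ic.
have m1 : measurable_fun setT (fun p : A * A => c p.1) by exact: measurableT_comp.
have m2 : measurable_fun setT (fun p : A * A => c p.2) by exact: measurableT_comp.
have := measurable_fun_eqr m1 m2 measurableT (Y := [set true]).
rewrite setTI => /(_ I); congr measurable; apply/seteqP; split => p /=.
  by move=> /eqP /ic.
by move=> ->; rewrite eqxx.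
Qed.

(** * Measurable Schroeder-Bernstein theorem with a parameter *)

Section SchroederBernstein.
Context d0 d1 d2 (Z : measurableType d0) (A : measurableType d1)
  (B : measurableType d2).
Variables (f : Z * A -> B) (f' : Z * B -> A) (g : Z * B -> A) (g' : Z * A -> B).
Hypotheses (mf : measurable_fun setT f) (mf' : measurable_fun setT f')
  (mg : measurable_fun setT g) (mg' : measurable_fun setT g').
Hypotheses (fK : forall z a, f' (z, f (z, a)) = a)
  (gK : forall z b, g' (z, g (z, b)) = b).
Hypotheses (mA : measurable [set p : A * A | p.1 = p.2])
  (mB : measurable [set p : B * B | p.1 = p.2]).

(** [back] retraces an orbit by two steps, undoing [g] and then [f]. [D] consists of the points
    whose backward orbit stops in A, outside the range of [g]. Ranges are expressed by equations
    such as [g (p.1, g' p) = p.2], which measurable diagonals turn into measurable sets. *)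
Let back (p : Z * A) : Z * A := (p.1, f' (p.1, g' p)).
Let hasback : set (Z * A) := [set p | g (p.1, g' p) = p.2 /\
  f (back p) = g' p].
Let D0 : set (Z * A) := [set p | g (p.1, g' p) <> p.2].
Let Dn n : set (Z * A) :=
  iter n (fun E => [set p | hasback p /\ E (back p)]) D0.
Let D := \bigcup_n Dn n.
Let fromD : set (Z * B) := [set q | f (q.1, f' q) = q.2 /\ D (q.1, f' q)].
Let theta p := if p \in D then f p else g' p.
Let eta q := if q \in fromD then f' q else g q.

Let mback : measurable_fun setT back.
Proof.
apply: measurable_fun_pair => //; apply: measurableT_comp => //.
exact: measurable_fun_pair.
Qed.

Let mgg' : measurable_fun setT (fun p => g (p.1, g' p)).
Proof. by apply: measurableT_comp => //; exact: measurable_fun_pair. Qed.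

Let mDn n : measurable (Dn n).
Proof.
elim: n => [|n IH].
  rewrite (_ : Dn 0 = ~` [set p | g (p.1, g' p) = p.2])//.
  by apply: measurableC; apply: measurable_eqset.
rewrite (_ : Dn n.+1 = [set p | g (p.1, g' p) = p.2] `&`
    [set p | f (back p) = g' p] `&` [set p | Dn n (back p)]); last first.
  by apply/seteqP; split => p /= -[[]].
apply: measurableI; last exact: measurable_preim.
apply: measurableI; apply: measurable_eqset => //.
exact: measurableT_comp.
Qed.

Let mD : measurable D. Proof. exact: bigcup_measurable. Qed.

Let mff' : measurable_fun setT (fun q : Z * B => (q.1, f' q)).
Proof. exact: measurable_fun_pair. Qed.

Let mfromD : measurable fromD.
Proof.
rewrite (_ : fromD = [set q | f (q.1, f' q) = q.2] `&`
    [set q | D (q.1, f' q)])//.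
apply: measurableI; last exact: (measurable_preim mff').
by apply: measurable_eqset => //; exact: measurableT_comp.
Qed.

(** The backward orbit of [g (z, b)] passes through b, so both end on the same side. Hence [theta]
    and [eta] choose matching branches. *)
Let Dg z b : D (z, g (z, b)) <-> fromD (z, b).
Proof.
split.
  move=> [[|n] _]; first by rewrite /Dn/= /D0/= gK.
  rewrite /Dn iterS /= -/(Dn n) /hasback /back /= gK => -[[_ fb] Dnb]; split => //.
  by exists n.
rewrite /fromD /= => -[fb [n _ Dnb]]; exists n.+1 => //.
by rewrite /Dn iterS /= -/(Dn n) /hasback /back /= gK; split.
Qed.

(** [theta] is [f] on [D] and the inverse of [g] off [D]. Both branches transport P to Q once [f]
    carries P to Q and [g] carries Q to P, so the bijection inherits the transport for each value of
    the parameter. *)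
Lemma SB_bijection : exists (theta : Z * A -> B) (eta : Z * B -> A),
  [/\ measurable_fun setT theta, measurable_fun setT eta,
      forall z a, eta (z, theta (z, a)) = a,
      forall z b, theta (z, eta (z, b)) = b &
      forall (R : realType) z (P : probability A R) (Q : probability B R),
        (forall C, measurable C -> P [set a | C (f (z, a))] = Q C) ->
        (forall E, measurable E -> Q [set b | E (g (z, b))] = P E) ->
        forall C, measurable C -> P [set a | C (theta (z, a))] = Q C].
Proof.
exists theta, eta; split.
- by apply: measurable_fun_ifT => //; exact: measurable_mem.
- by apply: measurable_fun_ifT => //; exact: measurable_mem.
- move=> z a; rewrite /theta; case: ifPn => [|].
    rewrite inE => Da; rewrite /eta ifT ?fK// inE; split => /=; by rewrite fK.
  rewrite notin_setE => nDa.
  have ga : g (z, g' (z, a)) = a by apply: contrapT => nga; apply: nDa; exists 0.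
  rewrite /eta ifF//; apply/negbTE; rewrite notin_setE => /Dg.
  by rewrite ga.
- move=> z b; rewrite /eta; case: ifPn => [|].
    by rewrite inE => -[/= fb Db]; rewrite /theta ifT ?inE.
  rewrite notin_setE => nb; rewrite /theta ifF// ?gK//.
  by apply/negbTE; rewrite notin_setE => /Dg.
move=> R z P Q fP gQ C mC.
pose Dz := [set a | D (z, a)]; pose Fz := [set b | fromD (z, b)].
have mDz : measurable Dz.
  by apply: (measurable_preim (f := pair z)) => //; exact: measurable_fun_pair.
have mFz : measurable Fz.
  by apply: (measurable_preim (f := pair z)) => //; exact: measurable_fun_pair.
have mfz : measurable_fun setT (fun a => f (z, a)).
  by apply: measurableT_comp => //; exact: measurable_fun_pair.
have mgz : measurable_fun setT (fun a => g' (z, a)).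
  by apply: measurableT_comp => //; exact: measurable_fun_pair.
have -> : [set a | C (theta (z, a))] =
    [set a | (C `&` Fz) (f (z, a))] `|` (~` Dz `&` [set a | C (g' (z, a))]).
  apply/seteqP; split => a /=; rewrite /theta.
    case: ifPn => [|].
      by rewrite inE => Da Ca; left; split => //; split => /=; rewrite fK.
    by rewrite notin_setE; right.
  case=> [[Ca [/= _]]|[nDa Ca]].
    by rewrite fK => Da; rewrite ifT// inE.
  by rewrite ifF//; apply/negbTE; rewrite notin_setE.
rewrite measureU//; first last.
- apply/seteqP; split => // a [[_ [/= _]]]; rewrite fK => Da [nDa _].
  exact: nDa.
- by apply: measurableI; [exact: measurableC|exact: measurable_preim].
- by apply: measurable_preim => //; exact: measurableI.
(* The branch off [Dz] is measured on the side of B: [gQ] pulls it back along [g], where [gK] and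
   [Dg] turn it into the part of C outside [Fz]. *)
transitivity (Q (C `&` Fz) + Q (C `&` ~` Fz))%E.
  congr (_ + _)%E; first by apply: fP; exact: measurableI.
  transitivity (Q [set b | (~` Dz `&` [set a | C (g' (z, a))]) (g (z, b))]).
    apply/esym/gQ.
    by apply: measurableI; [exact: measurableC|exact: measurable_preim].
  congr (Q _); apply/seteqP; split => b /=; rewrite gK => -[].
    by move=> nD Cb; split=> // Fb; apply: nD; apply/Dg.
  by move=> Cb nF; split=> // Db; apply: nF; apply/Dg.
rewrite -measureU//.
- by rewrite -setIUr setUv setIT.
- exact: measurableI.
- by apply: measurableI => //; exact: measurableC.
- by rewrite setIACA setICr setI0.
Qed.

End SchroederBernstein.


Section Filtered.
Context (N : nat) (d : 'I_N -> measure_display)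
  (X : forall t : 'I_N, measurableType (d t)).

Definition Fgen (t : nat) : set (set (forall s, X s)) :=
  [set A | exists s : 'I_N, (s < t)%N /\
     exists B : set (X s), measurable B /\ A = (fun x => x s) @^-1` B].

(** One carrier with a separate measurable structure for each t: a map is adapted when it is
    measurable from [FM t] to [FM t] for all t. *)
Definition FM (t : nat) := g_sigma_algebraType (Fgen t).

Definition cyl (t : nat) (C : forall s, set (X s)) : set (forall s, X s) :=
  [set x | forall s : 'I_N, (s < t)%N -> C s (x s)].

Lemma measurable_coord (s : 'I_N) t : (s < t)%N ->
  measurable_fun [set: FM t] (fun x : FM t => (x : forall s, X s) s).
Proof.
move=> st _ B mB; rewrite setTI; apply: sub_sigma_algebra.
by exists s; split => //; exists B.
Qed.

Lemma measurable_FM d0 (Z : measurableType d0) t (f : Z -> FM t) :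
  (forall s : 'I_N, (s < t)%N -> measurable_fun setT (fun z => (f z : forall s, X s) s)) ->
  measurable_fun setT f.
Proof.
move=> mf; apply: (@measurability _ _ Z (FM t) setT f (Fgen t)) => //.
move=> _ [A [s [st [B [mB ->]]]] <-].
by apply: (mf s st measurableT).
Qed.

Lemma measurable_FM_id t t' : (t <= t')%N ->
  measurable_fun [set: FM t'] (fun x : FM t' => x : FM t).
Proof.
move=> tt'; apply: measurable_FM => s st.
by apply: measurable_coord; exact: leq_trans tt'.
Qed.

Lemma measurable_FM_le t t' (A : set (forall s, X s)) : (t <= t')%N ->
  measurable (A : set (FM t)) -> measurable (A : set (FM t')).
Proof. by move=> tt' mA; exact: (measurable_preim (measurable_FM_id tt') mA). Qed.

Lemma measurable_cyl t C : (forall s, measurable (C s)) ->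
  measurable (cyl t C : set (FM t)).
Proof.
move=> mC.
rewrite (_ : cyl t C = \bigcap_(s in [set s : 'I_N | (s < t)%N])
   [set x : FM t | C s ((x : forall s, X s) s)]); last first.
  by apply/seteqP; split => x.
apply: fin_bigcap_measurable => // s st.
exact: (measurable_preim (measurable_coord st)).
Qed.

Definition cyls t : set (set (forall s, X s)) :=
  [set A | exists C, (forall s, measurable (C s)) /\ A = cyl t C].

Lemma cylT t : cyl t (fun=> setT) = setT.
Proof. by apply/seteqP; split => x. Qed.

Lemma setI_closed_cyls t : setI_closed (cyls t).
Proof.
move=> _ _ [C1 [m1 ->]] [C2 [m2 ->]]; exists (fun s => C1 s `&` C2 s); split.
  by move=> s; exact: measurableI.
apply/seteqP; split => x.
  by move=> [c1 c2] s st; split; [exact: c1|exact: c2].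
by move=> c; split => s st; have [] := c s st.
Qed.

Lemma FM_cyls t : @measurable _ (FM t) = <<s cyls t >>.
Proof.
apply/seteqP; split.
  apply: smallest_sub; first exact: smallest_sigma_algebra.
  move=> _ [s [st [B [mB ->]]]]; apply: sub_sigma_algebra.
  (* A constraint on the coordinate s alone is the box that is full in every other coordinate; the
     transport is there because the factor type depends on the index. *)
  exists (fun s' => match pselect (s = s') with
    | left e => eq_rect s (fun s => set (X s)) B s' e | right _ => setT end); split.
    by move=> s'; case: pselect => // e; case: _ / e.
  apply/seteqP; split => x /=.
    by move=> Bx s' _; case: pselect => // e; case: _ / e.
  move/(_ s st); case: pselect => // e.
  by rewrite (Prop_irrelevance e erefl).
apply: smallest_sub; first exact: sigma_algebra_measurable.
by move=> _ [C [mC ->]]; exact: measurable_cyl.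
Qed.

Lemma FM_measure_unique (R : realType) t (m1 m2 : {measure set (FM t) -> \bar R}) :
  (m1 setT < +oo)%E ->
  (forall C, (forall s, measurable (C s)) -> m1 (cyl t C) = m2 (cyl t C)) ->
  forall A, measurable A -> m1 A = m2 A.
Proof.
move=> m1T m12; apply: (@measure_unique _ R (FM t) (cyls t) (fun=> setT)) => //.
- exact: FM_cyls.
- exact: setI_closed_cyls.
- by move=> _; exists (fun=> setT); rewrite cylT; split.
- by rewrite bigcup_const//; exists 0.
- by move=> _ [C [mC ->]]; exact: m12.
Qed.

(** The sets that do not separate x from y form a sigma-algebra, and it contains the generators of
    [FM t]. *)
Lemma FM_dep t (A : set (forall s, X s)) x y : measurable (A : set (FM t)) ->
  (forall s : 'I_N, (s < t)%N -> x s = y s) -> A x -> A y.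
Proof.
move=> mA xy.
pose G : set (set (forall s, X s)) := [set A | A x <-> A y].
have : @measurable _ (FM t) `<=` G.
  apply: smallest_sub; last first.
    by move=> _ [s [st [B [mB ->]]]]; rewrite /G/= xy.
  split => //=.
  - by move=> B GB; split => -[_ nB]; split => // /GB.
  - by move=> F GF; split => -[n _ Fn]; exists n => //; apply/GF.
by move=> /(_ _ mA) [+ _].
Qed.

Lemma FM_dep_fun (R : realType) t (f : FM t -> R) x y : measurable_fun setT f ->
  (forall s : 'I_N, (s < t)%N -> x s = y s) -> f x = f y.
Proof.
move=> mf xy.
have := FM_dep (measurable_preim mf (measurable_set1 (f x))) xy.
by move=> /(_ erefl) ->.
Qed.

End Filtered.

Section Triangular.
Context (N : nat) (d d' : 'I_N -> measure_display)
  (X : forall t : 'I_N, measurableType (d t))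
  (Y : forall t : 'I_N, measurableType (d' t)).
Variable g : forall t : 'I_N, (forall s, X s) -> (forall s, Y s) -> Y t.
Hypothesis mg : forall t : 'I_N,
  measurable_fun setT (fun p : FM X t.+1 * FM Y t => g t p.1 p.2).
Hypothesis dg : forall (t : 'I_N) x y y',
  (forall s : 'I_N, (s < t)%N -> y s = y' s) -> g t x y = g t x y'.

Let G x (y : forall s, Y s) : forall s, Y s := fun t => g t x y.

Lemma triangular_uniq x y y' : (forall t, y t = g t x y) ->
  (forall t, y' t = g t x y') -> y = y'.
Proof.
move=> yg y'g.
have H n (t : 'I_N) : (t < n)%N -> y t = y' t.
  elim: n t => // n IH t tn; rewrite yg y'g; apply: dg => s st; apply: IH.
  exact: leq_trans st _.
apply/functional_extensionality_dep => t; exact: (H N).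
Qed.

(** Coordinate t of the equation involves only earlier coordinates of the unknown, so n iterations
    from any starting point settle the coordinates below n. Adaptedness follows because [g t] sees x
    up to time t and y strictly before t. *)
Lemma triangular_map : exists H : (forall s, X s) -> (forall s, Y s),
  (forall x t, H x t = g t x (H x)) /\
  (forall t : nat, measurable_fun [set: FM X t] (H : FM X t -> FM Y t)).
Proof.
pose H x := iter N (G x) (fun s => point).
have HG x t : H x t = g t x (H x).
  have st n (s : 'I_N) : (s < n)%N ->
      iter n.+1 (G x) (fun s => point) s = iter n (G x) (fun s => point) s.
    elim: n s => // n IH s sn; apply: dg => s' s's.
    by apply: IH; exact: leq_trans s's _.
  by rewrite -[LHS]st//.
exists H; split => // t.
(* Induction on the number n of output coordinates known to be measurable: the equation [HG]
   expresses the next one through x and the earlier ones. *)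
have mH n : forall t, measurable_fun [set: FM X t] (fun x : FM X t => H x : FM Y (minn n t)).
  elim: n => [t'|n IH t']; first by apply: measurable_FM => s; rewrite min0n.
  apply: measurable_FM => s; rewrite leq_min => /andP[sn st'].
  have m1 : measurable_fun [set: FM X t'] (fun x : FM X t' => H x : FM Y s).
    apply: (@measurableT_comp _ _ _ (FM X t') (FM Y (minn n t')) (FM Y s) id _ _ _ (IH t')).
    by apply: measurable_FM_id; rewrite leq_min -ltnS sn/= ltnW.
  have m2 : measurable_fun [set: FM X t'] (fun x : FM X t' => (x : FM X s.+1, H x : FM Y s)).
    by apply: measurable_fun_pair m1; exact: measurable_FM_id.
  rewrite (_ : (fun z : FM X t' => _) = (fun x => g s x (H x))); last first.
    by apply/funext => x; exact: HG.
  exact: (measurableT_comp (@mg s) m2).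
by have := mH t t; rewrite minnn.
Qed.

End Triangular.

Section ImageMeasure.
Context d1 d2 (T1 : measurableType d1) (T2 : measurableType d2) (R : realType).
Variables (m : {measure set T1 -> \bar R}) (P : probability T1 R) (f : T1 -> T2).
Hypothesis mf : measurable_fun setT f.

Definition imagem (_ : measurable_fun setT f) : set T2 -> \bar R :=
  fun A => m [set x | A (f x)].

Let imagem0 : imagem mf set0 = 0%E.
Proof. by rewrite /imagem (_ : mkset _ = set0) ?measure0. Qed.
Let imagem_ge0 A : (0 <= imagem mf A)%E. Proof. exact: measure_ge0. Qed.
Let imagem_sigma : semi_sigma_additive (imagem mf).
Proof.
exact: (@measure_semi_sigma_additive _ _ R
  (@measure_function_pushforward__canonical__measure_function_Measure _ _ _ _ R m f mf)).
Qed.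
HB.instance Definition _ := isMeasure.Build _ _ R (imagem mf) imagem0 imagem_ge0 imagem_sigma.

End ImageMeasure.

Section ImageProbability.
Context d1 d2 (T1 : measurableType d1) (T2 : measurableType d2) (R : realType).
Variables (P : probability T1 R) (f : T1 -> T2) (mf : measurable_fun setT f).

Definition imagep_ (_ : measurable_fun setT f) : set T2 -> \bar R := imagem P mf.
HB.instance Definition _ := Measure.on (imagep_ mf).
Let imagepT : imagep_ mf setT = 1%E. Proof. exact: probability_setT. Qed.
HB.instance Definition _ := @Measure_isProbability.Build _ _ R (imagep_ mf) imagepT.
Definition imagep : probability T2 R := imagep_ mf.

Lemma imagepE A : imagep A = P [set x | A (f x)]. Proof. by []. Qed.

End ImageProbability.
Arguments imagem {d1 d2 T1 T2 R} m {f} _ _.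
Arguments imagep {d1 d2 T1 T2 R} P {f} mf.

(** * Quantile transforms of kernels *)

Section UniformLaw.
Context (R : realType).

(** The uniform law of [0, 1) viewed on the whole line, because the coordinates of the bijective
    transform range over all of R; the rest of the line is a null set. *)
Definition rho_ : set R -> \bar R :=
  fun A => lebesgue_measure (A `&` `[0, 1[%classic).

Let mI : measurable (`[0, 1[%classic : set (measurableTypeR R)).
Proof. exact: measurable_itv. Qed.

Let rho0 : rho_ set0 = 0%E. Proof. by rewrite /rho_ set0I measure0. Qed.
Let rho_ge0 A : (0 <= rho_ A)%E. Proof. exact: measure_ge0. Qed.
Let rho_sigma : semi_sigma_additive rho_.
Proof.
exact: (@measure_semi_sigma_additive _ _ R (mrestr (@lebesgue_measure R) mI)).
Qed.
HB.instance Definition _ := isMeasure.Build _ R R rho_ rho0 rho_ge0 rho_sigma.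

Let rhoT : rho_ setT = 1%E.
Proof.
by rewrite /rho_ setTI lebesgue_measure_itv/= lte_fin ltr01 oppr0 adde0.
Qed.
HB.instance Definition _ := @Measure_isProbability.Build _ R R rho_ rhoT.

Definition rho : probability R R := rho_.

Lemma rhoE A : rho A = lebesgue_measure (A `&` `[0, 1[%classic).
Proof. by []. Qed.

End UniformLaw.
Arguments rho {R}.

Section ProbContinuity.
Context d (T : measurableType d) (R : realType) (P : probability T R).

Lemma prob_bigcup_gt (E : nat -> set T) (c : \bar R) :
  (forall n, measurable (E n)) -> (forall n m, (n <= m)%N -> E n `<=` E m) ->
  (c < P (\bigcup_n E n))%E -> exists n, (c < P (E n))%E.
Proof.
move=> mE ndE cP; apply: contrapT => /forallNP h.
have := @nondecreasing_cvg_mu _ _ _ P E mE (bigcup_measurable (fun n _ => mE n)).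
move=> /(_ (fun n m nm => introT (subsetPset _ _) (ndE _ _ nm))) cv.
have := cvg_lim (@ereal_hausdorff R) cv => lE.
have : (lim ((P \o E) @ \oo) <= c)%E.
  apply: lime_le; first by apply/cvg_ex; eexists; exact: cv.
  by apply: nearW => n /=; rewrite leNgt; apply/negP; exact: h.
by rewrite lE leNgt cP.
Qed.

Lemma prob_bigcap_lt (E : nat -> set T) (c : \bar R) :
  (forall n, measurable (E n)) -> (forall n m, (n <= m)%N -> E m `<=` E n) ->
  (P (\bigcap_n E n) < c)%E -> exists n, (P (E n) < c)%E.
Proof.
move=> mE niE cP; apply: contrapT => /forallNP h.
have := @nonincreasing_cvg_mu _ _ _ P E (le_lt_trans (probability_le1 P (mE 0%N)) (ltry 1)) mE
  (bigcapT_measurable mE).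
move=> /(_ (fun n m nm => introT (subsetPset _ _) (niE _ _ nm))) cv.
have := cvg_lim (@ereal_hausdorff R) cv => lE.
have : (c <= lim ((P \o E) @ \oo))%E.
  apply: lime_ge; first by apply/cvg_ex; eexists; exact: cv.
  by apply: nearW => n /=; rewrite leNgt; apply/negP; exact: h.
by rewrite lE leNgt cP.
Qed.

Lemma prob_fin (A : set T) : measurable A -> P A \is a fin_num.
Proof. by move=> mA; exact: fin_num_measure. Qed.

End ProbContinuity.

Lemma prob_ray_unique (R : realType) (P Q : probability R R) :
  (forall a : R, P `]-oo, a]%classic = Q `]-oo, a]%classic) ->
  forall A, measurable A -> P A = Q A.
Proof.
move=> PQ.
apply: (@measure_unique _ R R [set `]-oo, a]%classic | a in [set: R]]
   (fun n => `]-oo, n%:R]%classic)).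
- have -> : @measurable _ R = <<s @RGenOInfty.G R >> by exact: RGenOInfty.measurableE.
  apply/seteqP; split.
    apply: smallest_sub; first exact: smallest_sigma_algebra.
    move=> _ [a ->]; rewrite -setCitvl.
    apply: sigma_algebraC.
    by apply: sub_sigma_algebra; exists a.
  apply: smallest_sub; first exact: smallest_sigma_algebra.
  move=> _ [a _ <-]; rewrite -[X in _ X]setCK setCitvl.
  apply: sigma_algebraC.
  by apply: sub_sigma_algebra; exists a.
- move=> _ _ [a _ <-] [b _ <-]; exists (Num.min a b) => //.
  by apply/seteqP; split => x /=; rewrite !in_itv/= le_min => /andP.
- by move=> n; exists n%:R.
- apply/seteqP; split => // x _.
  exists (Num.bound `|x|) => //=; rewrite in_itv/=.
  by rewrite (le_trans (ler_norm x))// ltW// archi_boundP.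
- by move=> _ [a _ <-]; exact: PQ.
- by move=> n; rewrite (le_lt_trans (probability_le1 _ _)) ?ltry.
Qed.

Lemma measurable_fun_le_rays d (T : measurableType d) (R : realType) (f : T -> R) :
  (forall a, measurable [set x | f x <= a]) -> measurable_fun setT f.
Proof.
move=> mf; apply: (@measurability _ _ T R setT f (@RGenOInfty.G R)).
  exact: RGenOInfty.measurableE.
move=> _ [_ [a ->] <-]; rewrite setTI.
rewrite (_ : _ @^-1` _ = ~` [set x | f x <= a]); first exact: measurableC.
by apply/seteqP; split => x /=; rewrite in_itv/= andbT ltNge => /negP.
Qed.

Lemma measurable_fun_lt_rays d (T : measurableType d) (R : realType) (f : T -> R) :
  (forall a, measurable [set x | f x < a]) -> measurable_fun setT f.
Proof.
move=> mf; apply: (@measurability _ _ T R setT f (@RGenCInfty.G R)).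
  exact: RGenCInfty.measurableE.
move=> _ [_ [a ->] <-]; rewrite setTI.
rewrite (_ : _ @^-1` _ = ~` [set x | f x < a]); first exact: measurableC.
by apply/seteqP; split => x /=; rewrite in_itv/= andbT leNgt => /negP.
Qed.

Section Quantile.
Context (R : realType) d (Z : measurableType d) (k : Z -> probability R R).
Hypothesis mk : forall B, measurable B -> measurable_fun setT (fun z => k z B).
Hypothesis k0 : forall z a, k z [set a] = 0%E.

Definition kcdf (z : Z) (a : R) : R := fine (k z `]-oo, a]%classic).
(** At levels outside (0, 1) the set of admissible points can be empty or unbounded below, hence the
    default value; [rho] gives these levels mass zero. *)
Definition kquant (z : Z) (u : R) : R :=
  if (0 < u) && (u < 1) then inf [set a | u <= kcdf z a] else 0.

Let kfin z a : k z `]-oo, a]%classic = (kcdf z a)%:E.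
Proof. by rewrite /kcdf fineK// prob_fin. Qed.

Lemma kcdf_nd z a b : a <= b -> kcdf z a <= kcdf z b.
Proof.
move=> ab; rewrite -lee_fin -!kfin le_measure ?inE//.
by move=> x /=; rewrite !in_itv/= => /le_trans; apply.
Qed.

Lemma kcdf_ge0 z a : 0 <= kcdf z a.
Proof. by rewrite -lee_fin -kfin. Qed.

Lemma kcdf_le1 z a : kcdf z a <= 1.
Proof. by rewrite -lee_fin -kfin probability_le1. Qed.

Lemma kcdf_right z a c : kcdf z a < c -> exists2 b, a < b & kcdf z b < c.
Proof.
move=> Fc.
have [n En] : exists n : nat, (k z `]-oo, (a + n.+1%:R^-1)%R]%classic < c%:E)%E.
  apply: prob_bigcap_lt => //.
    move=> n m nm x /=; rewrite !in_itv/= => /le_trans; apply.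
    by rewrite lerD2l lef_pV2 ?posrE ?ltr0n// ler_nat ltnS.
  rewrite [X in k z X](_ : _ = `]-oo, a]%classic) ?kfin//.
  apply/seteqP; split => x /=; rewrite in_itv/=.
    move=> h; apply/ler_addgt0Pr => e e0.
    have [n ne] : exists n : nat, n.+1%:R^-1 < e.
      by have [n] := ltr_add_invr e0; rewrite add0r; exists n.
    have := h n I; rewrite /= in_itv/= => /le_trans; apply.
    by rewrite lerD2l ltW.
  move=> xa n _ /=; rewrite in_itv/= (le_trans xa)// lerDl invr_ge0//.
exists (a + n.+1%:R^-1); first by rewrite ltrDl invr_gt0 ltr0n.
by rewrite -lte_fin -kfin.
Qed.

(** Left continuity, which is the absence of atoms; it turns the quantile into an exact section of
    the distribution function in [kquantK]. *)
Lemma kcdf_left z a c : c < kcdf z a -> exists2 b, b < a & c < kcdf z b.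
Proof.
move=> Fc.
have [n En] : exists n : nat, (c%:E < k z `]-oo, (a - n.+1%:R^-1)%R]%classic)%E.
  apply: prob_bigcup_gt => //.
    move=> n m nm x /=; rewrite !in_itv/= => /le_trans; apply.
    by rewrite lerD2l lerN2 lef_pV2 ?posrE ?ltr0n// ler_nat ltnS.
  rewrite [X in k z X](_ : _ = `]-oo, a[%classic).
    have : (k z (`]-oo, a[%classic `|` [set a]) = k z `]-oo, a[%classic + k z [set a])%E.
      rewrite measureU//; apply/seteqP; split => // x /= [].
      by rewrite in_itv/= => xa ax; move: xa; rewrite ax ltxx.
    rewrite k0 adde0 => <-.
    rewrite [X in k z X](_ : _ = `]-oo, a]%classic) ?kfin ?lte_fin//.
    apply/seteqP; split => x /=; rewrite !in_itv/=.
      by case=> [/ltW|->].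
    by rewrite le_eqVlt => /orP[/eqP ->|]; [right|left].
  apply/seteqP; split => x /=; rewrite in_itv/=.
    move=> [n _ /=]; rewrite in_itv/= => /le_lt_trans; apply.
    by rewrite ltrBlDr ltrDl invr_gt0.
  move=> xa; have [n] := ltr_add_invr xa.
  by exists n => //=; rewrite in_itv/= lerBrDr ltW.
exists (a - n.+1%:R^-1); first by rewrite ltrBlDr ltrDl invr_gt0 ltr0n.
by rewrite -lte_fin -kfin.
Qed.

Lemma kcdf_lt1 z c : c < 1 -> exists a, c < kcdf z a.
Proof.
move=> c1.
have [n En] : exists n : nat, (c%:E < k z `]-oo, n%:R]%classic)%E.
  apply: prob_bigcup_gt => //.
    by move=> n m nm x /=; rewrite !in_itv/= => /le_trans; apply; rewrite ler_nat.
  rewrite [X in k z X](_ : _ = setT) ?probability_setT ?lte_fin//.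
  apply/seteqP; split => // x _; exists (Num.bound `|x|) => //=; rewrite in_itv/=.
  by rewrite (le_trans (ler_norm x))// ltW// archi_boundP.
by exists n%:R; rewrite -lte_fin -kfin.
Qed.

Lemma kcdf_gt0 z c : 0 < c -> exists a, kcdf z a < c.
Proof.
move=> c1.
have [n En] : exists n : nat, (k z `]-oo, (- n%:R)%R]%classic < c%:E)%E.
  apply: prob_bigcap_lt => //.
    by move=> n m nm x /=; rewrite !in_itv/= => /le_trans; apply; rewrite lerN2 ler_nat.
  rewrite [X in k z X](_ : _ = set0) ?measure0 ?lte_fin//.
  apply/seteqP; split => // x /(_ (Num.bound `|x|) I) /=; rewrite in_itv/= => h.
  have := archi_boundP (normr_ge0 x); rewrite ltNge => /negP; apply.
  by rewrite -[X in _ <= X]normrN (le_trans _ (ler_norm _))// lerNr.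
by exists (- n%:R); rewrite -lte_fin -kfin.
Qed.

Lemma kquantP z u a : 0 < u -> u < 1 -> (kquant z u <= a) = (u <= kcdf z a).
Proof.
move=> u0 u1; rewrite /kquant u0 u1/=.
have [b0 Fb0] := kcdf_gt0 z u0; have [b1 Fb1] := kcdf_lt1 z u1.
have lb b : kcdf z b < u -> lbound [set a | u <= kcdf z a] b.
  move=> Fb x /= ux; rewrite leNgt; apply/negP => xb.
  by have := le_lt_trans (le_trans ux (kcdf_nd z (ltW xb))) Fb; rewrite ltxx.
apply/idP/idP => [|ua].
  apply: contraTT; rewrite -!ltNge => /kcdf_right[b ab /lb lbb].
  by apply: lt_le_trans ab _; apply: lb_le_inf => //; exists b1; exact: ltW.
by apply: ge_inf => //; exists b0; exact: lb.
Qed.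

Lemma kquantK z u : 0 < u -> u < 1 -> kcdf z (kquant z u) = u.
Proof.
move=> u0 u1; apply/eqP; rewrite eq_le; apply/andP; split; last first.
  by rewrite -kquantP.
rewrite leNgt; apply/negP => /kcdf_left[b bq ub].
by move: bq; rewrite ltNge kquantP// ltW.
Qed.

(** Joint measurability follows from measurability in z alone: by right continuity, a value below c
    persists at some rational point to the right. *)
Lemma measurable_kcdf : measurable_fun setT (fun p : Z * R => kcdf p.1 p.2).
Proof.
apply: measurable_fun_lt_rays => c.
rewrite (_ : mkset _ = \bigcup_(q : rat) ([set z | kcdf z (ratr q) < c] `*`
   [set a | a <= ratr q])); last first.
  apply/seteqP; split => -[z a] /=.
    move=> /kcdf_right[b ab Fb].
    have [q] := rat_in_itvoo ab; rewrite in_itv/= => /andP[aq qb].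
    exists q => //=; split => /=; last exact: ltW.
    by rewrite (le_lt_trans _ Fb)// kcdf_nd// ltW.
  move=> [q _ [/= Fq aq]].
  by rewrite (le_lt_trans _ Fq)// kcdf_nd.
apply: bigcupT_measurable_rat => q; apply: measurableX.
  rewrite (_ : mkset _ = [set z | (k z `]-oo, ratr q]%classic < c%:E)%E]); last first.
    by apply/seteqP; split => z /=; rewrite kfin lte_fin.
  rewrite -[X in measurable X]setTI; apply: emeasurable_fun_infty_o => //.
  exact: mk.
by rewrite (_ : mkset _ = `]-oo, ratr q]%classic).
Qed.

Lemma measurable_kquant : measurable_fun setT (fun p : Z * R => kquant p.1 p.2).
Proof.
have m01 : measurable ([set p : Z * R | (0 < p.2) && (p.2 < 1)]).
  rewrite (_ : mkset _ = setT `*` `]0, 1[%classic); first exact: measurableX.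
  by apply/seteqP; split => p /=; rewrite in_itv/= => //; case.
apply: measurable_fun_le_rays => a.
rewrite (_ : mkset _ = ([set p : Z * R | (0 < p.2) && (p.2 < 1)] `&`
   [set p : Z * R | p.2 <= kcdf p.1 a]) `|`
   (~` [set p : Z * R | (0 < p.2) && (p.2 < 1)] `&`
   [set p : Z * R | 0 <= a])); last first.
  apply/seteqP; split => -[z u] /=.
    have [/andP[u0 u1]|h] := boolP ((0 < u) && (u < 1)).
      by rewrite kquantP//; left.
    by rewrite /kquant (negbTE h); right; split => //; apply/negP.
  case=> [[/andP[u0 u1]]|[/negP h]].
    by rewrite kquantP.
  by rewrite /kquant (negbTE h).
apply: measurableU; apply: measurableI => //.
- have m1 : measurable_fun setT (fun p : Z * R => kcdf p.1 a).
    apply: (measurableT_comp measurable_kcdf (g := fun p : Z * R => (p.1, a))).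
    exact: measurable_fun_pair.
  have m2 : measurable_fun setT (fun p : Z * R => p.2) by exact: measurable_snd.
  have := measurable_fun_ler m2 m1 measurableT (Y := [set true]) I.
  by rewrite setTI; congr measurable.
- exact: measurableC.
- by case: (0 <= a) => /=; [rewrite (_ : mkset _ = setT)|rewrite (_ : mkset _ = set0)];
    rewrite //; apply/seteqP; split.
Qed.

Lemma kquant_law z A : measurable A -> rho [set u | A (kquant z u)] = k z A.
Proof.
move=> mA.
have mq : measurable_fun setT (kquant z).
  apply: (measurableT_comp measurable_kquant (g := fun u => (z, u))).
  exact: measurable_fun_pair.
pose mq' : {mfun R >-> R} := mfun_Sub (mem_set mq).
pose P : probability R R := distribution rho mq'.
suff : P A = k z A by [].
apply: prob_ray_unique mA => a; rewrite kfin.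
have -> : P `]-oo, a]%classic = rho [set u | kquant z u <= a].
  by congr (rho_ _); apply/seteqP; split => u /=; rewrite in_itv.
have mS : measurable ([set u | kquant z u <= a] `&` `[0, 1[%classic).
  apply: measurableI => //.
  rewrite (_ : mkset _ = [set u | `]-oo, a]%classic (kquant z u)]).
    exact: measurable_preim.
  by apply/seteqP; split => u /=; rewrite in_itv.
(* The default values at the ends of the level interval are avoided by squeezing the event between
   an open and a closed interval of the same length. *)
rewrite rhoE; apply/eqP; rewrite eq_le; apply/andP; split.
- apply: (@le_trans _ _ (lebesgue_measure `[0, kcdf z a]%classic)).
    apply: le_measure; rewrite ?inE//.
    move=> u /=; rewrite !in_itv/= => -[qa /andP[u0 u1]]; rewrite u0/=.
    move: u0; rewrite le_eqVlt => /orP[/eqP <-|u0]; first exact: kcdf_ge0.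
    by rewrite -kquantP.
  rewrite lebesgue_measure_itv/= lte_fin; case: ifPn => // _.
    by rewrite oppr0 adde0.
  by rewrite lee_fin kcdf_ge0.
- apply: (@le_trans _ _ (lebesgue_measure `]0, kcdf z a[%classic)).
    rewrite lebesgue_measure_itv/= lte_fin; case: ifPn => [_|].
      by rewrite oppr0 adde0.
    by rewrite -leNgt lee_fin.
  apply: le_measure; rewrite ?inE//.
  move=> u /=; rewrite !in_itv/= => /andP[u0 uF].
  have u1 := lt_le_trans uF (kcdf_le1 z a).
  by rewrite kquantP// !ltW.
Qed.

End Quantile.

(** * Borel codings of Polish spaces *)

Lemma lebesgue_affine (R : realType) (a b : R) (A : set R) : 0 < a -> measurable A ->
  (a%:E * lebesgue_measure [set v | A (a * v + b)%R])%E = lebesgue_measure A.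
Proof.
move=> a0 mA.
have mf : measurable_fun setT ((fun v => a * v + b) : measurableTypeR R -> measurableTypeR R).
  have : measurable_fun setT (fun v : R => a * v + b).
    by apply: measurable_funD => //; exact: measurable_funM.
  by [].
pose m := mscale (NngNum (ltW a0)) (imagem (@lebesgue_measure R) mf).
suff : lebesgue_measure A = m A by move=> ->.
apply: lebesgue_measure_unique => // _ [[x y] _ <-].
change (lebesgue_measure `]x, y]%classic =
  (a%:E * lebesgue_measure [set v : R | `]x, y]%classic (a * v + b)%R])%E).
have -> : [set v | `]x, y]%classic (a * v + b)] = `](x - b) / a, (y - b) / a]%classic.
  apply/seteqP; split => v /=; rewrite !in_itv/= => /andP[].
    by move=> h1 h2; rewrite ltr_pdivrMr// ler_pdivlMr//; lra.
  by rewrite ltr_pdivrMr// ler_pdivlMr// => h1 h2; lra.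
rewrite !lebesgue_measure_itv/= !lte_fin ltr_pM2r ?invr_gt0// ltrD2r.
case: ifPn => _; last by rewrite mule0.
by rewrite -!EFinD -EFinM; congr EFin; field; rewrite gt_eqF.
Qed.

(** * The ternary Cantor set and its digits *)

Section Cantor.
Context (R : realType).
Implicit Types (s : nat -> bool) (v : R).

(** Partial sums, in Horner form, of the ternary expansion with digits 0 and 2 given by the bits of
    s; they increase, so the limit is written as a supremum. *)
Fixpoint cpart n s : R :=
  if n is n'.+1 then (2 * (s 0%N)%:R + cpart n' (fun i => s i.+1)) / 3 else 0.
Definition cval s : R := sup [set cpart n s | n in [set: nat]].
(** The shift of ternary expansions: the threshold 1/2 separates leading digit 0 from leading digit
    2. [cset] is the set of points whose whole orbit stays in [0, 1]. *)
Definition cstep v : R := 3 * v - 2 * (2^-1 < v)%R%:R.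
Definition cbit (i : nat) v : bool := 2^-1 < iter i cstep v.
Definition cset : set R := [set v | forall i, 0 <= iter i cstep v <= 1].

Lemma cpart01 n s : 0 <= cpart n s <= 1.
Proof.
elim: n s => [|n IH] s /=; first by rewrite lexx ler01.
by have /andP[? ?] := IH (fun i => s i.+1); case: (s 0%N) => /=; lra.
Qed.

Lemma cval_leP s v : (cval s <= v) <-> (forall n, cpart n s <= v).
Proof.
have ub : has_ubound [set cpart n s | n in [set: nat]].
  by exists 1 => _ [n _ <-]; have /andP[] := cpart01 n s.
split => [sv n|h].
  by apply: le_trans sv; apply: ub_le_sup => //; exists n.
by apply: ge_sup => [|_ [n _ <-]//]; exists (cpart 0 s), 0%N.
Qed.

Lemma cval01 s : 0 <= cval s <= 1.
Proof.
apply/andP; split; last by apply/cval_leP => n; have /andP[] := cpart01 n s.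
by have /cval_leP/(_ 0%N) := lexx (cval s).
Qed.

Lemma cvalS s : cval s = (2 * (s 0%N)%:R + cval (fun i => s i.+1)) / 3.
Proof.
apply/eqP; rewrite eq_le; apply/andP; split.
  apply/cval_leP => -[|n] /=.
    by have /andP[? ?] := cval01 (fun i => s i.+1); case: (s 0%N) => /=; lra.
  have /cval_leP/(_ n) := lexx (cval (fun i => s i.+1)).
  by move=> ?; rewrite ler_pM2r ?invr_gt0// lerD2l.
rewrite ler_pdivrMr// -lerBrDl; apply/cval_leP => n.
by have /cval_leP/(_ n.+1)/= := lexx (cval s); lra.
Qed.

Lemma cval_gt2 s : (2^-1 < cval s) = s 0%N.
Proof.
rewrite cvalS; have /andP[? ?] := cval01 (fun i => s i.+1).
by case: (s 0%N) => /=; [apply/idP; lra|apply/negbTE; rewrite -leNgt; lra].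
Qed.

Lemma iter_cstep_cval i s : iter i cstep (cval s) = cval (fun j => s (i + j)%N).
Proof.
elim: i s => // i IH s; rewrite iterSr.
have -> : cstep (cval s) = cval (fun j => s j.+1).
  by rewrite /cstep cval_gt2 cvalS; field.
by rewrite IH; congr cval; apply/funext => j; rewrite addSn.
Qed.

Lemma cbit_cval i s : cbit i (cval s) = s i.
Proof. by rewrite /cbit iter_cstep_cval cval_gt2 addn0. Qed.

Lemma cset_cval s : cset (cval s).
Proof. by move=> i; rewrite iter_cstep_cval cval01. Qed.

Lemma measurable_cstep : measurable_fun setT cstep.
Proof.
apply: measurable_funB; first exact: measurable_funM.
apply: measurable_funM => //.
have -> : (fun v : R => (2^-1 < v)%R%:R : R) = (fun v => if 2^-1 < v then 1 else 0).
  by apply/funext => v; case: ifP.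
by apply: measurable_fun_ifT => //; exact: measurable_fun_ltr.
Qed.

Lemma measurable_iter_cstep i : measurable_fun setT (iter i cstep).
Proof.
elim: i => [|i IH]; first exact: measurable_id.
exact: (measurableT_comp measurable_cstep IH).
Qed.

Lemma measurable_cbit i : measurable [set v | cbit i v].
Proof.
have := measurable_fun_ltr (measurable_cst (2^-1 : R)) (measurable_iter_cstep i) measurableT (Y := [set true]) I.
by rewrite setTI; congr measurable.
Qed.

Lemma measurable_cval d (T : measurableType d) (b : T -> nat -> bool) :
  (forall i, measurable [set x | b x i]) -> measurable_fun setT (fun x => cval (b x)).
Proof.
move=> mb; apply: measurable_fun_le_rays => a.
have -> : [set x | cval (b x) <= a] = \bigcap_n [set x | cpart n (b x) <= a].
  apply/seteqP; split => x /=.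
    by move=> /cval_leP h n _; exact: h.
  by move=> h; apply/cval_leP => n; exact: h.
apply: bigcapT_measurable => n.
have mc : measurable_fun setT (fun x => cpart n (b x)).
  elim: n b mb => [|n IH] b mb /=; first exact: measurable_cst.
  apply: measurable_funM => //; apply: measurable_funD; last exact: IH.
  apply: measurable_funM => //.
  have -> : (fun x => (b x 0%N)%:R : R) = (fun x => if b x 0%N then 1 else 0).
    by apply/funext => v; case: ifP.
  apply: measurable_fun_ifT => //; apply: (measurable_fun_bool true).
  by rewrite setTI; exact: mb.
have := measurable_fun_ler mc (measurable_cst a) measurableT (Y := [set true]) I.
by rewrite setTI; congr measurable.
Qed.

Lemma measurable_cset : measurable cset.
Proof.
have -> : cset = \bigcap_i [set v | `[0, 1]%classic (iter i cstep v)].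
  apply/seteqP; split => v /= h i; last by have := h i I; rewrite /= in_itv.
  by move=> _ /=; rewrite in_itv; exact: h.
apply: bigcapT_measurable => i.
apply: (measurable_preim (measurable_iter_cstep i)); exact: measurable_itv.
Qed.

(* Self-similarity: the Cantor set is covered by two copies of itself scaled by 1/3. *)
Lemma cset_null : lebesgue_measure cset = 0%E.
Proof.
have fin : (lebesgue_measure cset <= 1)%E.
  apply: (@le_trans _ _ (lebesgue_measure `[(0 : R), 1]%classic)).
    apply: le_measure; rewrite ?inE//; first exact: measurable_cset.
    by move=> v /(_ 0%N) /=; rewrite in_itv.
  by rewrite lebesgue_measure_itv/= lte_fin ltr01 oppr0 adde0.
pose T (b : R) := [set v : R | cset (3 * v + b)].
have mT b : measurable (T b).
  apply: (measurable_preim (f := fun v : R => 3 * v + b)); last exact: measurable_cset.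
  by apply: measurable_funD => //; exact: measurable_funM.
have lT b : (3%:E * lebesgue_measure (T b))%E = lebesgue_measure cset.
  by apply: lebesgue_affine => //; exact: measurable_cset.
have sub : cset `<=` T 0 `|` T (- 2).
  move=> v cv.
  have cs : cset (cstep v) by move=> i; have := cv i.+1; rewrite iterSr.
  move: cs; rewrite /cstep; case: (2^-1 < v) => /=.
    by rewrite mulr1; right.
  by rewrite mulr0 subr0; left; rewrite /T/= addr0.
have : (lebesgue_measure cset <= lebesgue_measure (T 0%R) + lebesgue_measure (T (- 2)%R))%E.
  apply: (@le_trans _ _ (lebesgue_measure (T 0%R `|` T (- 2)%R))).
    apply: le_measure => //; rewrite inE; first exact: measurable_cset.
    by apply: measurableU; exact: mT.
  by apply: measureU2; exact: mT.
have [c E] : exists c, lebesgue_measure cset = c%:E.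
  exists (fine (lebesgue_measure cset)); rewrite fineK// ge0_fin_numE//.
  exact: le_lt_trans fin (ltry 1).
have lT' b : lebesgue_measure (T b) = (c / 3)%:E.
  move: (lT b); rewrite E; case: (lebesgue_measure (T b)) => [x| |] /=.
  - by rewrite -EFinM => -[h]; congr EFin; lra.
  - by rewrite mulry gtr0_sg// mul1e.
  - by rewrite mulrNy gtr0_sg// mul1e.
rewrite !lT' E -EFinD lee_fin => h; congr EFin.
have : 0 <= c by rewrite -lee_fin -E.
by lra.
Qed.

End Cantor.

Section PolishCode.
Context (R : realType) (T : ptopologicalType).
Hypothesis polT : polish R T.

Lemma polish_seq (d : T -> T -> R) : compatible_metric d ->
  exists q : nat -> T, forall x e, 0 < e -> exists n, d x (q n) < e.
Proof.
move=> [[d0 dE dC dT] dO].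
have [[D [cD clD]] _] := polT.
have [f fi] := countable_injP _ cD.
exists (fun n => xget point [set x | D x /\ f x = n]) => x e e0.
have : closure D x by rewrite clD.
have nb : nbhs x [set y | d x y < e].
  apply: open_nbhs_nbhs; split; last by rewrite /= (dE x x).2.
  apply/dO => y /= xy; exists (e - d x y); first by rewrite subr_gt0.
  by move=> z /=; rewrite ltrBrDl; exact: le_lt_trans (dT _ _ _).
move=> /(_ _ nb)[y [Dy xy]]; exists (f y).
suff -> : xget point [set x | D x /\ f x = f y] = y by [].
apply: xget_unique => // z [Dz fz]; apply: fi => //; exact/mem_set.
Qed.

Definition pix (i : nat) : nat * nat := odflt (0%N, 0%N) (unpickle i).
Lemma pixK n k : pix (pickle (n, k)) = (n, k).
Proof. by rewrite /pix pickleK. Qed.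

Let e2 k : R := 2 ^- k.
Let e2_gt0 k : 0 < e2 k. Proof. by rewrite /e2 invr_gt0 exprn_gt0. Qed.
Let e2S k : e2 k = 2 * e2 k.+1.
Proof. by rewrite /e2 exprS invfM mulrA mulfV ?mul1r. Qed.
Let e2_small (e : R) : 0 < e -> exists k, e2 k < e.
Proof.
move=> e0; exists (Num.bound e^-1).
rewrite /e2 invf_plt ?posrE ?exprn_gt0//.
have := @archi_boundP _ e^-1; rewrite invr_ge0 => /(_ (ltW e0)) /lt_trans; apply.
by rewrite -natrX ltr_nat ltn_expl.
Qed.

(* A point is coded by the rational balls that contain it; completeness makes
   the centres of the coded balls converge for all codes in a Borel set, so the
   coding has a Borel left inverse. *)
Lemma polish_code : exists (code : borel T -> R) (decode : R -> borel T),
  [/\ measurable_fun setT code, measurable_fun setT decode,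
      forall a, decode (code a) = a, forall a, 0 < code a < 1 &
      forall a, cset (code a)].
Proof.
have [_ [d [cd compl]]] := polT.
have [q dq] := polish_seq cd.
have [[d0 dE dC dT] dO] := cd.
(* The two leading bits are fixed to 0 and 1, which keeps the code strictly inside (0, 1); the
   remaining ones record the rational balls. *)
pose bits (a : T) i := if i is i'.+2 then d a (q (pix i').1) < e2 (pix i').2 else i == 1%N.
pose code (a : borel T) : R := cval R (bits a).
pose hit (k n : nat) v := cbit (pickle (n, k)).+2 (v : R).
(* Taking the first centre at each scale makes the selection unique and measurable. For the code of
   a point a, centres within 2^-k and 2^-(k+1) of a are at most 2 * 2^-k apart, which is the
   condition in [V]; summing these bounds over all finer scales gives the radius 4 * 2^-k in
   [isl]. *)
pose fst_hit (k n : nat) (v : R) := hit k n v && [forall m : 'I_n, ~~ hit k m v].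
pose V : set R := [set v | forall k, exists n n' : nat,
  [/\ fst_hit k n v, fst_hit k.+1 n' v & d (q n) (q n') <= 2 * e2 k]].
pose isl (l : T) v := forall k n, fst_hit k n v -> d (q n) l <= 4 * e2 k.
pose decode (v : R) : borel T := if v \in V then xget point [set l | isl l v] else point.
have hitU k n n' v : fst_hit k n v -> fst_hit k n' v -> n = n'.
  move=> /andP[h /forallP hn] /andP[h' /forallP hn'].
  have [nn'|nn'|//] := ltngtP n n'.
    by have := hn' (Ordinal nn'); rewrite h.
  by have := hn (Ordinal nn'); rewrite h'.
have hitE k v n : hit k n v -> exists n', fst_hit k n' v.
  move=> h; have := ex_minnP (ex_intro (fun n => hit k n v) n h) => -[m hm mmin].
  exists m; rewrite /fst_hit hm/=; apply/forallP => -[i im]; apply/negP => hi.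
  by have := mmin i hi; rewrite leqNgt im.
have mhit k n : measurable [set v | hit k n v] by exact: measurable_cbit.
have mfst k n : measurable [set v | fst_hit k n v].
  rewrite (_ : mkset _ = [set v | hit k n v] `&` \bigcap_(m in [set m | (m < n)%N])
      ~` [set v | hit k m v]); last first.
    apply/seteqP; split => v /=.
      move=> /andP[h /forallP hn]; split=> // m /= mn; apply/negP.
      exact: (hn (Ordinal mn)).
    move=> [h hn]; apply/andP; split=> //; apply/forallP => -[m mn]; apply/negP.
    exact: hn.
  apply: measurableI => //; apply: bigcap_measurableType => m _.
  exact: measurableC.
have mV : measurable V.
  rewrite (_ : V = \bigcap_k \bigcup_n \bigcup_(n' in [set n' | d (q n) (q n') <= 2 * e2 k])
     ([set v | fst_hit k n v] `&` [set v | fst_hit k.+1 n' v])); last first.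
    apply/seteqP; split => v /=.
      by move=> h k _; have [n [n' [h1 h2 h3]]] := h k; exists n => //; exists n'.
    move=> h k; have [n _ [n' /= dn [h1 h2]]] := h k I.
    by exists n, n'.
  apply: bigcapT_measurable => k; apply: bigcupT_measurable => n.
  by apply: bigcup_measurable => n' _; exact: measurableI.
have Vl v : V v -> exists l, isl l v.
  move=> Vv.
  have [u hu] : exists u : nat -> nat, forall k, fst_hit k (u k) v.
    have : forall k, exists n, fst_hit k n v by move=> k; have [n [_ [? _ _]]] := Vv k; exists n.
    by move=> /choice[u hu]; exists u.
  have du k : d (q (u k)) (q (u k.+1)) <= 2 * e2 k.
    have [n [n' [h1 h2 h3]]] := Vv k.
    by rewrite (hitU _ _ _ _ (hu k) h1) (hitU _ _ _ _ (hu k.+1) h2).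
  have dum k m : d (q (u k)) (q (u (k + m)%N)) <= 4 * (e2 k - e2 (k + m)).
    elim: m => [|m IH]; first by rewrite addn0 subrr mulr0 (dE _ _).2.
    rewrite addnS; apply: le_trans (dT _ (q (u (k + m)%N)) _) _.
    by have := du (k + m)%N; have := e2S (k + m)%N; lra.
  have dum' k m : (k <= m)%N -> d (q (u k)) (q (u m)) <= 4 * e2 k.
    by move=> /subnKC <-; have := dum k (m - k)%N; have := e2_gt0 (k + (m - k))%N; lra.
  have [|l hl] := compl (q \o u).
    move=> e eg0; have [k ke] := e2_small (divr_gt0 eg0 (ltr0n R 8)).
    exists k => m m' km km'; apply: le_lt_trans (dT _ (q (u k)) _) _.
    have := dum' _ _ km; have := dum' _ _ km'; rewrite (dC (q (u m))) /=.
    by move: ke; rewrite ltr_pdivlMr//; lra.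
  exists l => k n hn; rewrite (hitU _ _ _ _ hn (hu k)).
  apply/ler_addgt0Pr => e eg0; have [m hm] := hl e eg0.
  apply: le_trans (dT _ (q (u (maxn k m))) _) _; apply: lerD.
    by apply: dum'; exact: leq_maxl.
  by apply/ltW/hm; exact: leq_maxr.
have decl v : V v -> isl (decode v) v.
  move=> Vv; rewrite /decode mem_set//; have [l hl] := Vl _ Vv.
  exact: (@xgetPex _ point [set l | isl l v] (ex_intro _ l hl)).
have hitc a k n : hit k n (code a) = (d a (q n) < e2 k).
  by rewrite /hit /code cbit_cval /bits pixK.
have Vc a : V (code a).
  move=> k; have [n hn] := dq a _ (e2_gt0 k); have [n' hn'] := dq a _ (e2_gt0 k.+1).
  rewrite -hitc in hn; rewrite -hitc in hn'.
  have [m hm] := hitE _ _ _ hn; have [m' hm'] := hitE _ _ _ hn'.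
  exists m, m'; split=> //; have /andP[+ _] := hm; have /andP[+ _] := hm'.
  rewrite !hitc => h1 h2; apply: le_trans (dT _ a _) _.
  by rewrite (dC _ a); have := e2S k; have := e2_gt0 k; lra.
exists code, decode; split.
- apply: measurable_cval => -[|[|i]] /=; first by rewrite (_ : mkset _ = set0)//; apply/seteqP; split.
    by rewrite (_ : mkset _ = setT)//; apply/seteqP; split.
  apply: sub_sigma_algebra; apply/dO => y /= xy.
  exists (e2 (pix i).2 - d y (q (pix i).1)); first by rewrite subr_gt0.
  move=> z /=; rewrite ltrBrDr => h; apply: le_lt_trans h.
  by rewrite (dC y z); exact: dT.
(* A code in [V] is decoded into the open set U exactly when, for some scale, the ball of radius 4 *
   2^-k around the selected centre lies in U; this is a countable condition. *)
- apply: (@measurability _ _ R (borel T) setT decode (@open T)) => //.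
  move=> _ [U oU <-]; rewrite setTI.
  rewrite (_ : _ @^-1` _ = (V `&` \bigcup_k \bigcup_(n in [set n |
     [set y | d (q n) y <= 4 * e2 k] `<=` U]) [set v | fst_hit k n v]) `|`
     (~` V `&` [set v | U point])); last first.
    apply/seteqP; split => v /=.
      have [Vv|nV] := pselect (V v); last by rewrite /decode memNset//; right.
      move=> Ud; left; split => //.
      have /dO/(_ _ Ud)[e eg0 eU] := oU.
      have [k ke] := e2_small (divr_gt0 eg0 (ltr0n R 8)).
      have [n [_ [hn _ _]]] := Vv k; exists k => //; exists n => // y /= dy.
      apply: eU => /=; apply: le_lt_trans (dT _ (q n) _) _.
      have := decl _ Vv k n hn; rewrite (dC (q n)); move: ke dy.
      by rewrite ltr_pdivlMr//; lra.
    move=> [[Vv [k _ [n /= nU hn]]]|[nV Up]]; last by rewrite /decode memNset.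
    by apply: nU; exact: decl.
  apply: measurableU; apply: measurableI => //.
  + by apply: bigcupT_measurable => k; exact: bigcup_measurable.
  + exact: measurableC.
  + have [Up|Up] := pselect (U point); first by rewrite (_ : mkset _ = setT)//; apply/seteqP; split.
    by rewrite (_ : mkset _ = set0)//; apply/seteqP; split.
- move=> a; have dl := decl _ (Vc a).
  apply/dE/eqP; rewrite eq_le d0 andbT; apply/ler_addgt0Pr => e eg0; rewrite add0r.
  have [k ke] := e2_small (divr_gt0 eg0 (ltr0n R 8)).
  have [n hn] := dq a _ (e2_gt0 k); rewrite -hitc in hn.
  have [m hm] := hitE _ _ _ hn; have /andP[+ _] := hm; rewrite hitc.
  have := dl k m hm; move: ke; rewrite ltr_pdivlMr// => h1 h2 h3.
  apply: le_trans (dT _ (q m) _) _; rewrite dC (dC _ a).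
  by have := e2_gt0 k; lra.
- move=> a; have -> : code a = (2 + cval R (fun i => bits a i.+2)) / 9.
    by rewrite /code (cvalS R (bits a)) (cvalS R (fun i => bits a i.+1)) /=; field.
  by have /andP[? ?] := cval01 R (fun i => bits a i.+2); apply/andP; split; lra.
- by move=> a; exact: cset_cval.
Qed.

End PolishCode.

Lemma prob_U2 d (T : measurableType d) (R : realType) (P : probability T R)
  (A B : set T) : measurable A -> measurable B -> (P (A `|` B) <= P A + P B)%E.
Proof. by move=> mA mB; exact: measureU2. Qed.

Lemma prob_le d (T : measurableType d) (R : realType) (P : probability T R)
  (A B : set T) : measurable A -> measurable B -> A `<=` B -> (P A <= P B)%E.
Proof. by move=> mA mB AB; apply: le_measure; rewrite ?inE. Qed.

Lemma prob_eq_off d (T : measurableType d) (R : realType) (P : probability T R)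
  (A B N : set T) : measurable A -> measurable B -> measurable N -> P N = 0%E ->
  (forall x, ~ N x -> (A x <-> B x)) -> P A = P B.
Proof.
have H : forall A B, measurable A -> measurable B -> measurable N -> P N = 0%E ->
    (forall x, ~ N x -> (A x <-> B x)) -> (P A <= P B)%E.
  move=> {}A {}B mA mB mN N0 AB.
  apply: (@le_trans _ _ (P (B `|` N))).
    apply: le_measure; rewrite ?inE//; first exact: measurableU.
    by move=> x Ax; have [Nx|nNx] := pselect (N x); [right|left; apply/(AB x nNx)].
  by apply: (le_trans (prob_U2 _ mB mN)); rewrite N0 adde0.
move=> mA mB mN N0 AB; apply/eqP; rewrite eq_le !H// => x nN; split => /(AB x nN)//.
Qed.

Section CondProb.
Context d (T : measurableType d) (R : realType) (P : probability T R) (K : set T).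
Hypotheses (mK : measurable K) (PK : (0 < P K)%E).

Definition condp_ (_ : measurable K) (_ : (0 < P K)%E) : set T -> \bar R :=
  mscale (NngNum (ltac:(rewrite invr_ge0 fine_ge0// ) : 0 <= (fine (P K))^-1)) (mrestr P mK).
HB.instance Definition _ := Measure.on (condp_ mK PK).
Let condpT : condp_ mK PK setT = 1%E.
Proof.
rewrite /condp_ /mscale/= /mrestr setTI.
have fK : P K \is a fin_num by exact: prob_fin.
rewrite -{2}(fineK fK) -EFinM mulVf// gt_eqF//.
by rewrite fine_gt0// PK/= ltey_eq fK.
Qed.
HB.instance Definition _ := @Measure_isProbability.Build _ _ R (condp_ mK PK) condpT.
Definition condp : probability T R := condp_ mK PK.

Lemma condp0 A : measurable A -> P (A `&` K) = 0%E -> condp A = 0%E.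
Proof. by move=> mA A0; rewrite /condp/= /condp_ /mscale/= /mrestr A0 mule0. Qed.

End CondProb.

(** * Uniformization of atomless kernels *)

Section UniformizeR.
Context (R : realType) d (Z : measurableType d) (k : Z -> probability R R).
Hypothesis mk : forall B, measurable B -> measurable_fun setT (fun z => k z B).
Hypothesis k0 : forall z a, k z [set a] = 0%E.
Variables (j j' : R -> R).
Hypotheses (mj : measurable_fun setT j) (mj' : measurable_fun setT j').
Hypotheses (jK : forall a, j' (j a) = a) (j01 : forall a, 0 < j a < 1).
Let C : set R := [set v | j (j' v) = v].
Hypothesis C0 : rho C = 0%E.

Let diagR : measurable [set p : R * R | p.1 = p.2].
Proof. by apply: (measurable_diag_inj (c := @id R)). Qed.
Let mC : measurable C.
Proof.
apply: measurable_eqset => //; first exact: (measurableT_comp mj).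
Qed.
Let Cj a : C (j a). Proof. by rewrite /C/= jK. Qed.
Let I01 : set R := `]0, 1[%classic `\` C.
Let mI01 : measurable I01. Proof. exact: measurableD. Qed.
Let F := kcdf k. Let G := kquant k.
Let mF : measurable_fun setT (fun p : Z * R => F p.1 p.2).
Proof. exact: measurable_kcdf. Qed.
Let mG : measurable_fun setT (fun p : Z * R => G p.1 p.2).
Proof. exact: measurable_kquant. Qed.
Let mGF : measurable_fun setT (fun p : Z * R => G p.1 (F p.1 p.2)).
Proof.
have m : measurable_fun setT (fun p : Z * R => (p.1, F p.1 p.2)).
  exact: measurable_fun_pair.
exact: (measurableT_comp mG m).
Qed.
Let good : set (Z * R) := [set p | I01 (F p.1 p.2)] `&` [set p | G p.1 (F p.1 p.2) = p.2].
Let mgood : measurable good.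
Proof.
apply: measurableI; first exact: measurable_preim.
by apply: measurable_eqset.
Qed.
(** [f] is the distribution function at the points it determines, and sends all other points into
    the null set [C] through [j]; membership in [C] tells [f'] which rule was applied. Conversely
    [jj] squeezes the line injectively into (0, 1), moving only levels outside [I01], and there the
    quantile function is injective. *)
Let f (p : Z * R) := if p \in good then F p.1 p.2 else j p.2.
Let f' (p : Z * R) := if p.2 \in C then j' p.2 else G p.1 p.2.
Let jj u := if u \in I01 then u else j u.
Let g (p : Z * R) := G p.1 (jj p.2).
Let g' (p : Z * R) := if F p.1 p.2 \in C then j' (F p.1 p.2) else F p.1 p.2.

Let jj01 u : 0 < jj u < 1.
Proof.
rewrite /jj; case: ifPn => [|_]; last exact: j01.
by rewrite inE => -[]; rewrite /= in_itv.
Qed.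

Let bad : rho (~` I01) = 0%E.
Proof.
have m0 : measurable (~` `]0, 1[%classic : set R) by exact: measurableC.
apply/eqP; rewrite eq_le measure_ge0 andbT.
rewrite /I01 setCD.
apply: (le_trans (prob_U2 _ m0 _)) => //.
rewrite C0 adde0 rhoE (_ : _ `&` _ = [set 0]) ?lebesgue_measure_set1//.
apply/seteqP; split => u /=; rewrite !in_itv/=.
  move=> [/negP + /andP[u0 u1]]; rewrite u1 andbT -leNgt => u0'.
  by apply/eqP; rewrite eq_le u0 u0'.
by move=> ->; rewrite lexx ltxx ltr01.
Qed.

(** The injections [f] and [g] differ from the distribution and quantile functions only on null
    sets, so they carry each [k z] to [rho] and back, and [SB_bijection] merges them. *)
Lemma uniformize_real : exists (theta : Z * R -> R) (eta : Z * R -> R),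
  [/\ measurable_fun setT theta, measurable_fun setT eta,
      forall z a, eta (z, theta (z, a)) = a,
      forall z b, theta (z, eta (z, b)) = b &
      forall z A, measurable A -> k z [set a | A (theta (z, a))] = rho A].
Proof.
have mf : measurable_fun setT f.
  apply: measurable_fun_ifT => //; first exact: measurable_mem.
  exact: measurableT_comp.
have mf' : measurable_fun setT f'.
  apply: measurable_fun_ifT => //; last exact: measurableT_comp.
  exact: (measurableT_comp (measurable_mem mC)).
have mjj : measurable_fun setT jj.
  by apply: measurable_fun_ifT => //; exact: measurable_mem.
have mg : measurable_fun setT g.
  have m : measurable_fun setT (fun p : Z * R => (p.1, jj p.2)).
    by apply: measurable_fun_pair => //; exact: measurableT_comp.
  exact: (measurableT_comp mG m).
have mg' : measurable_fun setT g'.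
  apply: measurable_fun_ifT => //; last exact: measurableT_comp.
  exact: (measurableT_comp (measurable_mem mC)).
have mz (z : Z) : measurable_fun setT (fun a : R => (z, a)) by exact: pair1_measurable.
have [||theta [eta [m1 m2 K1 K2 L]]] := SB_bijection mf mf' mg mg' _ _ diagR diagR.
- move=> z a; rewrite /f/=; case: ifPn => [|_].
    rewrite inE /f'/= => -[[/= _ nC] e]; rewrite memNset//.
  by rewrite /f'/= mem_set// jK.
- move=> z b; rewrite /g'/g/=; have /andP[u0 u1] := jj01 b.
  rewrite /F /G kquantK// /jj; case: (boolP (b \in I01)) => [|_].
    by rewrite inE => -[_ nC]; rewrite memNset.
  by rewrite mem_set// jK.
exists theta, eta; split=> // z A mA; apply: L => //.
- move=> B mB.
  have mfz : measurable_fun setT (fun a => f (z, a)) by exact: measurableT_comp.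
  have mGz : measurable_fun setT (fun a => G z a) by exact: (measurableT_comp mG (mz z)).
  (* [k z] is the law of the quantile at a uniform level. At a level in [I01] the quantile is a good
     point, and [f] returns the level. *)
  rewrite -(kquant_law mk); last exact: measurable_preim.
  apply: (prob_eq_off (N := ~` I01)) => //.
  + apply: (measurable_preim (f := fun u => f (z, G z u))) => //.
    exact: (measurableT_comp mfz mGz).
  + exact: measurableC.
  + move=> u /contrapT Iu.
    have /andP[u0 u1] : 0 < u < 1 by case: Iu; rewrite /= in_itv.
    rewrite /= /f mem_set/= -/F -/G; last first.
      by split; rewrite /= /F /G kquantK.
    by rewrite /F /G kquantK.
- move=> E mE; rewrite -(kquant_law mk z mE).
  have mGz : measurable_fun setT (fun a => G z a) by exact: (measurableT_comp mG (mz z)).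
  apply: (prob_eq_off (N := ~` I01)) => //.
  + apply: (measurable_preim (f := fun u => g (z, u))) => //.
    exact: measurableT_comp.
  + exact: measurable_preim.
  + exact: measurableC.
  + by move=> u /contrapT Iu; rewrite /g/= /jj mem_set.
Qed.

End UniformizeR.

Section BorelIso.
Context (R : realType) (T : ptopologicalType) (P : Prob R T).
Hypotheses (polT : polish R T) (P0 : atomless P).

(** The distribution function of the Laplace law, an explicit Borel injection of the line into (0,
    1). *)
Let sg (x : R) : R := if x < 0 then expR x / 2 else 1 - expR (- x) / 2.
Let sg' (y : R) : R := if y < 2^-1 then ln (2 * y) else - ln (2 * (1 - y)).
Let sg01 x : 0 < sg x < 1.
Proof.
rewrite /sg; case: (ltP x 0) => x0.
  have := expR_gt0 x; have : expR x < 1 by rewrite expR_lt1.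
  by move=> ? ?; apply/andP; split; lra.
have := expR_gt0 (- x); have : expR (- x) <= 1 by rewrite -expR0 ler_expR oppr_le0.
by move=> ? ?; apply/andP; split; lra.
Qed.
Let sgK x : sg' (sg x) = x.
Proof.
rewrite /sg /sg'; case: (ltP x 0) => x0.
  have : expR x < 1 by rewrite expR_lt1.
  move=> ?; rewrite ifT; last by lra.
  by rewrite (_ : 2 * _ = expR x) ?expRK//; field.
have : expR (- x) <= 1 by rewrite -expR0 ler_expR oppr_le0.
move=> ?; rewrite ifF; last by apply/negbTE; rewrite -leNgt; lra.
by rewrite (_ : 2 * _ = expR (- x)) ?expRK ?opprK//; field.
Qed.
Let msg : measurable_fun setT sg.
Proof.
apply: measurable_fun_ifT.
- exact: measurable_fun_ltr.
- by apply: measurable_funM => //; exact: measurable_expR.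
- apply: measurable_funB => //; apply: measurable_funM => //.
  by apply: measurableT_comp; [exact: measurable_expR|exact: oppr_measurable].
Qed.
Let msg' : measurable_fun setT sg'.
Proof.
apply: measurable_fun_ifT.
- exact: measurable_fun_ltr.
- by apply: measurableT_comp; [exact: measurable_ln|exact: measurable_funM].
- apply: measurableT_comp => //.
  apply: measurableT_comp; first exact: measurable_ln.
  by apply: measurable_funM => //; exact: measurable_funB.
Qed.

(* The quantile function of the uniform law on a compact set of positive
   measure embeds the real line into that set. *)
Lemma borel_iso : exists (i : borel T -> R) (i' : R -> borel T),
  [/\ measurable_fun setT i, measurable_fun setT i', cancel i i' & cancel i' i].
Proof.
have [code [decode [mc md cK c01 _]]] := polish_code polT.
have diagR : measurable [set p : R * R | p.1 = p.2].
  by apply: (measurable_diag_inj (c := @id R)).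
pose Pc : probability R R := imagep P mc.
pose k1 (_ : unit) := Pc.
have mk1 B : measurable B -> measurable_fun setT (fun z => k1 z B).
  by move=> _; exact: measurable_cst.
have k10 z a : k1 z [set a] = 0%E.
  apply/eqP; rewrite eq_le measure_ge0 andbT -(P0 (decode a)).
  apply: (@prob_le _ _ R P).
  - by apply: (measurable_preim (f := code) (B := [set a])).
  - have -> : [set decode a] = [set x : borel T | code x = code (decode a)].
      apply/seteqP; split => x /=; first by move=> ->.
      by move=> /(congr1 decode); rewrite !cK.
    by apply: (measurable_preim (f := code) (B := [set _])).
  - by move=> x /= <-; rewrite cK.
pose F := kcdf k1 tt; pose G := kquant k1 tt.
have mtt : measurable_fun setT (fun u : R => (tt, u)) by exact: pair1_measurable.
have mF : measurable_fun setT F by exact: (measurableT_comp (measurable_kcdf mk1) mtt).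
have mG : measurable_fun setT G by exact: (measurableT_comp (measurable_kquant mk1) mtt).
(* [S] is the range of [code], which has full mass under the image law. Hence almost every level has
   its quantile in [S], where [decode] loses nothing. *)
pose S : set R := [set r | code (decode r) = r].
have mS : measurable S.
  by apply: measurable_eqset => //; exact: measurableT_comp.
pose E := [set u | S (G u)].
have mE : measurable E by exact: measurable_preim.
have rE : rho E = 1%E.
  rewrite (kquant_law mk1 tt mS) -(probability_setT P).
  by congr (P _); apply/seteqP; split => // x _ /=; rewrite /S/= cK.
pose D := E `&` `]0, 1[%classic.
have mD : measurable D by exact: measurableI.
have lD : lebesgue_measure D = 1%E.
  rewrite -rE rhoE.
  have -> : E `&` `[0, 1[%classic = D `|` (E `&` [set 0]).
    rewrite /D -setIUr; congr (_ `&` _); apply/seteqP; split => u /=; rewrite !in_itv/=.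
      move=> /andP[]; rewrite le_eqVlt => /orP[/eqP <-|u0] u1; first by right.
      by left; rewrite u0.
    by case=> [/andP[/ltW ->]//|->]; rewrite lexx ltr01.
  apply/esym/measureU0 => //; first exact: measurableI.
  by apply: subset_measure0 (lebesgue_measure_set1 (0 : R)) => //; exact: measurableI.
(* Inner regularity replaces the set [D] of admissible levels by a closed set. Quantiles of a law
   carried by a closed set lie in that set, at every level of (0, 1) and not just almost surely. *)
have [K [cK' KD lK]] : exists V : set R, [/\ compact V, V `<=` D &
    (lebesgue_measure (D `\` V) < (2^-1)%:E)%E].
  have lDoo : (lebesgue_measure D < +oo)%E by rewrite lD ltry.
  exact: (lebesgue_regularity_inner mD lDoo).
have clK : closed K by apply: compact_closed => //; exact: Rhausdorff.
have mK : measurable K by exact: closed_measurable.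
have KI : K `<=` `[0, 1[%classic.
  move=> u /KD[_]; rewrite /= !in_itv/= => /andP[/ltW -> ->]//.
have PK : (0 < rho K)%E.
  rewrite rhoE setIidl//.
  rewrite lt_neqAle measure_ge0 andbT eq_sym; apply/eqP => K0.
  have : (lebesgue_measure D <= lebesgue_measure (D `\` K) + lebesgue_measure K)%E.
    apply: (@le_trans _ _ (lebesgue_measure ((D `\` K) `|` K))).
      by rewrite setUC setDUK.
    by apply: measureU2 => //; exact: measurableD.
  rewrite lD K0 adde0 => h; have := le_lt_trans h lK.
  by rewrite lte_fin; lra.
pose Q := condp mK PK; pose k2 (_ : unit) := Q.
have mk2 B : measurable B -> measurable_fun setT (fun z => k2 z B).
  by move=> _; exact: measurable_cst.
have k20 z a : k2 z [set a] = 0%E.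
  apply: condp0 => //; rewrite rhoE.
  apply: subset_measure0 (lebesgue_measure_set1 a) => //.
  - by apply: measurableI => //; exact: measurableI.
  - by move=> x [[]].
pose FK := kcdf k2 tt; pose GK := kquant k2 tt.
have mFK : measurable_fun setT FK by exact: (measurableT_comp (measurable_kcdf mk2) mtt).
have mGK : measurable_fun setT GK by exact: (measurableT_comp (measurable_kquant mk2) mtt).
(* A quantile outside [K] has a neighbourhood without mass, so the level u would already be reached
   at a smaller point. *)
have GKK u : 0 < u -> u < 1 -> K (GK u).
  move=> u0 u1; apply: contrapT => nK.
  have : open (~` K) by exact: closed_openC.
  rewrite openE => /(_ _ nK) /nbhs_ballP[e /= e0 eK].
  have : u <= FK (GK u - e / 2).
    rewrite -[X in X <= _](kquantK k20 tt u0 u1) -lee_fin /kcdf !fineK ?prob_fin//.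
    have -> : `]-oo, kquant k2 tt u]%classic = `]-oo, GK u - e / 2]%classic `|`
        `]GK u - e / 2, GK u]%classic.
      apply/seteqP; split => x /=; rewrite !in_itv/=.
        by move=> xq; case: (leP x (GK u - e / 2)); [left|right].
      case=> [/le_trans|/andP[]//]; apply; rewrite /GK; lra.
    apply: (le_trans (prob_U2 _ _ _)) => //.
    rewrite [X in (_ + X <= _)%E](_ : _ = 0%E) ?adde0//.
    apply: condp0 => //.
    rewrite (_ : _ `&` _ = set0) ?measure0//; apply/seteqP; split => // x /= [].
    rewrite in_itv/= => /andP[x1 x2]; apply: eK.
    by rewrite /ball/= ger0_norm; lra.
  by rewrite /FK -kquantP// -/GK; lra.
pose h u : borel T := decode (G (GK u)).
pose h' (a : borel T) := FK (F (code a)).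
have mh : measurable_fun setT h.
  by apply: measurableT_comp => //; exact: measurableT_comp.
have mh' : measurable_fun setT h'.
  by apply: measurableT_comp => //; exact: measurableT_comp.
have hK u : 0 < u -> u < 1 -> h' (h u) = u.
  move=> u0 u1; have [Eu] := KD _ (GKK _ u0 u1); rewrite /= in_itv/= => /andP[w0 w1].
  rewrite /h' /h; have -> : code (decode (G (GK u))) = G (GK u) by exact: Eu.
  by rewrite /F /G kquantK// /FK /GK kquantK.
(* [code] embeds T into the line and [h] after [sg] embeds the line into T. The parameter space is a
   single point. *)
have [||||||||theta [eta [m1 m2 K1 K2 _]]] := @SB_bijection _ _ _ unit (borel T) R
    (fun p => code p.2) (fun p => decode p.2)
    (fun p => h (sg p.2)) (fun p => sg' (h' p.2)).
- exact: measurableT_comp.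
- exact: measurableT_comp.
- by apply: measurableT_comp => //; exact: measurableT_comp.
- by apply: measurableT_comp => //; exact: measurableT_comp.
- by move=> z a /=.
- by move=> z b /=; have /andP[s0 s1] := sg01 b; rewrite hK// sgK.
- exact: (measurable_diag_inj mc (can_inj cK)).
- exact: diagR.
exists (fun a => theta (tt, a)), (fun b => eta (tt, b)); split.
- by apply: measurableT_comp => //; exact: pair1_measurable.
- by apply: measurableT_comp => //; exact: pair1_measurable.
- by move=> a; exact: K1.
- by move=> b; exact: K2.
Qed.

End BorelIso.

(** [borel_iso] moves the kernel to the line. All codes of points of T lie in the Cantor set, so
    composing the isomorphism with [code] gives the injection of the line into a null set that
    [uniformize_real] asks for. *)
Lemma uniformize_kernel (R : realType) (T : ptopologicalType) (P : Prob R T)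
  d (Z : measurableType d) (k : Z -> Prob R T) :
  polish R T -> atomless P ->
  (forall B, Borel B -> measurable_fun setT (fun z => k z B)) ->
  (forall z, atomless (k z)) ->
  exists (theta : Z * borel T -> R) (eta : Z * R -> borel T),
  [/\ measurable_fun setT theta, measurable_fun setT eta,
      forall z a, eta (z, theta (z, a)) = a,
      forall z b, theta (z, eta (z, b)) = b &
      forall z A, measurable A -> k z [set a | A (theta (z, a))] = rho A].
Proof.
move=> polT P0 mk k0.
have [i [i' [mi mi' iK i'K]]] := borel_iso polT P0.
have [code [decode [mc md cK c01 cC]]] := polish_code polT.
pose j (r : R) := code (i' r); pose j' (r : R) := i (decode r).
have mj : measurable_fun setT j by exact: measurableT_comp.
have mj' : measurable_fun setT j' by exact: measurableT_comp.
have jK a : j' (j a) = a by rewrite /j' /j cK i'K.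
have C0 : rho [set v | j (j' v) = v] = 0%E.
  apply/eqP; rewrite eq_le measure_ge0 andbT.
  have -> : (0 : \bar R)%E = lebesgue_measure (@cset R) by rewrite cset_null.
  rewrite rhoE; apply: le_measure; rewrite ?inE.
  - apply: measurableI => //; apply: measurable_eqset => //.
      exact: (measurable_diag_inj (c := @id R)).
    exact: (measurableT_comp mj).
  - exact: measurable_cset.
  - by move=> v [/= <- _]; exact: cC.
pose k' z : probability R R := imagep (k z) mi.
have mk' B : measurable B -> measurable_fun setT (fun z => k' z B).
  by move=> mB; apply: mk; exact: (measurable_preim mi mB).
have k'0 z a : k' z [set a] = 0%E.
  rewrite -(k0 z (i' a)) /k' imagepE; congr (k z _).
  by apply/seteqP; split => x /= => [<-|->].
have [theta [eta [m1 m2 K1 K2 L]]] :=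
  uniformize_real mk' k'0 mj mj' jK (fun a => c01 (i' a)) C0.
exists (fun p => theta (p.1, i p.2)), (fun p => i' (eta p)); split.
- have m : measurable_fun setT (fun p : Z * borel T => (p.1, i p.2)).
    by apply: measurable_fun_pair => //; exact: measurableT_comp.
  exact: (measurableT_comp m1 m).
- exact: measurableT_comp.
- by move=> z a /=; rewrite K1 iK.
- by move=> z b /=; rewrite i'K K2.
- by move=> z A mA; rewrite -(L z A mA).
Qed.

(** * Borel sets of products of Polish spaces *)

Section ProductTopology.
Context (N : nat) (X : 'I_N -> ptopologicalType).

(** The sets containing an open box around x form a filter that converges to x in every coordinate,
    hence in the supremum of the initial topologies. *)
Lemma prodsp_box (O : set (prodsp X)) (x : prodsp X) : open O -> O x ->
  exists V : forall t, set (X t), (forall t, open (V t) /\ V t (x t)) /\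
    (forall y : prodsp X, (forall t, V t (y t)) -> O y).
Proof.
move=> oO Ox.
pose G : set_system (forall t, X t) := [set A | exists V : forall t, set (X t),
  (forall t, open (V t) /\ V t (x t)) /\ (forall y, (forall t, V t (y t)) -> A y)].
have FG : Filter G.
  split.
  - by exists (fun=> setT); split => // t; split => //; exact: openT.
  - move=> A B [V [V1 V2]] [W [W1 W2]]; exists (fun t => V t `&` W t); split.
      move=> t; have [oV Vx] := V1 t; have [oW Wx] := W1 t.
      by split => //; exact: openI.
    by move=> y VW; split; [apply: V2|apply: W2] => t; have [] := VW t.
  - by move=> A B AB [V [V1 V2]]; exists V; split => // y Vy; apply/AB/V2.
have nO : nbhs (x : prodsp X) O by apply: open_nbhs_nbhs; split.
have := (@cvg_sup (forall t, X t) 'I_N (fun i => Topological.class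
  (initial_topology (fun f : (forall t, X t) => f i))) G x FG).2; apply; last exact: nO.
move=> i A; rewrite (@nbhsE (initial_topology (fun f : (forall t, X t) => f i))).
move=> [_ [[V oV <-] Vx] VA].
pose W t := match pselect (i = t) with
    | left e => eq_rect i (fun s => set (X s)) V t e | right _ => setT end.
exists W; split.
  move=> t; rewrite /W; case: pselect => [e|_]; last by split => //; exact: openT.
  by case: _ / e; split.
move=> y Wy; apply: VA => /=; have := Wy i; rewrite /W; case: pselect => // e.
by rewrite (Prop_irrelevance e erefl).
Qed.

Lemma coord_open t (V : set (X t)) : open V -> open [set y : prodsp X | V (y t)].
Proof.
move=> oV; have : continuous (fun y : prodsp X => y t) by exact: proj_continuous.
by move=> /continuousP; apply.
Qed.

End ProductTopology.

Definition cbase (T : topologicalType) := exists U : nat -> set T,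
  (forall n, open (U n)) /\
  forall (O : set T) x, open O -> O x -> exists n, U n x /\ U n `<=` O.

Lemma compatible_ball_open (R : realType) (T : topologicalType) (d : T -> T -> R) x e :
  compatible_metric d -> open [set y | d x y < e].
Proof.
move=> [[d0 dE dC dT] dO]; apply/dO => y /= xy.
exists (e - d x y); first by rewrite subr_gt0.
by move=> z /=; rewrite ltrBrDl; exact: le_lt_trans (dT _ _ _).
Qed.

Lemma inv_expn_small (R : realType) (e : R) : 0 < e -> exists k : nat, 2 ^- k < e.
Proof.
move=> e0; exists (Num.bound e^-1).
rewrite invf_plt ?posrE ?exprn_gt0//.
have := @archi_boundP _ e^-1; rewrite invr_ge0 => /(_ (ltW e0)) /lt_trans; apply.
by rewrite -natrX ltr_nat ltn_expl.
Qed.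

Lemma polish_cbase (R : realType) (T : ptopologicalType) : polish R T -> cbase T.
Proof.
move=> pT; have [_ [d [cd _]]] := pT; have [q dq] := polish_seq pT cd.
have [[d0 dE dC dT] dO] := cd.
exists (fun i => [set y | d (q (pix i).1) y < 2 ^- (pix i).2]); split.
  by move=> n; exact: compatible_ball_open.
move=> O x oO Ox; have /dO/(_ x Ox)[e e0 eO] := oO.
have [k ke] := inv_expn_small (divr_gt0 e0 (ltr0n R 2)).
have [|n dn] := dq x (2 ^- k); first by rewrite invr_gt0 exprn_gt0.
exists (pickle (n, k)); rewrite pixK /=; split; first by rewrite dC.
move=> y /= dy; apply: eO => /=; apply: le_lt_trans (dT _ (q n) _) _.
by move: ke; rewrite ltr_pdivlMr//; lra.
Qed.

Lemma pos_lower_bound (R : realType) N (e : 'I_N -> R) : (forall t, 0 < e t) ->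
  exists2 e0, 0 < e0 & forall t, e0 <= e t.
Proof.
(* The reciprocal of 1 plus the sum of the reciprocals is below every [e t], and it is positive even
   for an empty family. *)
move=> he; pose s := 1 + \sum_t (e t)^-1.
have s0 : 0 < s by rewrite ltr_wpDr// sumr_ge0// => t _; rewrite invr_ge0 ltW.
exists s^-1; first by rewrite invr_gt0.
move=> t; rewrite invf_ple ?posrE// /s (bigD1 t)//= addrCA lerDl.
by rewrite addr_ge0// sumr_ge0// => u _; rewrite invr_ge0 ltW.
Qed.

Lemma nbhs_forall_ord (T : topologicalType) (x : T) N (P : 'I_N -> T -> Prop) :
  (forall t, nbhs x (P t)) -> nbhs x (fun y => forall t, P t y).
Proof.
by move=> h; exact: (@filter_forall T 'I_N P (nbhs x) _ h).
Qed.

Section ProductBorel.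
Context (R : realType) (N : nat) (X : 'I_N -> ptopologicalType).
Hypothesis polX : forall t, polish R (X t).

Definition XB (t : 'I_N) : measurableType (sigma_display (@open (X t))) := borel (X t).

Lemma prodsp_cbase : cbase (prodsp X).
Proof.
have cb t : {U : nat -> set (X t) | (forall n, open (U n)) /\
    forall (O : set (X t)) x, open O -> O x -> exists n, U n x /\ U n `<=` O}.
  exact: cid (polish_cbase (polX t)).
pose U t := sval (cb t).
have oU t n : open (U t n) by exact: (svalP (cb t)).1.
have UO t := (svalP (cb t)).2.
pose B (f : {ffun 'I_N -> nat}) := [set x : prodsp X | forall t, U t (f t) (x t)].
have oB f : open (B f).
  rewrite openE => x Bx; have := @nbhs_forall_ord (prodsp X) x N (fun t y => U t (f t) (y t)).
  apply => t; apply: open_nbhs_nbhs; split; [exact: coord_open|exact: Bx].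
exists (fun i => B (odflt [ffun=> 0%N] (unpickle i))); split => // O x oO Ox.
have [V [V1 V2]] := prodsp_box oO Ox.
have h t : {n | U t n (x t) /\ U t n `<=` V t}.
  by apply: cid; have [oV Vx] := V1 t; exact: UO.
exists (pickle [ffun t => sval (h t)]); rewrite pickleK/=; split.
  by move=> t; rewrite ffunE; have [] := svalP (h t).
move=> y By; apply: V2 => t; have := By t; rewrite ffunE.
by have [_] := svalP (h t); apply.
Qed.

Lemma prodsp_sum_compatible (d : forall t, X t -> X t -> R) :
  (forall t, compatible_metric (d t)) ->
  compatible_metric (fun x y : prodsp X => \sum_t d t (x t) (y t)).
Proof.
move=> dP; split.
  split.
  - by move=> x y; apply: sumr_ge0 => t _; have [[]] := dP t.
  - move=> x y; split.
      move=> /eqP; rewrite psumr_eq0 => [/allP h|t _]; last by have [[]] := dP t.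
      apply/functional_extensionality_dep => t; have [[_ dE _ _] _] := dP t.
      by apply/dE/eqP; apply: h; rewrite mem_index_enum.
    by move=> ->; apply: big1 => t _; have [[_ dE _ _] _] := dP t; apply/dE.
  - by move=> x y; apply: eq_bigr => t _; have [[]] := dP t.
  - by move=> x y z; rewrite -big_split/=; apply: ler_sum => t _; have [[]] := dP t.
move=> A; split.
  move=> oA x Ax; have [V [V1 V2]] := prodsp_box oA Ax.
  have h t : {e : R | 0 < e & [set y | d t (x t) y < e] `<=` V t}.
    by apply: cid2; have [oV Vx] := V1 t; have [_ dO] := dP t; exact: (dO _).1 oV _ Vx.
  have [|e e0 eh] := @pos_lower_bound R N (fun t => s2val (h t)).
    by move=> t; exact: s2valP (h t).
  exists e => // y /= dy; apply: V2 => t; apply: (s2valP' (h t)) => /=.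
  apply: lt_le_trans (eh t); apply: le_lt_trans dy.
  rewrite (bigD1 t)//= lerDl; apply: sumr_ge0 => s _; by have [[]] := dP s.
move=> h; rewrite openE => x Ax; have [e e0 eA] := h x Ax.
(* Shares of size e / N.+1 keep the sum strictly below e, also for N = 0. *)
have : nbhs x (fun y : prodsp X => forall t, d t (x t) (y t) < e / N.+1%:R).
  have := @nbhs_forall_ord (prodsp X) x N (fun t y => d t (x t) (y t) < e / N.+1%:R).
  apply => t.
  apply: open_nbhs_nbhs; split.
    exact: (@coord_open N X t [set y | d t (x t) y < e / N.+1%:R]
      (compatible_ball_open _ _ (dP t))).
  by have [[_ dE _ _] _] := dP t; rewrite (dE _ _).2// divr_gt0.
apply: filterS => y dy; apply: eA => /=.
apply: (@le_lt_trans _ _ (\sum_(t < N) e / N.+1%:R)).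
  by apply: ler_sum => t _; exact: ltW.
rewrite sumr_const card_ord -[X in X < _]mulr_natr -mulrA gtr_pMr// mulrC ltr_pdivrMr//.
by rewrite mul1r ltr_nat.
Qed.

Lemma prodsp_compatible : exists d : prodsp X -> prodsp X -> R, compatible_metric d.
Proof.
have cd t : {d : X t -> X t -> R | compatible_metric d}.
  by apply: cid; have [_ [d [cd _]]] := polX t; exists d.
exists (fun x y : prodsp X => \sum_t sval (cd t) (x t) (y t)).
exact: (prodsp_sum_compatible (fun t => svalP (cd t))).
Qed.

Lemma prodsp_polish : polish R (prodsp X).
Proof.
split.
  have [U [oU UO]] := prodsp_cbase.
  exists (range (fun n => xget point (U n))); split; first exact: card_image_le.
  apply/seteqP; split => // x _ B nB.
  have [V oV VB] : exists2 V, open V /\ V x & V `<=` B.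
    by move: nB; rewrite nbhsE => -[V [oV Vx] VB]; exists V.
  have [n [Ux UB]] := UO V x oV.1 oV.2.
  exists (xget point (U n)); split; first by exists n.
  by apply/VB/UB; exact: (@xgetPex _ point (U n) (ex_intro _ x Ux)).
have cd t : {d : X t -> X t -> R | compatible_metric d /\ complete_metric d}.
  by apply: cid; have [_ [d [cd c]]] := polX t; exists d.
pose d t := sval (cd t).
have dP t : compatible_metric (d t) := (svalP (cd t)).1.
have dC t : complete_metric (d t) := (svalP (cd t)).2.
exists (fun x y => \sum_t d t (x t) (y t)); split; first exact: prodsp_sum_compatible.
have dle (x y : prodsp X) t : d t (x t) (y t) <= \sum_t d t (x t) (y t).
  rewrite (bigD1 t)//= lerDl; apply: sumr_ge0 => s _; by have [[]] := dP s.
move=> u cu.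
have lim t : {l | forall e : R, 0 < e -> exists n, forall m, (n <= m)%N -> d t (u m t) l < e}.
  apply: cid; apply: (dC t (fun n => u n t)) => e e0; have [n hn] := cu e e0.
  by exists n => m k nm nk; apply: le_lt_trans (dle _ _ t) _; exact: hn.
exists (fun t => sval (lim t)) => e e0.
have h t : {n | forall m, (n <= m)%N -> d t (u m t) (sval (lim t)) < e / N.+1%:R}.
  by apply: cid; apply: (svalP (lim t)); rewrite divr_gt0.
exists (\max_t sval (h t)) => m hm.
apply: (@le_lt_trans _ _ (\sum_(t < N) e / N.+1%:R)).
  apply: ler_sum => t _; apply/ltW/(svalP (h t)).
  exact: leq_trans (leq_bigmax t) hm.
rewrite sumr_const card_ord -[X in X < _]mulr_natr -mulrA gtr_pMr// mulrC ltr_pdivrMr//.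
by rewrite mul1r ltr_nat.
Qed.

(** Second countability of the factors makes each open set a countable union of open boxes; this
    links the topological Borel sets to the filtration at its final time. *)
Lemma Borel_FM (A : set (prodsp X)) : Borel A <-> measurable (A : set (FM XB N)).
Proof.
split.
  move: A; apply: smallest_sub; first exact: sigma_algebra_measurable.
  move=> O oO.
  have cb t : {U : nat -> set (X t) | (forall n, open (U n)) /\
    forall (O : set (X t)) x, open O -> O x -> exists n, U n x /\ U n `<=` O}.
    exact: cid (polish_cbase (polX t)).
  pose U t := sval (cb t).
  have oU t n : open (U t n) by exact: (svalP (cb t)).1.
  have UO t := (svalP (cb t)).2.
  pose B (f : {ffun 'I_N -> nat}) := cyl (X := XB) N (fun t => U t (f t)).
  have mB f : measurable (B f : set (FM XB N)).
    by apply: measurable_cyl => t; apply: sub_sigma_algebra; exact: oU.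
  rewrite (_ : O = \bigcup_(i in [set i | B (odflt [ffun=> 0%N] (unpickle i)) `<=` O])
      B (odflt [ffun=> 0%N] (unpickle i))).
    by apply: bigcup_measurable => i _; exact: mB.
  apply/seteqP; split => x; last by move=> [i /= + Bx]; apply.
  move=> Ox; have [V [V1 V2]] := prodsp_box oO Ox.
  have h t : {n | U t n (x t) /\ U t n `<=` V t}.
    by apply: cid; have [oV Vx] := V1 t; exact: UO.
  exists (pickle [ffun t => sval (h t)]); rewrite /= pickleK/=.
    move=> y By; apply: V2 => t; have := By t (ltn_ord t); rewrite ffunE.
    by have [_] := svalP (h t); apply.
  by move=> t _; rewrite ffunE; have [] := svalP (h t).
move: A; apply: smallest_sub; first exact: smallest_sigma_algebra.
move=> _ [s [_ [B [mB ->]]]].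
have ms : measurable_fun setT ((fun x : prodsp X => x s) : borel (prodsp X) -> borel (X s)).
  apply: (@measurability _ _ (borel (prodsp X)) (borel (X s)) setT _ (@open (X s))) => //.
  by move=> _ [V oV <-]; rewrite setTI; apply: sub_sigma_algebra; exact: coord_open.
exact: (measurable_preim ms mB).
Qed.

Lemma measurable_to_FM : measurable_fun setT ((fun x => x) : borel (prodsp X) -> FM XB N).
Proof. by move=> _ A mA; rewrite setTI; apply/Borel_FM. Qed.

Lemma measurable_of_FM : measurable_fun setT ((fun x => x) : FM XB N -> borel (prodsp X)).
Proof. by move=> _ A mA; rewrite setTI; apply/Borel_FM. Qed.

End ProductBorel.

Section PairBorel.
Context (A B : ptopologicalType).
Hypotheses (cA : cbase A) (cB : cbase B).

Lemma pairsp_box (O : set (pairsp A B)) (z : pairsp A B) : open O -> O z ->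
  exists U V, [/\ open U, open V, U z.1, V z.2 & U `*` V `<=` O].
Proof.
rewrite openE => oO Oz; have [[P Q] /= [nP nQ] PQ] := oO z Oz.
exists P^°, Q^°; split; try exact: open_interior; try by [].
by move=> [a b] [/= Pa Qb]; apply: PQ; split; exact: interior_subset.
Qed.

Lemma fst_preopen (U : set A) : open U -> open [set z : pairsp A B | U z.1].
Proof.
move=> oU; have : continuous (fst : A * B -> A) by move=> z; exact: cvg_fst.
by move=> /continuousP; apply.
Qed.

Lemma snd_preopen (U : set B) : open U -> open [set z : pairsp A B | U z.2].
Proof.
move=> oU; have : continuous (snd : A * B -> B) by move=> z; exact: cvg_snd.
by move=> /continuousP; apply.
Qed.

Lemma pairsp_cbase : cbase (pairsp A B).
Proof.
have [U [oU UO]] := cA; have [V [oV VO]] := cB.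
exists (fun i => [set z : pairsp A B | U (pix i).1 z.1] `&` [set z : pairsp A B | V (pix i).2 z.2]); split.
  by move=> n; apply: openI; [exact: fst_preopen|exact: snd_preopen].
move=> O z oO Oz; have [P [Q [oP oQ Pz Qz PQ]]] := pairsp_box oO Oz.
have [n [nz nP]] := UO _ _ oP Pz; have [m [mz mQ]] := VO _ _ oQ Qz.
exists (pickle (n, m)); rewrite pixK /=; split => // w [/= /nP Pw /mQ Qw].
by apply: PQ.
Qed.

Lemma Borel_pair (S : set (pairsp A B)) :
  Borel S <-> measurable (S : set (borel A * borel B)).
Proof.
split.
  move: S; apply: smallest_sub; first exact: sigma_algebra_measurable.
  move=> O oO; have [U [oU UO]] := cA; have [V [oV VO]] := cB.
  pose W i : set (borel A * borel B) := U (pix i).1 `*` V (pix i).2.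
  have mW i : measurable (W i).
    by apply: measurableX; apply: sub_sigma_algebra.
  rewrite (_ : O = \bigcup_(i in [set i | W i `<=` O]) W i).
    by apply: bigcup_measurable => i _; exact: mW.
  apply/seteqP; split => z; last by move=> [i /= + Wz]; apply.
  move=> Oz; have [P [Q [oP oQ Pz Qz PQ]]] := pairsp_box oO Oz.
  have [n [nz nP]] := UO _ _ oP Pz; have [m [mz mQ]] := VO _ _ oQ Qz.
  exists (pickle (n, m)); rewrite /W/= pixK/=; last by split.
  by move=> w [/= /nP Pw /mQ Qw]; apply: PQ.
rewrite measurable_prod_measurableType.
move: S; apply: smallest_sub; first exact: smallest_sigma_algebra.
move=> _ [U mU [V mV <-]].
have m1 : measurable_fun setT ((fun z => z.1) : borel (pairsp A B) -> borel A).
  apply: (@measurability _ _ (borel (pairsp A B)) (borel A) setT _ (@open A)) => //.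
  by move=> _ [W oW <-]; rewrite setTI; apply: sub_sigma_algebra; exact: fst_preopen.
have m2 : measurable_fun setT ((fun z => z.2) : borel (pairsp A B) -> borel B).
  apply: (@measurability _ _ (borel (pairsp A B)) (borel B) setT _ (@open B)) => //.
  by move=> _ [W oW <-]; rewrite setTI; apply: sub_sigma_algebra; exact: snd_preopen.
have := measurableI _ _ (measurable_preim m1 mU) (measurable_preim m2 mV).
by [].
Qed.

Lemma measurable_to_pair :
  measurable_fun setT ((fun z => z) : borel (pairsp A B) -> (borel A * borel B)%type).
Proof. by move=> _ S mS; rewrite setTI; apply/Borel_pair. Qed.

Lemma measurable_of_pair :
  measurable_fun setT ((fun z => z) : (borel A * borel B)%type -> borel (pairsp A B)).
Proof. by move=> _ S mS; rewrite setTI; apply/Borel_pair. Qed.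

End PairBorel.

(** * Uniformization *)

Definition RR (R : realType) (N : nat) (t : 'I_N) : measurableType default_measure_display := R.

Lemma integral_cst_indic d (T : measurableType d) (R : realType) (P : probability T R)
  (c : R) (E : set T) : 0 <= c -> measurable E ->
  (\int[P]_y (c * \1_E y)%:E)%E = (c%:E * P E)%E.
Proof.
move=> c0 mE; under eq_integral do rewrite EFinM.
rewrite ge0_integralZl_EFin//; first by rewrite integral_indic// setIT.
by apply/measurable_EFinP; exact: measurable_indic.
Qed.

Section Uniformization.
Context (R : realType) (N : nat) (X : 'I_N -> ptopologicalType).
Hypothesis polX : forall t, polish R (X t).
Variable mu : Prob R (prodsp X).

(* [Phi] is a bijective Rosenblatt transform: adapted in both directions, and its
   coordinates are independent and uniform under [mu]. *)
Definition unif_iso (Phi : prodsp X -> ('I_N -> R)) (Psi : ('I_N -> R) -> prodsp X) :=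
  [/\ cancel Phi Psi, cancel Psi Phi,
      forall t, measurable_fun [set: FM (XB X) t] (Phi : FM (XB X) t -> FM (@RR R N) t),
      forall t, measurable_fun [set: FM (@RR R N) t] (Psi : FM (@RR R N) t -> FM (XB X) t) &
      forall C : 'I_N -> set R, (forall t, measurable (C t)) ->
        mu [set x | forall t, C t (Phi x t)] = (\prod_t fine (rho (C t)))%:E].

(** Coordinate t of [Phi] applies the uniformizing bijection of the kernel [k t], with the past of x
    as parameter; the inverse solves the corresponding triangular system. *)
Lemma uniformization : cont_disint mu -> exists Phi Psi, unif_iso Phi Psi.
Proof.
move=> [k [mk k0 muk]].
have U (t : 'I_N) : {p : (FM (XB X) t * borel (X t) -> R) * (FM (XB X) t * R -> borel (X t)) |
  [/\ measurable_fun setT p.1, measurable_fun setT p.2,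
      forall z a, p.2 (z, p.1 (z, a)) = a,
      forall z b, p.1 (z, p.2 (z, b)) = b &
      forall z A, measurable A -> k t z [set a | A (p.1 (z, a))] = rho A]}.
  apply: cid.
  have [||||theta [eta H]] := @uniformize_kernel R (X t) (k t point) _ (FM (XB X) t) (k t).
  - exact: polX.
  - exact: k0.
  - by move=> B mB _ A mA; rewrite setTI; exact: mk.
  - exact: k0.
  by exists (theta, eta).
pose th (t : 'I_N) : FM (XB X) t * borel (X t) -> R := (sval (U t)).1.
pose et (t : 'I_N) : FM (XB X) t * R -> borel (X t) := (sval (U t)).2.
have mth t : measurable_fun setT (th t) by have [] := svalP (U t).
have met t : measurable_fun setT (et t) by have [] := svalP (U t).
have thK t z a : et t (z, th t (z, a)) = a by have [_ _ h _ _] := svalP (U t); exact: h.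
have etK t z b : th t (z, et t (z, b)) = b by have [_ _ _ h _] := svalP (U t); exact: h.
have thL t z A : measurable A -> k t z [set a | A (th t (z, a))] = rho A.
  by have [_ _ _ _ h] := svalP (U t); exact: h.
(* Elements of [FM t] are full sequences. That the bijection reads only the first t coordinates
   comes from its measurability. *)
have dth (t : 'I_N) (x x' : FM (XB X) t) a :
    (forall s : 'I_N, (s < t)%N -> (x : prodsp X) s = (x' : prodsp X) s) ->
    th t (x, a) = th t (x', a).
  move=> xx'.
  have m : measurable_fun setT (fun z : FM (XB X) t => th t (z, a)).
    exact: (measurableT_comp (mth t) (pair2_measurable a)).
  exact: (FM_dep_fun m xx').
have det (t : 'I_N) (x x' : FM (XB X) t) b :
    (forall s : 'I_N, (s < t)%N -> (x : prodsp X) s = (x' : prodsp X) s) ->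
    et t (x, b) = et t (x', b).
  by move=> xx'; rewrite -[RHS](thK t x) (dth t x x')// etK.
pose Phi (x : prodsp X) : 'I_N -> R := fun t => th t (x, x t).
have mPhi t : measurable_fun [set: FM (XB X) t] (Phi : FM (XB X) t -> FM (@RR R N) t).
  apply: measurable_FM => s st.
  have m : measurable_fun [set: FM (XB X) t] (fun x : FM (XB X) t =>
      (x : FM (XB X) s, (x : prodsp X) s : borel (X s))).
    apply: measurable_fun_pair; first by apply: measurable_FM_id; exact: ltnW.
    exact: measurable_coord.
  exact: (measurableT_comp (mth s) m).
pose g (t : 'I_N) (w : forall s, @RR R N s) (x : forall s, XB X s) : XB X t := et t (x, w t).
have mg (t : 'I_N) : measurable_fun setT (fun p : FM (@RR R N) t.+1 * FM (XB X) t => g t p.1 p.2).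
  have m : measurable_fun setT (fun p : FM (@RR R N) t.+1 * FM (XB X) t =>
      (p.2, (p.1 : 'I_N -> R) t)).
    apply: measurable_fun_pair => //.
    apply: (measurableT_comp (measurable_coord (X := @RR R N) (ltnSn t))).
    exact: measurable_fst.
  exact: (measurableT_comp (met t) m).
have dg (t : 'I_N) w (x x' : forall s, XB X s) :
  (forall s : 'I_N, (s < t)%N -> x s = x' s) -> g t w x = g t w x' by exact: det.
have [Psi [PsiE mPsi]] := triangular_map mg dg.
exists Phi, Psi; split => //.
- move=> x; apply: (triangular_uniq dg (x := Phi x)); first by move=> t; rewrite PsiE.
  by move=> t; rewrite /g /Phi thK.
- by move=> w; apply/funext => t; rewrite /Phi PsiE /g etK.
move=> C mC.
pose ok n (x : prodsp X) := forall t : 'I_N, (t < n)%N -> C t (Phi x t).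
have okN : [set x | forall t, C t (Phi x t)] = [set x | ok N x].
  by apply/seteqP; split => x h t; [move=> _; exact: h|exact: h].
have mA : Borel [set x | ok N x].
  apply/(Borel_FM polX).
  have mc : measurable (cyl N C : set (FM (@RR R N) N)) by exact: measurable_cyl.
  have H := measurable_preim (mPhi N) mc.
  exact: H.
rewrite okN (muk _ mA point) /iter_int.
set step := (fun t g => _).
(* Integrating out the coordinates from n on leaves their masses times the indicator of the
   constraints before n. The induction descends from N, hence the substitution of N - m for n. *)
have J n (nN : (n <= N)%N) x : foldr step (fun x => (\1_[set x | ok N x] x)%:E)
    (drop n (enum 'I_N)) x =
    ((\prod_(t < N | (n <= t)%N) fine (rho (C t))) * (\1_[set x | ok n x] x))%:E.
  move: x; rewrite -(subKn nN); move: (N - n)%N (leq_subr n N) => m {n nN}.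
  elim: m => [|m IH] mN x.
    rewrite subn0 drop_oversize ?size_enum_ord//= big1 ?mul1r// => t.
    by rewrite leqNgt ltn_ord.
  pose n : 'I_N := Ordinal (leq_trans (ltnSn (N - m.+1)) (etrans (congr1 (fun k => (k <= N)%N) (subnSK mN)) (leq_subr m N))).
  have nE : (N - m = n.+1)%N by rewrite /= subnSK.
  rewrite (drop_nth n) ?size_enum_ord; last exact: (ltn_ord n).
  have -> : nth n (enum 'I_N) (N - m.+1) = n.
    by apply: val_inj; rewrite /= nth_enum_ord// (ltn_ord n).
  rewrite [LHS]/= {1}/step.
  have IHm := IH (ltnW mN); rewrite -/n in IHm.
  under eq_integral do rewrite -nE IHm.
  set c' := \prod_(t < N | _) _.
  have c'0 : 0 <= c' by apply: prodr_ge0 => t _; exact: fine_ge0.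
  pose c := c' * \1_[set x | ok n x] x.
  have c0 : 0 <= c by rewrite mulr_ge0.
  pose E := [set y : X n | C n (th n (x, y))].
  have mE : measurable (E : set (borel (X n))).
    have my : measurable_fun setT (fun y : borel (X n) => th n (x, y)).
      exact: (measurableT_comp (mth n) (pair1_measurable _)).
    exact: (measurable_preim my (mC n)).
  transitivity (\int[k n x]_y (c * \1_E y)%:E)%E.
    apply: eq_integral => y _; congr EFin; rewrite /c -mulrA; congr (_ * _).
    pose x' : prodsp X := @dfwith _ (fun i => X i) x n y; rewrite -/x'.
    have x'lt (t : 'I_N) : (t < n)%N -> x' t = x t.
      by move=> tn; rewrite /x' dfwithout// gt_eqF.
    have x'n : x' n = y by rewrite /x' dfwithin.
    have PhiE (t : 'I_N) : (t < n)%N -> Phi x' t = Phi x t.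
      move=> tn; rewrite /Phi x'lt//; apply: dth => s st; apply: x'lt.
      exact: ltn_trans st tn.
    have Phin : Phi x' n = th n (x, y).
      by rewrite /Phi x'n; apply: dth => s st; apply: x'lt.
    rewrite !indicE.
    have -> : (x' \in [set x0 | ok (N - m)%N x0]) = (x \in [set x0 | ok n x0]) && (y \in E).
      apply/idP/idP.
        rewrite inE /= => okx'; apply/andP; split; rewrite inE/=.
          by move=> t tn; rewrite -PhiE//; apply: okx'; rewrite nE ltnS ltnW.
        by rewrite /E/= -Phin; apply: okx'; rewrite nE.
      move=> /andP[]; rewrite !inE/= => okx Ey t; rewrite nE ltnS leq_eqVlt.
      move=> /orP[/eqP/val_inj ->|tn]; first by rewrite Phin.
      by rewrite PhiE//; exact: okx.
    by rewrite -natrM mulnb.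
  rewrite integral_cst_indic// (thL n x (C n) (mC n)) -(@fineK _ (rho (C n))) ?prob_fin//.
  rewrite -EFinM; congr EFin; rewrite /c mulrAC; congr (_ * _).
  rewrite [RHS](bigD1 n)//= mulrC; congr (_ * _).
  apply: eq_bigl => t; rewrite nE ltn_neqAle andbC; congr (_ && _).
  by rewrite eq_sym.
have := J 0%N (leq0n N) point; rewrite drop0 => ->; congr EFin.
rewrite (_ : \1_[set x | ok 0%N x] point = 1) ?mulr1//.
by rewrite indicE mem_set.
Qed.

End Uniformization.

Lemma ge0_integral_mrestr d (T : measurableType d) (R : realType)
  (m : {measure set T -> \bar R}) (D : set T) (mD : measurable D) (g : T -> \bar R) :
  measurable_fun setT g -> (forall x, 0 <= g x)%E ->
  (\int[mrestr m mD]_x g x)%E = (\int[m]_(x in D) g x)%E.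
Proof.
move=> mg g0; have mC : measurable (~` D) by exact: measurableC.
rewrite -(setUv D) ge0_integral_setU//=; first last.
- by rewrite /disj_set setICr.
- by rewrite setUv.
rewrite [X in (_ + X)%E](_ : _ = 0%E) ?adde0.
  by apply: eq_measure_integral => A mA AD; rewrite /= /mrestr setIidl.
rewrite -(integral_measure_zero (~` D) g); apply: eq_measure_integral => A mA AD.
rewrite /= /mrestr /mzero (_ : A `&` D = set0) ?measure0//.
by apply/seteqP; split => // x [/AD].
Qed.

Lemma ge0_integral_imagem d1 d2 (T1 : measurableType d1) (T2 : measurableType d2)
  (R : realType) (m : {measure set T1 -> \bar R}) (f : T1 -> T2)
  (mf : measurable_fun setT f) (g : T2 -> \bar R) :
  measurable_fun setT g -> (forall x, 0 <= g x)%E ->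
  (\int[imagem m mf]_y g y)%E = (\int[m]_x g (f x))%E.
Proof.
move=> mg g0.
by rewrite -[RHS](@ge0_integral_pushforward _ _ _ _ _ f mf m setT g)//.
Qed.

Section FiltrationBorel.
Context (R : realType) (N : nat) (X : 'I_N -> ptopologicalType).
Hypothesis polX : forall t, polish R (X t).

Lemma measurable_Ft_id t : measurable_fun setT ((fun x => x) : borel (prodsp X) -> FM (XB X) t).
Proof.
move=> _ A mA; rewrite setTI; apply/(Borel_FM polX).
move: mA; have [tN|Nt] := leqP t N; first exact: measurable_FM_le.
move=> mA; have mi : measurable_fun [set: FM (XB X) N] ((fun x => x) : FM (XB X) N -> FM (XB X) t).
  by apply: measurable_FM => s _; apply: measurable_coord.
exact: (measurable_preim mi mA).
Qed.

Lemma Borel_Ft t (A : set (prodsp X)) : measurable (A : set (FM (XB X) t)) -> Borel A.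
Proof. by move=> mA; exact: (measurable_preim (@measurable_Ft_id t) mA). Qed.

End FiltrationBorel.

Section Independence.
Context (R : realType) (N : nat) (X : 'I_N -> ptopologicalType).
Hypothesis polX : forall t, polish R (X t).
Variables (mu : Prob R (prodsp X)) (Phi : prodsp X -> ('I_N -> R))
  (Psi : ('I_N -> R) -> prodsp X).
Hypothesis iso : unif_iso mu Phi Psi.

Definition tail (t : nat) (C : 'I_N -> set R) : set (prodsp X) :=
  [set x | forall s : 'I_N, (t <= s)%N -> C s (Phi x s)].
Definition wt (t : nat) (C : 'I_N -> set R) : R :=
  \prod_(s < N | (t <= s)%N) fine (rho (C s)).

Lemma wt_ge0 t C : 0 <= wt t C.
Proof. by apply: prodr_ge0 => s _; exact: fine_ge0. Qed.

Lemma measurable_Phi_coord s : measurable_fun setT ((fun x => Phi x s) : borel (prodsp X) -> R).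
Proof.
have [_ _ mPhi _ _] := iso.
have m1 := measurable_coord (X := @RR R N) (ltn_ord s).
have m2 := measurableT_comp m1 (mPhi N).
exact: (measurableT_comp m2 (@measurable_Ft_id R N X polX N)).
Qed.

Lemma Borel_tail t C : (forall s, measurable (C s)) -> Borel (tail t C).
Proof.
move=> mC.
rewrite (_ : tail t C = \bigcap_(s in [set s : 'I_N | (t <= s)%N]) [set x | C s (Phi x s)]); last first.
  by apply/seteqP; split => x.
have : measurable (\bigcap_(s in [set s : 'I_N | (t <= s)%N]) [set x : borel (prodsp X) | C s (Phi x s)]).
  apply: fin_bigcap_measurable => // s _.
  exact: (measurable_preim (measurable_Phi_coord s)).
by [].
Qed.

(** Read through [Phi], A concerns only the first t of N independent coordinates. Both sides are
    finite measures in A, so cylinders decide. *)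
Lemma tail_indep (t : nat) (A : set (prodsp X)) C :
  measurable (A : set (FM (XB X) t)) -> (forall s, measurable (C s)) ->
  mu (A `&` tail t C) = ((wt t C)%:E * mu A)%E.
Proof.
have [PhiK PsiK mPhi mPsi law] := iso.
move=> mA mC.
have mT : measurable (tail t C : set (borel (prodsp X))) by exact: Borel_tail.
have mP : measurable_fun setT (Phi : borel (prodsp X) -> FM (@RR R N) t).
  exact: (measurableT_comp (mPhi t) (@measurable_Ft_id R N X polX t)).
pose m1 := imagem (mrestr mu mT) mP.
pose m2 := mscale (NngNum (wt_ge0 t C)) (imagem mu mP).
pose A' : set (FM (@RR R N) t) := [set w | A (Psi w)].
have mA' : measurable A' by exact: (measurable_preim (mPsi t) mA).
have AE : A = [set x | A' (Phi x)] by apply/seteqP; split => x /=; rewrite /A'/= PhiK.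
suff : m1 A' = m2 A' by rewrite AE.
apply: FM_measure_unique mA' => //.
  rewrite /m1/= /imagem /= /mrestr.
  apply: (@le_lt_trans _ _ 1%E); last exact: ltry.
  apply: (@probability_le1 _ (borel (prodsp X)) R mu); apply: measurableI => //.
  exact: measurableT.
move=> D mD.
rewrite /m1 /m2 /= /mscale /imagem /= /mrestr.
pose E (s : 'I_N) := if (s < t)%N then D s else C s.
pose E' (s : 'I_N) := if (s < t)%N then D s else setT.
have mE s : measurable (E s) by rewrite /E; case: ifP.
have mE' s : measurable (E' s) by rewrite /E'; case: ifP.
have -> : [set x | cyl t D (Phi x)] `&` tail t C = [set x | forall s, E s (Phi x s)].
  apply/seteqP; split => x /=.
    move=> [h1 h2] s; rewrite /E; case: ltnP => st; [exact: h1|exact: h2].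
  move=> h; split=> s st; have := h s; rewrite /E; first by rewrite st.
  by rewrite ltnNge st.
have -> : [set x | cyl t D (Phi x)] = [set x | forall s, E' s (Phi x s)].
  apply/seteqP; split => x /=.
    by move=> h1 s; rewrite /E'; case: ltnP => // st; exact: h1.
  by move=> h s st; have := h s; rewrite /E' st.
rewrite (law _ mE) (law _ mE') -EFinM; congr EFin.
rewrite (bigID (fun s : 'I_N => (t <= s)%N))/=; congr (_ * _).
  by apply: eq_bigr => s ts; rewrite /E ltnNge ts.
rewrite [RHS](bigID (fun s : 'I_N => (t <= s)%N))/= [X in X * _]big1 ?mul1r.
  by apply: eq_bigr => s; rewrite -ltnNge /E /E' => ->.
by move=> s ts; rewrite /E' ltnNge ts/= probability_setT.
Qed.

Lemma tail_indep_integral (t : nat) (g : FM (XB X) t -> \bar R) C :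
  measurable_fun setT g -> (forall x, 0 <= g x)%E -> (forall s, measurable (C s)) ->
  (\int[mu]_(x in tail t C) g x)%E = ((wt t C)%:E * \int[mu]_x g x)%E.
Proof.
move=> mg g0 mC.
have mT : measurable (tail t C : set (borel (prodsp X))) by exact: Borel_tail.
have mi := @measurable_Ft_id R N X polX t.
have mg' : measurable_fun setT (g : borel (prodsp X) -> \bar R) by exact: (measurableT_comp mg mi).
rewrite -(ge0_integral_mrestr mu mT mg' g0).
transitivity (\int[imagem (mrestr mu mT) mi]_x g x)%E.
  by rewrite ge0_integral_imagem.
transitivity (\int[mscale (NngNum (wt_ge0 t C)) (imagem mu mi)]_x g x)%E.
  apply: eq_measure_integral => A mA _.
  exact: tail_indep.
by rewrite ge0_integral_mscale//= ge0_integral_imagem.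
Qed.

Context (Y : 'I_N -> ptopologicalType).

(* Causality in terms of innovations: under [pi] the uniform variables [Phi x s], [s >= t],
   are independent of the first [t] coordinates of [x] and of [y]. *)
Definition IC (pi : set (pairsp (prodsp X) (prodsp Y)) -> \bar R) :=
  forall (t : 'I_N) (A : set (prodsp X)) C (B : set (prodsp Y)),
    measurable (A : set (FM (XB X) t)) -> (forall s, measurable (C s)) ->
    measurable (B : set (FM (XB Y) t)) ->
    pi ((A `&` tail t C) `*` B) = ((wt t C)%:E * pi (A `*` B))%E.

Hypothesis polY : forall t, polish R (Y t).

Lemma BorelX (A : set (prodsp X)) (B : set (prodsp Y)) : Borel A -> Borel B ->
  Borel (A `*` B : set (pairsp (prodsp X) (prodsp Y))).
Proof.
move=> mA mB; apply/Borel_pair; [exact: prodsp_cbase polX|exact: prodsp_cbase polY|].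
exact: (@measurableX _ _ (borel (prodsp X)) (borel (prodsp Y)) A B mA mB).
Qed.

(** For B in F_t the function [K x B] is F_t-measurable, so the integrand 1_A(x) K(x, B) is
    independent of the innovations from t on. *)
Lemma causal_IC pi : causal mu pi -> IC pi.
Proof.
move=> [K [mK piK aK]] t A C B mA mC mB.
have BA := Borel_Ft polX mA; have BT := Borel_tail t mC.
have BB := Borel_Ft polY mB.
pose g (x : FM (XB X) t) : \bar R := ((\1_A x)%:E * K x B)%E.
have mg : measurable_fun setT g.
  apply: emeasurable_funM; first by apply/measurable_EFinP; exact: measurable_indic.
  by move=> _ D mD; rewrite setTI; exact: aK.
have g0 x : (0 <= g x)%E by rewrite mule_ge0// lee_fin.
rewrite piK; last by apply: BorelX => //; exact: (@measurableI _ (borel (prodsp X))).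
rewrite piK; last exact: BorelX.
transitivity (\int[mu]_(x in tail t C) g x)%E.
  rewrite [RHS]integral_mkcond; apply: eq_integral => x _.
  rewrite patchE /g indicE; case: ifPn => [|].
    rewrite inE => Tx; case: (boolP (x \in A)) => [|].
      rewrite inE mul1e => Ax; congr (K x _).
      by apply/seteqP; split => y /= => [[]//|By]; split.
    rewrite notin_setE mul0e => nA; rewrite [X in K x X](_ : _ = set0) ?measure0//.
    by apply/seteqP; split => // y [[]].
  rewrite notin_setE => nT; rewrite [X in K x X](_ : _ = set0) ?measure0//.
  by apply/seteqP; split => // y [[]].
rewrite tail_indep_integral//; congr (_ * _)%E.
apply: eq_integral => x _; rewrite /g indicE.
case: (boolP (x \in A)) => [|].
  rewrite inE mul1e => Ax; congr (K x _).
  by apply/seteqP; split => y /= => [|[]//]; split.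
rewrite notin_setE mul0e => nA; rewrite [X in K x X](_ : _ = set0) ?measure0//.
by apply/seteqP; split => // y [].
Qed.

End Independence.

(** * Disintegration *)

Section ProductProbability.
Context d1 d2 (T1 : measurableType d1) (T2 : measurableType d2) (R : realType).
Variables (P : probability T1 R) (Q : probability T2 R).

Definition prodp_ : set (T1 * T2) -> \bar R := (P \x Q)%E.
HB.instance Definition _ := Measure.on prodp_.
Let prodpT : prodp_ setT = 1%E.
Proof.
rewrite -setXTT /prodp_ product_measure1E//.
by rewrite -[RHS]mule1; congr (_ * _)%E; exact: probability_setT.
Qed.
HB.instance Definition _ := @Measure_isProbability.Build _ _ R prodp_ prodpT.
Definition prodp : probability (T1 * T2)%type R := prodp_.

Lemma prodpE (S : set (T1 * T2)) :
  prodp S = (\int[P]_x Q [set y | S (x, y)])%E.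
Proof.
rewrite /prodp/= /prodp_ /product_measure1; apply: eq_integral => x _ /=.
by congr (Q _); apply/seteqP; split => y; rewrite /xsection/= inE.
Qed.

Lemma prodpX A B : measurable A -> measurable B -> prodp (A `*` B) = (P A * Q B)%E.
Proof. by move=> mA mB; exact: product_measure1E. Qed.

Lemma measurable_section (S : set (T1 * T2)) : measurable S ->
  measurable_fun setT (fun x => Q [set y | S (x, y)]).
Proof.
move=> mS; rewrite (_ : (fun x => _) = Q \o xsection S).
  exact: measurable_fun_xsection.
apply/funext => x /=.
by congr (Q _); apply/seteqP; split => y; rewrite /xsection/= inE.
Qed.

End ProductProbability.

Lemma prod_measure_unique d1 d2 (T1 : measurableType d1) (T2 : measurableType d2)
  (R : realType) (m1 m2 : {measure set (T1 * T2)%type -> \bar R}) :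
  (m1 setT < +oo)%E ->
  (forall A B, measurable A -> measurable B -> m1 (A `*` B) = m2 (A `*` B)) ->
  forall S, measurable S -> m1 S = m2 S.
Proof.
move=> m1T m12.
apply: (@measure_unique _ R (T1 * T2)%type
  [set A `*` B | A in @measurable _ T1 & B in @measurable _ T2] (fun=> setT)) => //.
- exact: measurable_prod_measurableType.
- move=> _ _ [A mA [B mB <-]] [A' mA' [B' mB' <-]].
  exists (A `&` A'); first exact: measurableI.
  by exists (B `&` B'); [exact: measurableI|rewrite setXI].
- by move=> _; exists setT => //; exists setT => //; rewrite setXTT.
- by rewrite bigcup_const//; exists 0%N.
- by move=> _ [A mA [B mB <-]]; exact: m12.
Qed.

Lemma rat_ray_unique (R : realType) (m1 m2 : {measure set R -> \bar R}) :
  (m1 setT < +oo)%E ->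
  (forall a : rat, m1 `]-oo, ratr a[%classic = m2 `]-oo, ratr a[%classic) ->
  forall A, measurable A -> m1 A = m2 A.
Proof.
move=> m1T m12.
apply: (@measure_unique _ R R [set `]-oo, (ratr a : R)[%classic | a in [set: rat]]
   (fun n => `]-oo, ratr n%:R[%classic)).
- have -> : @measurable _ R = <<s @RGenInftyO.G R >> by exact: RGenInftyO.measurableE.
  apply/seteqP; split.
    apply: smallest_sub; first exact: smallest_sigma_algebra.
    move=> _ [b ->].
    rewrite (_ : `]-oo, b[%classic = \bigcup_(n in [set n | ratr (odflt 0 (unpickle n)) <= b])
      `]-oo, (ratr (odflt 0 (unpickle n)) : R)[%classic); last first.
      apply/seteqP; split => x /=.
        rewrite in_itv/= => xb; have [q] := rat_in_itvoo xb.
        rewrite in_itv/= => /andP[xq qb].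
        exists (pickle q); rewrite /mkset pickleK; first exact: ltW.
        by rewrite /= in_itv.
      by move=> [n /= nb]; rewrite !in_itv/= => /lt_le_trans; apply.
    apply: (@bigcup_measurable _ (g_sigma_algebraType
      [set `]-oo, (ratr a : R)[%classic | a in [set: rat]])) => n _.
    by apply: sub_sigma_algebra; exists (odflt 0 (unpickle n)).
  apply: smallest_sub; first exact: smallest_sigma_algebra.
  by move=> _ [a _ <-]; apply: sub_sigma_algebra; exists (ratr a).
- move=> _ _ [a _ <-] [b _ <-]; exists (Num.min a b) => //.
  case: (leP a b) => ab.
    rewrite setIidl// => x /=; rewrite !in_itv/= => /lt_le_trans; apply.
    by rewrite ler_rat.
  rewrite setIidr// => x /=; rewrite !in_itv/= => /lt_trans; apply.
  by rewrite ltr_rat.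
- by move=> n; exists n%:R.
- apply/seteqP; split => // x _.
  exists (Num.bound `|x|) => //=; rewrite in_itv/= ratr_nat.
  by rewrite (le_lt_trans (ler_norm x))// archi_boundP.
- by move=> _ [a _ <-]; exact: m12.
- move=> n; apply: le_lt_trans m1T; apply: le_measure; rewrite ?inE//.
Qed.

Lemma ae_le_integral d (T : measurableType d) (R : realType) (P : probability T R)
  (f g : T -> R) : P.-integrable setT (EFin \o f) -> P.-integrable setT (EFin \o g) ->
  (forall U, measurable U -> (\int[P]_(x in U) (f x)%:E <= \int[P]_(x in U) (g x)%:E)%E) ->
  {ae P, forall x, f x <= g x}.
Proof.
move=> fi gi fg.
have mf : measurable_fun setT f by apply/measurable_EFinP; exact: measurable_int fi.
have mg : measurable_fun setT g by apply/measurable_EFinP; exact: measurable_int gi.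
pose U := [set x | g x < f x].
have mU : measurable U.
  have := measurable_fun_ltr mg mf measurableT (Y := [set true]) I.
  by rewrite setTI; congr measurable.
have : ae_eq P U (EFin \o f) (EFin \o g).
  apply: integral_ae_eq => //.
  - exact: integrableS fi.
  - by apply: measurable_funTS; exact: measurable_int gi.
  - move=> E EU mE; apply/eqP; rewrite eq_le fg//=; apply: le_integral => //.
    + exact: integrableS gi.
    + exact: integrableS fi.
    + by move=> x /[!inE] /EU /ltW; rewrite lee_fin.
apply: filterS => x /= h; rewrite leNgt; apply/negP => gf.
by move: (h gf) => -[fe]; move: gf; rewrite fe ltxx.
Qed.

Section Slice.
Context d1 d2 (A : measurableType d1) (Y : measurableType d2) (R : realType).
Variables (pi : probability (A * Y)%type R) (S : set Y).
Hypothesis mS : measurable S.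

Definition slice (_ : measurable S) : set A -> \bar R := fun U => pi (U `*` S).
Let slice0 : slice mS set0 = 0%E. Proof. by rewrite /slice set0X measure0. Qed.
Let slice_ge0 U : (0 <= slice mS U)%E. Proof. exact: measure_ge0. Qed.
Let slice_sigma : semi_sigma_additive (slice mS).
Proof.
move=> F mF tF mUF; rewrite /slice setX_bigcupl.
apply: measure_semi_sigma_additive.
- by move=> n; exact: measurableX.
- apply/trivIsetP => i j _ _ ij; move/trivIsetP : tF => /(_ i j I I ij) Fij.
  apply/seteqP; split => // -[x y] [[/= Fi _] [/= Fj _]].
  by have : (F i `&` F j) x by []; rewrite Fij.
- by apply: bigcupT_measurable => n; exact: measurableX.
Qed.
HB.instance Definition _ := isMeasure.Build _ _ R (slice mS) slice0 slice_ge0 slice_sigma.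
Let slice_fin : fin_num_fun (slice mS).
Proof. by move=> U mU; apply: prob_fin; exact: measurableX. Qed.
HB.instance Definition _ := Measure_isFinite.Build _ _ R (slice mS) slice_fin.

Variable mu : probability A R.
Hypothesis mu1 : forall U, measurable U -> pi (U `*` setT) = mu U.

(** The slice measure is dominated by the first marginal; its Radon-Nikodym derivative is the
    conditional probability of [S] given x. *)
Lemma slice_density : exists f : A -> R, mu.-integrable setT (EFin \o f) /\
  forall U, measurable U -> (\int[mu]_(x in U) (f x)%:E)%E = pi (U `*` S).
Proof.
pose nu := charge_of_finite_measure (slice mS).
have dom : nu `<< mu.
  apply/null_content_dominatesP => U mU mu0.
  apply/eqP; rewrite eq_le; apply/andP; split; last exact: slice_ge0.
  apply: (@le_trans _ _ (mu U)); last by rewrite mu0.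
  rewrite -(mu1 mU); apply: (@prob_le _ _ R pi); [exact: measurableX|exact: measurableX|].
  by move=> -[x y] [].
exists (fun x => fine (Radon_Nikodym nu mu x)).
have fE : EFin \o (fun x => fine (Radon_Nikodym nu mu x)) = Radon_Nikodym nu mu.
  by apply/funext => x /=; rewrite fineK// Radon_Nikodym_fin_num.
split; first by rewrite fE; exact: Radon_Nikodym_integrable.
move=> U mU; have := Radon_Nikodym_integral dom mU; rewrite -fE => <-.
by [].
Qed.

End Slice.

Section Disintegration.
Context d1 d2 (A : measurableType d1) (Y : measurableType d2) (R : realType).
Variables (pi : probability (A * Y)%type R) (mu : probability A R).
Hypothesis mu1 : forall U, measurable U -> pi (U `*` setT) = mu U.
Variables (c : Y -> R) (c' : R -> Y).
Hypotheses (mc : measurable_fun setT c) (mc' : measurable_fun setT c')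
  (cK : forall y, c' (c y) = y) (c01 : forall y, 0 < c y < 1).

Let S (q : rat) : set Y := [set y | c y <= ratr q].
Let mS q : measurable (S q).
Proof.
rewrite (_ : S q = [set y | `]-oo, (ratr q : R)]%classic (c y)]).
  exact: measurable_preim.
by apply/seteqP; split => y /=; rewrite in_itv.
Qed.

(** The pointwise properties that make quantiles of the family meaningful. The values at q <= 0 and
    q >= 1 reflect that codes lie strictly between 0 and 1. *)
Definition cond_cdf_ok (f : rat -> A -> R) (x : A) := forall q q' : rat,
  [/\ q <= q' -> f q x <= f q' x, 0 <= f q x, f q x <= 1,
      q <= 0 -> f q x <= 0 & 1 <= q -> 1 <= f q x].

Lemma cond_cdf : exists f : rat -> A -> R, [/\ forall q, measurable_fun setT (f q),
  forall x, cond_cdf_ok f x &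
  forall q U, measurable U -> (\int[mu]_(x in U) (f q x)%:E)%E = pi (U `*` S q)].
Proof.
have dens q : {f : A -> R | mu.-integrable setT (EFin \o f) /\
  forall U, measurable U -> (\int[mu]_(x in U) (f x)%:E)%E = pi (U `*` S q)}.
  exact: cid (slice_density (mS q) mu1).
pose f q := sval (dens q).
have fi q : mu.-integrable setT (EFin \o f q) by exact: (svalP (dens q)).1.
have fE q U : measurable U -> (\int[mu]_(x in U) (f q x)%:E)%E = pi (U `*` S q).
  exact: (svalP (dens q)).2.
have ci (r : R) : mu.-integrable setT (EFin \o (fun=> r) : A -> \bar R).
  exact: finite_measure_integrable_cst.
have cint (r : R) U : measurable U -> (\int[mu]_(x in U) r%:E)%E = (r%:E * mu U)%E.
  by move=> mU; rewrite integral_cst.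
have mX U q : measurable U -> measurable (U `*` S q) by move=> mU; exact: measurableX.
have ok : {ae mu, forall x, forall n : nat,
    let p := odflt (0, 0) (unpickle n) : rat * rat in
    [/\ p.1 <= p.2 -> f p.1 x <= f p.2 x, 0 <= f p.1 x, f p.1 x <= 1,
      p.1 <= 0 -> f p.1 x <= 0 & 1 <= p.1 -> 1 <= f p.1 x]}.
  apply: ae_foralln => n; move: (odflt _ _) => [q q'] /=.
  have h1 : {ae mu, forall x, q <= q' -> f q x <= f q' x}.
    have [qq'|qq'] := boolP (q <= q'); last by apply: aeW.
    apply: (filterS _ (ae_le_integral (fi q) (fi q') _)); first by move=> x h _.
    move=> U mU; rewrite !fE//; apply: prob_le; try exact: mX.
    move=> [x y] [/= Ux cy]; split => //; apply: le_trans cy _.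
    by rewrite ler_rat.
  have h2 : {ae mu, forall x, 0 <= f q x}.
    apply: (ae_le_integral (ci 0) (fi q)) => U mU.
    by rewrite cint// mul0e fE//.
  have h3 : {ae mu, forall x, f q x <= 1}.
    apply: (ae_le_integral (fi q) (ci 1)) => U mU.
    rewrite cint// mul1e fE// -mu1//; apply: prob_le; [exact: mX|exact: measurableX|].
    by move=> [x y] [].
  have h4 : {ae mu, forall x, q <= 0 -> f q x <= 0}.
    have [q0|q0] := boolP (q <= 0); last by apply: aeW.
    apply: (filterS _ (ae_le_integral (fi q) (ci 0) _)); first by move=> x h _.
    move=> U mU; rewrite cint// mul0e fE// (_ : _ `*` _ = set0) ?measure0//.
    apply/seteqP; split => // -[x y] [/= _] /=; rewrite /S/=.
    have /andP[c0 _] := c01 y; rewrite leNgt => /negP; apply.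
    by apply: le_lt_trans c0; rewrite -(rmorph0 (@ratr R)) ler_rat.
  have h5 : {ae mu, forall x, 1 <= q -> 1 <= f q x}.
    have [q0|q0] := boolP (1 <= q); last by apply: aeW.
    apply: (filterS _ (ae_le_integral (ci 1) (fi q) _)); first by move=> x h _.
    move=> U mU; rewrite cint// mul1e fE// -mu1// (_ : S q = setT)//.
    apply/seteqP; split => // y _; rewrite /S/=; have /andP[_ /ltW c1] := c01 y.
    by apply: (le_trans c1); rewrite -(rmorph1 (@ratr R)) ler_rat.
  have h45 : {ae mu, forall x, (q <= 0 -> f q x <= 0) /\ (1 <= q -> 1 <= f q x)}.
    exact: (filterS2 _ _ h4 h5).
  have h12 : {ae mu, forall x, (q <= q' -> f q x <= f q' x) /\ 0 <= f q x}.
    exact: (filterS2 _ _ h1 h2).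
  apply: (filterS3 _ _ h12 h3 h45).
  by move=> x [? ?] ? [? ?]; split.
have {ok} [M [mM M0 ok]] := ok.
have Mok x : ~ M x -> cond_cdf_ok f x.
  move=> nM; have : (forall n : nat,
    let p := odflt (0, 0) (unpickle n) : rat * rat in
    [/\ p.1 <= p.2 -> f p.1 x <= f p.2 x, 0 <= f p.1 x, f p.1 x <= 1,
      p.1 <= 0 -> f p.1 x <= 0 & 1 <= p.1 -> 1 <= f p.1 x]).
    by apply: contrapT => h; apply: nM; apply: ok.
  by move=> h q q'; have := h (pickle (q, q')); rewrite pickleK.
have mf q : measurable_fun setT (f q) by apply/measurable_EFinP; exact: measurable_int (fi q).
(* Each property holds almost everywhere for each of countably many pairs of rationals, hence off a
   single null set; on it the family is replaced by the distribution function of the point mass at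
   1. *)
pose g (q : rat) x : R := if x \in M then (1 <= q)%R%:R else f q x.
have mg q : measurable_fun setT (g q).
  by apply: measurable_fun_ifT => //; exact: measurable_mem.
exists g; split => //.
- move=> x q q'; rewrite /g; case: ifPn => [_|].
    split => //.
    + by move=> qq'; rewrite ler_nat; case: (leP 1 q) => // q1; rewrite (le_trans q1 qq').
    + by rewrite lern1 leq_b1.
    + by move=> q0; rewrite lern0 eqb0 -ltNge (le_lt_trans q0).
    + by move=> ->.
  by rewrite notin_setE => /Mok; apply.
- move=> q U mU; rewrite -fE//; apply: ae_eq_integral => //.
  + by apply: measurable_funTS; apply/measurable_EFinP.
  + by apply: measurable_funTS; apply/measurable_EFinP.
  + exists M; split => // x /= h; apply: contrapT => nM; apply: h => _.
    by rewrite /g memNset.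
Qed.

(* [H x u] is the quantile at level [u] of the conditional law of the code of [y] given [x]. *)
Lemma disintegration : exists H : A * R -> Y, measurable_fun setT H /\
  forall W, measurable W -> pi W = prodp mu rho [set p | W (p.1, H p)].
Proof.
have [f [mf fok fE]] := cond_cdf.
pose h (p : A * R) : R := if (0 < p.2) && (p.2 < 1) then
  inf [set (ratr q : R) | q in [set q | p.2 <= f q p.1]] else 0.
(* The strict inequality is the one that an infimum over rational points decides without right
   continuity of the family. *)
have hP x u (a : R) : 0 < u -> u < 1 ->
    (h (x, u) < a <-> exists2 q : rat, ratr q < a & u <= f q x).
  move=> u0 u1; rewrite /h /= u0 u1/=.
  have lb : has_lbound [set (ratr q : R) | q in [set q | u <= f q x]].
    exists 0 => _ [q /= uq <-]; rewrite -(rmorph0 (@ratr R)) ler_rat leNgt; apply/negP => q0.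
    have [_ _ _ /(_ (ltW q0)) + _] := fok x q q.
    by move=> /(le_trans uq); rewrite leNgt u0.
  have ne : [set (ratr q : R) | q in [set q | u <= f q x]] !=set0.
    exists (ratr 1), 1 => //=; have [_ _ _ _ /(_ (lexx _))] := fok x 1 1.
    exact: le_trans (ltW u1).
  split => [/inf_lt|[q qa uq]].
    by move=> /(_ ne)[_ [q /= uq <-] qa]; exists q.
  by apply: le_lt_trans qa; apply: ge_inf => //; exists q.
have mle (q : rat) : measurable [set p : A * R | p.2 <= f q p.1].
  have m1 : measurable_fun setT (fun p : A * R => f q p.1) by exact: measurableT_comp.
  have m2 : measurable_fun setT (fun p : A * R => p.2) by exact: measurable_snd.
  have := measurable_fun_ler m2 m1 measurableT (Y := [set true]) I.
  by rewrite setTI; congr measurable.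
have m01 : measurable ([set p : A * R | (0 < p.2) && (p.2 < 1)]).
  rewrite (_ : mkset _ = setT `*` `]0, 1[%classic); first exact: measurableX.
  by apply/seteqP; split => p /=; rewrite in_itv/= => //; case.
have mh : measurable_fun setT h.
  apply: measurable_fun_lt_rays => a.
  rewrite (_ : mkset _ = ([set p : A * R | (0 < p.2) && (p.2 < 1)] `&`
    \bigcup_(q in [set q : rat | ratr q < a]) [set p : A * R | p.2 <= f q p.1]) `|`
    (~` [set p : A * R | (0 < p.2) && (p.2 < 1)] `&` [set p : A * R | 0 < a])).
    apply: measurableU; apply: measurableI => //.
    - rewrite bigcup_mkcond; apply: bigcupT_measurable_rat => q.
      by case: ifPn.
    - exact: measurableC.
    - by case: (0 < a) => /=; [rewrite (_ : mkset _ = setT)|rewrite (_ : mkset _ = set0)];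
        rewrite //; apply/seteqP; split.
  apply/seteqP; split => -[x u] /=.
    have [/andP[u0 u1]|n01] := boolP ((0 < u) && (u < 1)).
      by move=> /(hP x u a u0 u1)[q qa uq]; left; split => //; exists q.
    by rewrite /h/= (negbTE n01); right; split => //; apply/negP.
  case=> [[/andP[u0 u1] [q qa uq]]|[/negP n01 a0]].
    by apply/(hP x u a u0 u1); exists q.
  by rewrite /h/= (negbTE n01).
exists (c' \o h); split; first exact: measurableT_comp.
have mph : measurable_fun setT (fun p : A * R => (p.1, h p)) by exact: measurable_fun_pair.
have mpc : measurable_fun setT (fun p : A * Y => (p.1, c p.2)).
  by apply: measurable_fun_pair => //; exact: measurableT_comp.
pose n1 := imagep pi mpc; pose n2 := imagep (prodp mu rho) mph.
suff n12 : forall V, measurable V -> n1 V = n2 V.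
  move=> W mW.
  have mcc : measurable_fun setT (fun p : A * R => (p.1, c' p.2)).
    by apply: measurable_fun_pair => //; exact: measurableT_comp.
  transitivity (n1 [set p | W (p.1, c' p.2)]).
    have -> : n1 [set p | W (p.1, c' p.2)] = pi [set p | W (p.1, c' (c p.2))] by [].
    by congr (pi _); apply/seteqP; split => -[x y]; rewrite /mkset cK.
  exact: (n12 _ (measurable_preim mcc mW)).
apply: prod_measure_unique.
  exact: (le_lt_trans (probability_le1 n1 measurableT) (ltry 1)).
move=> U V mU mV.
have mUT : measurable (U `*` [set: R]) by exact: measurableX.
have msnd : measurable_fun setT (fun p : A * R => p.2) by exact: measurable_snd.
pose v1 := imagem (mrestr n1 mUT) msnd; pose v2 := imagem (mrestr n2 mUT) msnd.
have UVE B : U `*` B = [set p : A * R | B p.2] `&` (U `*` [set: R]).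
  by apply/seteqP; split => p; [move=> [? ?]; split|move=> [? [? _]]; split].
have vE1 B : v1 B = n1 (U `*` B) by rewrite (UVE B).
have vE2 B : v2 B = n2 (U `*` B) by rewrite (UVE B).
apply: (etrans (esym (vE1 V))); apply: (etrans _ (vE2 V)).
apply: rat_ray_unique mV.
  have h1 : (v1 setT <= 1)%E by rewrite vE1; exact: probability_le1.
  exact: (le_lt_trans h1 (ltry 1)).
move=> a; apply: (etrans (vE1 _)); apply: (etrans _ (esym (vE2 _))).
(* [fE] gives masses for closed rays at rational ends only, so the open ray at a is exhausted, on
   the side of y and on the side of the level u, along rationals increasing to a. *)
pose q n : rat := a - (2 ^- n).
have qlt n : q n < a by rewrite /q ltrBlDr ltrDl invr_gt0 exprn_gt0.
have qnd n m : (n <= m)%N -> q n <= q m.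
  by move=> nm; rewrite /q lerD2l lerN2 lef_pV2 ?posrE ?exprn_gt0// ler_eXn2l ?ltr1n.
have qcof (r : R) : r < ratr a -> exists n, r < ratr (q n).
  move=> ra; have [n hn] := inv_expn_small (etrans (subr_gt0 r (ratr a)) ra).
  exists n; rewrite /q rmorphB/= fmorphV rmorphXn/= rmorph_nat.
  by rewrite ltrBrDr -ltrBrDl.
pose E1 n : set (A * Y) := U `*` S (q n).
pose E2 n : set (A * R) := (U `*` [set: R]) `&` ([set p | p.2 <= f (q n) p.1] `&`
   [set p : A * R | (0 < p.2) && (p.2 < 1)]).
have mE1 n : measurable (E1 n) by exact: measurableX.
have mE2 n : measurable (E2 n) by apply: measurableI => //; exact: measurableI.
have E12 n : pi (E1 n) = prodp mu rho (E2 n).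
  rewrite -fE// prodpE integral_mkcond; apply: eq_integral => x _.
  rewrite patchE; case: ifPn => [|].
    rewrite inE => Ux; rewrite (_ : [set y | _] = `]0, 1[%classic `&` [set y | y <= f (q n) x]); last first.
      apply/seteqP; split => u /=; rewrite in_itv/=; first by case=> [[_ _] [? ?]].
      by case=> ? ?.
    have [_ f0 f1 _ _] := fok x (q n) (q n).
    rewrite rhoE; apply/eqP; rewrite eq_le; apply/andP; split.
    - apply: (@le_trans _ _ (lebesgue_measure `]0, f (q n) x[%classic)).
        rewrite lebesgue_measure_itv/= lte_fin; case: ifPn => [_|].
          by rewrite oppr0 adde0.
        by rewrite -leNgt lee_fin.
      apply: le_measure; rewrite ?inE//.
        apply: measurableI => //; apply: measurableI => //.
        rewrite (_ : mkset _ = `]-oo, f (q n) x]%classic)//.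
      move=> u /=; rewrite !in_itv/= => /andP[u0 uf].
      by rewrite u0 (ltW u0) (ltW uf) (lt_le_trans uf f1).
    - apply: (@le_trans _ _ (lebesgue_measure `[0, f (q n) x]%classic)).
        apply: le_measure; rewrite ?inE//.
          apply: measurableI => //; apply: measurableI => //.
          rewrite (_ : mkset _ = `]-oo, f (q n) x]%classic)//.
        by move=> u /=; rewrite !in_itv/= => -[[_ ->]] /andP[->].
      rewrite lebesgue_measure_itv/= lte_fin; case: ifPn => // _.
      by rewrite oppr0 adde0.
  rewrite notin_setE => nU; rewrite (_ : [set y | _] = set0) ?measure0//.
  by apply/seteqP; split => // u [[]].
have nd1 n m : (n <= m)%N -> E1 n `<=` E1 m.
  move=> nm [x y] [/= Ux cy]; split => //=; apply: le_trans cy _.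
  by rewrite ler_rat qnd.
have nd2 n m : (n <= m)%N -> E2 n `<=` E2 m.
  move=> nm [x u] [[/= Ux _] [uf u01]]; split => //; split => //=; apply: le_trans uf _.
  by have [] := fok x (q n) (q m); move=> /(_ (qnd _ _ nm)).
have cv1 := @nondecreasing_cvg_mu _ _ _ pi E1 mE1 (bigcup_measurable (fun n _ => mE1 n))
  (fun n m nm => introT (subsetPset _ _) (nd1 _ _ nm)).
have cv2 := @nondecreasing_cvg_mu _ _ _ (prodp mu rho) E2 mE2 (bigcup_measurable (fun n _ => mE2 n))
  (fun n m nm => introT (subsetPset _ _) (nd2 _ _ nm)).
have L1 : n1 (U `*` `]-oo, ratr a[%classic) = pi (\bigcup_n E1 n).
  rewrite /n1 imagepE; congr (pi _); apply/seteqP; split => -[x y] /=; rewrite /S/=.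
    rewrite in_itv/= => -[Ux /qcof[n cn]]; exists n => //; split => //=.
    by rewrite /S/= ltW.
  move=> [n _ [/= Ux cn]]; rewrite in_itv/=; split => //; apply: le_lt_trans cn _.
  by rewrite ltr_rat qlt.
have rI : rho (~` `]0, 1[%classic : set R) = 0%E.
  rewrite rhoE (_ : _ `&` _ = [set 0]) ?lebesgue_measure_set1//.
  apply/seteqP; split => u /=; rewrite !in_itv/=.
    move=> [/negP + /andP[u0 u1]]; rewrite u1 andbT -leNgt => u0'.
    by apply/eqP; rewrite eq_le u0 u0'.
  by move=> ->; rewrite lexx ltxx ltr01.
have L2 : n2 (U `*` `]-oo, ratr a[%classic) = prodp mu rho (\bigcup_n E2 n).
  change (prodp mu rho [set p | (U `*` `]-oo, ratr a[%classic) (p.1, h p)] =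
    prodp mu rho (\bigcup_n E2 n)).
  pose M : set (A * R) := [set: A] `*` ~` `]0, 1[%classic.
  apply: (@prob_eq_off _ _ R (prodp mu rho) _ _ M).
  - by apply: (measurable_preim mph); exact: measurableX.
  - exact: bigcup_measurable.
  - by apply: measurableX => //; exact: measurableC.
  - by rewrite prodpX//; [rewrite rI mule0|exact: measurableC].
  move=> [x u] /= n01.
  have /andP[u0 u1] : (0 < u) && (u < 1).
    by apply: contrapT => h'; apply: n01; split => //; rewrite /= in_itv.
  rewrite in_itv/=; split.
    move=> [Ux /(hP x u _ u0 u1)[r ra ur]]; have [n hn] := qcof _ ra.
    exists n => //; split => //; split => /=; last by rewrite u0.
    apply: le_trans ur _; have [+ _ _ _ _] := fok x r (q n); apply.
    by rewrite -(ler_rat R) ltW.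
  move=> [n _ [[/= Ux _] [/= uf _]]]; split => //.
  by apply/(hP x u _ u0 u1); exists (q n) => //; rewrite ltr_rat.
apply: (etrans L1); apply: (etrans _ (esym L2)); apply: (cvg_unique _ cv1); first exact: ereal_hausdorff.
rewrite (_ : _ \o _ = prodp mu rho \o E2)//; apply/funext => n /=.
exact: E12.
Qed.

End Disintegration.

(** * Innovation condition and causality *)

(** Countably many quadrants suffice, so that agreement of two kernels can be checked outside one
    null set. *)
Lemma FM_RR_unique (R : realType) N t (m1 m2 : {measure set (FM (@RR R N) t) -> \bar R}) :
  (m1 setT < +oo)%E ->
  (forall q : {ffun 'I_N -> rat}, m1 (cyl (X := @RR R N) t (fun s => `]-oo, (ratr (q s) : R)[%classic)) =
    m2 (cyl (X := @RR R N) t (fun s => `]-oo, (ratr (q s) : R)[%classic))) ->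
  forall A, measurable A -> m1 A = m2 A.
Proof.
move=> m1T m12.
pose G : set (set ('I_N -> R)) := [set A | exists q : {ffun 'I_N -> rat},
  A = cyl (X := @RR R N) t (fun s => `]-oo, (ratr (q s) : R)[%classic)].
apply: (@measure_unique _ R (FM (@RR R N) t) G
  (fun n => cyl (X := @RR R N) t (fun s => `]-oo, (ratr n%:R : R)[%classic))) => //.
- apply/seteqP; split; last first.
    apply: smallest_sub; first exact: sigma_algebra_measurable.
    by move=> _ [q ->]; apply: measurable_cyl => s; exact: measurable_itv.
  apply: smallest_sub; first exact: smallest_sigma_algebra.
  move=> _ [s [st [B [mB ->]]]].
  pose GT := g_sigma_algebraType G.
  have ms : measurable_fun setT ((fun x : 'I_N -> R => x s) : GT -> R).
    apply: measurable_fun_lt_rays => a.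
    rewrite (_ : mkset _ = \bigcup_(n in [set n : nat | forall q : {ffun 'I_N -> rat}, unpickle n = Some q -> ratr (q s) <= a])
      \bigcup_(q in [set q : {ffun 'I_N -> rat} | unpickle n = Some q])
        cyl (X := @RR R N) t (fun s => `]-oo, (ratr (q s) : R)[%classic)).
      apply: bigcup_measurable => n _.
      case E: (unpickle n) => [q|].
        rewrite (_ : mkset _ = [set q]) ?bigcup_set1.
          by apply: sub_sigma_algebra; exists q.
        by apply/seteqP; split => q' /= => [[->]|->].
      by rewrite (_ : mkset _ = set0) ?bigcup_set0//; apply/seteqP; split.
    apply/seteqP; split => x /=.
      move=> xa; have [r] := rat_in_itvoo xa; rewrite in_itv/= => /andP[xr ra].
      have bnd s' : {r' : rat | x s' < ratr r'}.
        apply: cid; exists (Num.bound `|x s'|)%:R; rewrite ratr_nat.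
        by rewrite (le_lt_trans (ler_norm _))// archi_boundP.
      pose q := [ffun s' => if s' == s then r else sval (bnd s')] : {ffun 'I_N -> rat}.
      exists (pickle q).
        by move=> q'; rewrite pickleK => -[<-]; rewrite ffunE eqxx ltW.
      exists q; first by rewrite /mkset pickleK.
      move=> s' _; rewrite /= in_itv/= ffunE; case: ifPn => [/eqP ->//|_].
      exact: svalP (bnd s').
    move=> [n nq [q /= /nq qa]] /(_ s st); rewrite /= in_itv/= => /lt_le_trans; exact.
  exact: (measurable_preim ms mB).
- move=> _ _ [q ->] [q' ->]; exists [ffun s => Num.min (q s) (q' s)].
  apply/seteqP; split => x.
    move=> [h h'] s st; have := h s st; have := h' s st; rewrite /= !in_itv/= ffunE.
    by case: (leP (q s) (q' s)).
  move=> h; split => s st; have := h s st; rewrite /= !in_itv/= ffunE => /lt_le_trans; apply.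
    by rewrite ler_rat ge_min lexx.
  by rewrite ler_rat ge_min lexx orbT.
- by move=> n; exists [ffun=> n%:R]; apply/seteqP; split => x h s st; have := h s st; rewrite ffunE.
- apply/seteqP; split => // x _.
  exists (\max_s Num.bound `|x s|) => // s _; rewrite /= in_itv/= ratr_nat.
  rewrite (le_lt_trans (ler_norm _))//; apply: (lt_le_trans (archi_boundP (normr_ge0 (x s)))).
  by rewrite ler_nat (leq_bigmax s).
- by move=> _ [q ->]; exact: m12.
- move=> n; apply: le_lt_trans m1T; apply: le_measure; rewrite ?inE//.
  by apply: measurable_cyl => s; exact: measurable_itv.
Qed.

Section IsoUnique.
Context (R : realType) (N : nat) (X : 'I_N -> ptopologicalType).
Hypothesis polX : forall t, polish R (X t).
Variables (mu : Prob R (prodsp X)) (Phi : prodsp X -> ('I_N -> R))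
  (Psi : ('I_N -> R) -> prodsp X).
Hypothesis iso : unif_iso mu Phi Psi.

Lemma iso_measure_unique (m1 m2 : {measure set (borel (prodsp X)) -> \bar R}) :
  (m1 setT < +oo)%E ->
  (forall C : 'I_N -> set R, (forall s, measurable (C s)) ->
     m1 [set x | forall s, C s (Phi x s)] = m2 [set x | forall s, C s (Phi x s)]) ->
  forall A, Borel A -> m1 A = m2 A.
Proof.
have [PhiK PsiK mPhi mPsi law] := iso.
move=> m1T m12 A bA.
have mP : measurable_fun setT (Phi : borel (prodsp X) -> FM (@RR R N) N).
  exact: (measurableT_comp (mPhi N) (@measurable_Ft_id R N X polX N)).
have mA : measurable (A : set (FM (XB X) N)) by apply/Borel_FM.
pose A' : set (FM (@RR R N) N) := [set w | A (Psi w)].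
have mA' : measurable A' by exact: (measurable_preim (mPsi N) mA).
have AE : A = [set x | A' (Phi x)] by apply/seteqP; split => x /=; rewrite /A'/= PhiK.
suff : imagem m1 mP A' = imagem m2 mP A' by rewrite /imagem -AE.
apply: FM_measure_unique mA' => // C mC.
have E : [set x | cyl (X := @RR R N) N C (Phi x)] = [set x | forall s, C s (Phi x s)].
  by apply/seteqP; split => x h s; [apply: h|move=> _; exact: h].
have := m12 C mC; rewrite -E; exact.
Qed.

(** Resampling of the future: the past of x is kept and the innovations from t on come from x'. For
    independent x and x' of law [mu] the result again has law [mu]. *)
Definition oplus (t : nat) (x x' : prodsp X) : prodsp X :=
  Psi (fun s => if (s < t)%N then Phi x s else Phi x' s).

Lemma oplusN x x' : oplus N x x' = x.
Proof.
have [PhiK PsiK mPhi mPsi law] := iso.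
rewrite -[RHS]PhiK /oplus; congr Psi; apply/funext => s; by rewrite ltn_ord.
Qed.

Lemma Phi_oplus t x x' s : Phi (oplus t x x') s = if (s < t)%N then Phi x s else Phi x' s.
Proof. by have [PhiK PsiK mPhi mPsi law] := iso; rewrite /oplus PsiK. Qed.

Lemma oplus_Ft t (U : set (prodsp X)) x x' : measurable (U : set (FM (XB X) t)) ->
  U (oplus t x x') <-> U x.
Proof.
have [PhiK PsiK mPhi mPsi law] := iso.
move=> mU; have mU' : measurable ([set w | U (Psi w)] : set (FM (@RR R N) t)).
  exact: (measurable_preim (mPsi t) mU).
have ag (s : 'I_N) : (s < t)%N -> (fun s : 'I_N => if (s < t)%N then Phi x s else Phi x' s) s = Phi x s.
  by move=> ->.
split => h.
  by have := FM_dep mU' ag h; rewrite /mkset PhiK.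
rewrite /oplus; apply: (@FM_dep _ _ (@RR R N) t [set w | U (Psi w)] (Phi x)) => //.
  by move=> s st; rewrite ag.
by rewrite /mkset PhiK.
Qed.

Lemma measurable_oplus t : measurable_fun setT
  (fun p : FM (XB X) t * borel (prodsp X) => oplus t p.1 p.2 : borel (prodsp X)).
Proof.
have [PhiK PsiK mPhi mPsi law] := iso.
pose w (p : FM (XB X) t * borel (prodsp X)) : FM (@RR R N) N :=
  fun s : 'I_N => if (s < t)%N then Phi p.1 s else Phi p.2 s.
have mw : measurable_fun setT w.
  apply: measurable_FM => s _; rewrite /w; case: ltnP => st.
    have m1 := measurable_coord (X := @RR R N) st.
    have m2 := measurableT_comp m1 (mPhi t).
    exact: (measurableT_comp m2 measurable_fst).
  exact: (measurableT_comp (@measurable_Phi_coord R N X polX mu Phi Psi iso s) measurable_snd).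
have m1 := measurableT_comp (mPsi N) mw.
exact: (measurableT_comp (@measurable_of_FM R N X polX) m1).
Qed.

Lemma oplus_law t (A : set (prodsp X)) : Borel A ->
  prodp mu mu [set p | A (oplus t p.1 p.2)] = mu A.
Proof.
have [PhiK PsiK mPhi mPsi law] := iso.
have mo : measurable_fun setT (fun p : borel (prodsp X) * borel (prodsp X) =>
    oplus t p.1 p.2 : borel (prodsp X)).
  have m : measurable_fun setT (fun p : borel (prodsp X) * borel (prodsp X) =>
      (p.1 : FM (XB X) t, p.2)).
    apply: measurable_fun_pair => //.
    exact: (measurableT_comp (@measurable_Ft_id R N X polX t) measurable_fst).
  exact: (measurableT_comp (@measurable_oplus t) m).
move=> bA; suff : imagep (prodp mu mu) mo A = mu A by [].
apply: iso_measure_unique bA.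
  exact: (le_lt_trans (probability_le1 (imagep (prodp mu mu) mo) measurableT) (ltry 1)).
move=> C mC.
pose D (s : 'I_N) := if (s < t)%N then C s else setT.
have mD s : measurable (D s) by rewrite /D; case: ifP.
pose D' (s : 'I_N) := if (s < t)%N then setT else C s.
have mD' s : measurable (D' s) by rewrite /D'; case: ifP.
have mcy E : (forall s, measurable (E s)) -> Borel [set x | forall s, E s (Phi x s)].
  move=> mE; have := Borel_tail polX iso 0 mE; congr Borel.
  by apply/seteqP; split => x h s; [apply: h|move=> _; exact: h].
transitivity (prodp mu mu ([set x | forall s, D s (Phi x s)] `*` [set x | forall s, D' s (Phi x s)])).
  change (prodp mu mu [set p | forall s, C s (Phi (oplus t p.1 p.2) s)] =
    prodp mu mu ([set x | forall s, D s (Phi x s)] `*` [set x | forall s, D' s (Phi x s)])).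
  congr (prodp mu mu _); apply/seteqP; split => -[x x'] /=.
    move=> h; split => s; have := h s; rewrite Phi_oplus /D /D'; by case: ifP.
  move=> [h h'] s; have := h s; have := h' s; rewrite Phi_oplus /D /D'; by case: ifP.
rewrite prodpX; [|exact: mcy|exact: mcy].
rewrite [X in (X * _)%E](law _ mD) [X in (_ * X)%E](law _ mD') [RHS](law _ mC) -EFinM.
congr EFin; rewrite -big_split/=; apply: eq_bigr => s _; rewrite /D /D'.
by case: ifP => _; rewrite probability_setT/= ?mulr1 ?mul1r.
Qed.

End IsoUnique.

Section CausalKernel.
Context (R : realType) (N : nat) (X Y : 'I_N -> ptopologicalType).
Hypotheses (polX : forall t, polish R (X t)) (polY : forall t, polish R (Y t)).
Variables (mu : Prob R (prodsp X)) (Phi : prodsp X -> ('I_N -> R))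
  (Psi : ('I_N -> R) -> prodsp X).
Hypothesis iso : unif_iso mu Phi Psi.
Variables (nu : Prob R (prodsp Y)) (PhiY : prodsp Y -> ('I_N -> R))
  (PsiY : ('I_N -> R) -> prodsp Y).
Hypothesis isoY : unif_iso nu PhiY PsiY.
Variable pi : Prob R (pairsp (prodsp X) (prodsp Y)).
Hypothesis pi1 : forall U, Borel U -> pi (U `*` setT) = mu U.
Hypothesis ICpi : IC Phi pi.

Let XX := borel (prodsp X).
Let YY := borel (prodsp Y).

Lemma rect_disintegration : exists H : XX * R -> YY, measurable_fun setT H /\
  forall W, Borel W -> pi W = prodp mu rho [set p : XX * R | W (p.1, H p)].
Proof.
have cX := prodsp_cbase polX; have cY := prodsp_cbase polY.
have [code [decode [mc md cK c01 _]]] := polish_code (prodsp_polish polY).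
pose pi' := imagep pi (measurable_to_pair cX cY).
have pi'1 U : measurable U -> pi' (U `*` setT) = mu U by exact: pi1.
have [H [mH HE]] := disintegration pi'1 mc md cK c01.
by exists H; split => // W bW; apply: HE; apply/(Borel_pair cX cY).
Qed.

Section Kernels.
Variable H : XX * R -> YY.
Hypothesis mH : measurable_fun setT H.
Hypothesis HE : forall W, Borel W -> pi W = prodp mu rho [set p : XX * R | W (p.1, H p)].

(** A random draw of y: [p.1] supplies fresh innovations from t on, [p.2] the randomness of [H]. Its
    law is [kern t x]. *)
Let hk (t : nat) (x : XX) (p : XX * R) : YY := H (oplus Phi Psi t x p.1, p.2).

Lemma measurable_hk t : measurable_fun setT (fun z : FM (XB X) t * (XX * R) => hk t z.1 z.2).
Proof.
have m1 : measurable_fun setT (fun z : FM (XB X) t * (XX * R) => (z.1, z.2.1)).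
  apply: measurable_fun_pair => //.
  exact: (measurableT_comp measurable_fst measurable_snd).
have m2 := measurableT_comp (@measurable_oplus R N X polX mu Phi Psi iso t) m1.
have m3 : measurable_fun setT (fun z : FM (XB X) t * (XX * R) =>
    (oplus Phi Psi t z.1 z.2.1 : XX, z.2.2)).
  apply: measurable_fun_pair => //.
  exact: (measurableT_comp measurable_snd measurable_snd).
exact: (measurableT_comp mH m3).
Qed.

Lemma measurable_hk_section t x : measurable_fun setT (hk t x).
Proof.
exact: (measurableT_comp (@measurable_hk t) (pair1_measurable (x : FM (XB X) t))).
Qed.

(* The innovations after time [t] are averaged out, so that [kern t] is a conditional law
   of [y] given the first [t] coordinates of [x], as far as events of [F_t] are concerned. *)
Definition kern t (x : prodsp X) : Prob R (prodsp Y) :=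
  imagep (prodp mu rho) (@measurable_hk_section t x).

Lemma measurable_kern t (S : set (FM (XB X) t * YY)) : measurable S ->
  measurable_fun setT (fun x : FM (XB X) t => kern t x [set y | S (x, y)]).
Proof.
move=> mS.
have m : measurable_fun setT (fun z : FM (XB X) t * (XX * R) => (z.1, hk t z.1 z.2)).
  by apply: measurable_fun_pair => //; exact: measurable_hk.
exact: (measurable_section (prodp mu rho) (measurable_preim m mS)).
Qed.

Lemma measurable_kern1 t (B : set (prodsp Y)) : Borel B ->
  measurable_fun setT (fun x : FM (XB X) t => kern t x B).
Proof.
move=> bB; have mB : measurable (setT `*` B : set (FM (XB X) t * YY)) by exact: measurableX.
have := measurable_kern mB; rewrite (_ : (fun x => _) = (fun x => kern t x B))//.
apply/funext => x; congr (kern t x _).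
by apply/seteqP; split => y /= => [[]//|]; split.
Qed.

Lemma kern_integral (A : set (prodsp X)) t B : Borel A -> Borel B ->
  (\int[mu]_(x in A) kern t x B)%E =
  prodp mu (prodp mu rho) [set z : XX * (XX * R) | A z.1 /\ B (hk t z.1 z.2)].
Proof.
move=> bA bB; rewrite prodpE integral_mkcond; apply: eq_integral => x _.
rewrite patchE; case: ifPn => [|].
  rewrite inE => Ax.
  change (prodp mu rho [set p : XX * R | B (hk t x p)] =
    prodp mu rho [set p : XX * R | A x /\ B (hk t x p)]).
  by congr (prodp mu rho _); apply/seteqP; split => p /= => [|[]//]; split.
rewrite notin_setE => nA; rewrite (_ : [set y | _] = set0) ?measure0//.
by apply/seteqP; split => // p [].
Qed.

Lemma kernN x B : Borel B -> kern N x B = rho [set u | B (H (x, u))].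
Proof.
move=> bB.
have mB : measurable [set u | B (H (x, u))].
  exact: (measurable_preim (measurableT_comp mH (pair1_measurable (x : XX))) bB).
transitivity (prodp mu rho (setT `*` [set u | B (H (x, u))])).
  change (prodp mu rho [set p : XX * R | B (hk N x p)] =
    prodp mu rho (setT `*` [set u | B (H (x, u))])).
  congr (prodp mu rho _); apply/seteqP; split => p /=; rewrite /hk (oplusN iso).
    by split.
  by case.
rewrite prodpX// -[RHS]mul1e; congr (_ * _)%E; exact: probability_setT.
Qed.

Lemma kernN_disint S : Borel S -> pi S = (\int[mu]_x kern N x [set y | S (x, y)])%E.
Proof.
move=> bS; rewrite HE// prodpE; apply: eq_integral => x _; rewrite kernN//.
have mS : measurable (S : set (XX * YY)).
  by apply/Borel_pair => //; [exact: prodsp_cbase polX|exact: prodsp_cbase polY].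
exact: (measurable_preim (pair1_measurable (x : XX)) mS).
Qed.

(** It suffices to take for A a past event intersected with a condition on later innovations. The
    past event is handled by resampling; the condition factors out on the left since [kern t] is
    adapted, and on the right by the innovation condition. *)
Lemma kern_Ft (t : nat) (A : set (prodsp X)) B : (t <= N)%N -> Borel A ->
  measurable (B : set (FM (XB Y) t)) ->
  (\int[mu]_(x in A) kern t x B)%E = pi (A `*` B).
Proof.
have [PhiK PsiK mPhi mPsi law] := iso.
move=> tN bA mB; have bB := Borel_Ft polY mB.
have mD : measurable [set z : XX * (XX * R) | B (hk t z.1 z.2)].
  have m : measurable_fun setT (fun z : XX * (XX * R) => (z.1 : FM (XB X) t, z.2)).
    apply: measurable_fun_pair => //.
    exact: (measurableT_comp (@measurable_Ft_id R N X polX t) measurable_fst).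
  exact: (measurable_preim (measurableT_comp (@measurable_hk t) m) bB).
have mpi : measurable_fun setT ((fun z => z.1) : borel (pairsp (prodsp X) (prodsp Y)) -> XX).
  exact: (measurableT_comp measurable_fst
    (measurable_to_pair (prodsp_cbase polX) (prodsp_cbase polY))).
have bTB : measurable (setT `*` B : set (borel (pairsp (prodsp X) (prodsp Y)))).
  by apply: (BorelX polX polY) => //; exact: (@measurableT _ XX).
pose m1 := imagem (mrestr (prodp mu (prodp mu rho)) mD)
  (measurable_fst (T1 := XX) (T2 := (XX * R)%type)).
pose m2 := imagem (mrestr pi bTB) mpi.
have m1E U : Borel U -> m1 U = (\int[mu]_(x in U) kern t x B)%E.
  by move=> bU; rewrite kern_integral//; congr (prodp mu (prodp mu rho) _).
have m2E U : m2 U = pi (U `*` B).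
  change (pi ([set z | U z.1] `&` (setT `*` B)) = pi (U `*` B)).
  by congr (pi _); apply/seteqP; split => z; [move=> [? [? ?]]|move=> [? ?]]; split.
rewrite -m1E// -m2E; apply: (iso_measure_unique polX iso) bA.
  have h : (m1 setT <= 1)%E.
    change (prodp mu (prodp mu rho) ([set z : XX * (XX * R) | True] `&`
      [set z : XX * (XX * R) | B (hk t z.1 z.2)]) <= 1)%E.
    by apply: probability_le1; apply: measurableI => //; exact: measurableT.
  exact: (le_lt_trans h (ltry 1)).
move=> C mC.
pose U : set (prodsp X) := [set x | forall s : 'I_N, (s < t)%N -> C s (Phi x s)].
have mU : measurable (U : set (FM (XB X) t)).
  have mc : measurable (cyl t C : set (FM (@RR R N) t)) by exact: measurable_cyl.
  exact: (measurable_preim (mPhi t) mc).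
have bU := Borel_Ft polX mU.
have ZE : [set x | forall s, C s (Phi x s)] = U `&` tail Phi t C.
  apply/seteqP; split => x /=; first by move=> h; split => s _; exact: h.
  by move=> [h1 h2] s; case: (ltnP s t) => st; [exact: h1|exact: h2].
have bZ : Borel [set x | forall s, C s (Phi x s)].
  rewrite ZE; apply: (@measurableI _ XX) => //; exact: (Borel_tail polX iso).
apply: (etrans (m1E _ bZ)); apply: (etrans _ (esym (m2E _))).
(* Resampling from t on leaves the past event [U] unchanged and preserves [mu], so the average over
   fresh innovations collapses to a single integral. *)
have kU : (\int[mu]_(x in U) kern t x B)%E = pi (U `*` B).
  rewrite kern_integral//.
  pose G : set (XX * R) := [set p | U p.1 /\ B (H p)].
  have mG : measurable G.
    rewrite (_ : G = [set p | U p.1] `&` [set p | B (H p)])//; apply: measurableI.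
      have mf1 : measurable_fun setT (fun p : XX * R => p.1) by exact: measurable_fst.
      exact: (measurable_preim mf1 bU).
    exact: (measurable_preim mH bB).
  have -> : pi (U `*` B) = prodp mu rho G.
    by rewrite HE//; exact: BorelX.
  pose phi (z : XX) := rho [set u | G (z, u)].
  have mphi : measurable_fun setT phi by exact: measurable_section.
  have phi0 z : (0 <= phi z)%E by exact: measure_ge0.
  have mo : measurable_fun setT (fun p : XX * XX => oplus Phi Psi t p.1 p.2 : XX).
    have m : measurable_fun setT (fun p : XX * XX => (p.1 : FM (XB X) t, p.2)).
      apply: measurable_fun_pair => //.
      exact: (measurableT_comp (@measurable_Ft_id R N X polX t) measurable_fst).
    exact: (measurableT_comp (@measurable_oplus R N X polX mu Phi Psi iso t) m).
  transitivity (\int[mu]_x \int[mu]_x' phi (oplus Phi Psi t x x'))%E.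
    rewrite prodpE; apply: eq_integral => x _; rewrite prodpE.
    apply: eq_integral => x' _; rewrite /phi; congr (rho_ _).
    apply/seteqP; split => u /= -[h1 h2]; split => //; exact/(oplus_Ft iso x x' mU).
  transitivity (\int[prodp mu mu]_p phi (oplus Phi Psi t p.1 p.2))%E.
    have m := measurableT_comp mphi mo.
    exact: (esym (@fubini_tonelli1 _ _ XX XX R mu mu _ m (fun p => phi0 _))).
  transitivity (\int[imagem (prodp mu mu) mo]_z phi z)%E.
    by rewrite ge0_integral_imagem.
  rewrite prodpE; apply: eq_measure_integral => W mW _.
  exact: (oplus_law polX iso t mW).
(* [IC] speaks of t < N; at t = N no innovation is left and [U] is already the whole event. *)
have [tN'|tN'] := ltnP t N; last first.
  have te : t = N by apply/eqP; rewrite eqn_leq tN tN'.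
  have UE : U = [set x | forall s, C s (Phi x s)].
    rewrite ZE setIidl// => x Ux s; rewrite te leqNgt ltn_ord//.
  by rewrite -UE.
rewrite ZE (ICpi (t := Ordinal tN'))//= -kU.
have mg : measurable_fun setT (fun x : FM (XB X) t => ((\1_U x)%:E * kern t x B)%E).
  apply: emeasurable_funM; first by apply/measurable_EFinP; exact: measurable_indic.
  exact: measurable_kern1.
have g0 (x : FM (XB X) t) : (0 <= (\1_U x)%:E * kern t x B)%E.
  by rewrite mule_ge0// lee_fin.
have patch D : (\int[mu]_(x in U `&` D) kern t x B)%E =
    (\int[mu]_(x in D) ((\1_U x)%:E * kern t x B))%E.
  rewrite integral_mkcond [RHS]integral_mkcond; apply: eq_integral => x _.
  rewrite !patchE in_setI indicE; case: (x \in U) => /=; last by rewrite mul0e; case: ifP.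
  by rewrite mul1e.
rewrite patch (tail_indep_integral polX iso mg g0 mC); congr (_ * _)%E.
by rewrite -patch setIT.
Qed.

Let rc t (q : {ffun 'I_N -> rat}) : set (prodsp Y) :=
  [set y | cyl (X := @RR R N) t (fun s => `]-oo, (ratr (q s) : R)[%classic) (PhiY y)].

Let measurable_rc t q : measurable (rc t q : set (FM (XB Y) t)).
Proof.
have [_ _ mPhiY _ _] := isoY.
have mc : measurable (cyl t (fun s => `]-oo, (ratr (q s) : R)[%classic) : set (FM (@RR R N) t)).
  by apply: measurable_cyl => s; exact: measurable_itv.
exact: (measurable_preim (mPhiY t) mc).
Qed.

(** Testing countably many sets keeps this event measurable, for F_{t+1} because [kern t.+1] enters.
    By [FM_RR_unique] these sets decide equality on all of F_t. *)
Definition agree t : set (prodsp X) :=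
  [set x | forall q, kern t x (rc t q) = kern t.+1 x (rc t q)].

Lemma agreeP t x B : agree t x -> measurable (B : set (FM (XB Y) t)) ->
  kern t x B = kern t.+1 x B.
Proof.
have [PhiK PsiK mPhi mPsi _] := isoY.
move=> ag mB.
have mP : measurable_fun setT (PhiY : YY -> FM (@RR R N) t).
  exact: (measurableT_comp (mPhi t) (@measurable_Ft_id R N Y polY t)).
pose B' : set (FM (@RR R N) t) := [set w | B (PsiY w)].
have mB' : measurable B' by exact: (measurable_preim (mPsi t) mB).
have BE : B = [set y | B' (PhiY y)] by apply/seteqP; split => y /=; rewrite /B'/= PhiK.
pose m1 := imagep (kern t x) mP; pose m2 := imagep (kern t.+1 x) mP.
have H12 : m1 B' = m2 B'.
  apply: FM_RR_unique mB'; last by move=> q; exact: (ag q).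
  exact: (le_lt_trans (probability_le1 m1 measurableT) (ltry 1)).
by rewrite BE; exact: H12.
Qed.

Lemma measurable_agree t : measurable (agree t : set (FM (XB X) t.+1)).
Proof.
rewrite (_ : agree t = \bigcap_(n : nat)
  [set x | fine (kern t x (rc t (odflt [ffun=> 0] (unpickle n)))) =
           fine (kern t.+1 x (rc t (odflt [ffun=> 0] (unpickle n))))]); last first.
  apply/seteqP; split => x; first by move=> ag n _; rewrite /mkset ag.
  move=> h q; have := h (pickle q) I; rewrite /mkset pickleK /odflt /oapp => e.
  have bq : Borel (rc t q) by exact: (Borel_Ft polY (@measurable_rc t q)).
  have E1 := fineK (prob_fin (kern t x) bq); have E2 := fineK (prob_fin (kern t.+1 x) bq).
  exact: (etrans (esym E1) (etrans (congr1 EFin e) E2)).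
apply: bigcapT_measurable => n; set q := odflt _ _.
have bq : Borel (rc t q) by exact: (Borel_Ft polY (@measurable_rc t q)).
have m1 : measurable_fun setT (fun x : FM (XB X) t.+1 => kern t x (rc t q)).
  exact: (measurableT_comp (measurable_kern1 (t := t) bq) (measurable_FM_id (leqnSn t))).
have m2 : measurable_fun setT (fun x : FM (XB X) t.+1 => kern t.+1 x (rc t q)).
  exact: measurable_kern1.
apply: measurable_eqset.
- exact: (measurable_diag_inj (c := @id R)).
- exact: (measurableT_comp (fine_measurable measurableT) m1).
- exact: (measurableT_comp (fine_measurable measurableT) m2).
Qed.

(** By [kern_Ft] both kernels have the same integral over every event E, namely the mass that [pi]
    gives to E times the test set. *)
Lemma agree_ae : {ae mu, forall x, forall t : nat, (t < N)%N -> agree t x}.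
Proof.
apply: ae_foralln => t; have [tN|tN] := boolP (t < N)%N; last by apply: aeW.
have : {ae mu, forall x, forall n : nat,
    kern t x (rc t (odflt [ffun=> 0] (unpickle n))) =
    kern t.+1 x (rc t (odflt [ffun=> 0] (unpickle n)))}.
  apply: ae_foralln => n; set q := odflt _ _.
  have bq : Borel (rc t q) by exact: (Borel_Ft polY (@measurable_rc t q)).
  have mk s : measurable_fun setT (fun x : XX => kern s x (rc t q)).
    have H' := measurableT_comp (measurable_kern1 (t := s) bq) (@measurable_Ft_id R N X polX s).
    exact: H'.
  have : ae_eq mu setT (fun x : XX => kern t x (rc t q)) (fun x : XX => kern t.+1 x (rc t q)).
    apply: integral_ae_eq; [exact: measurableT| |exact: mk|].
    - apply: (le_integrable measurableT (mk t) (g := EFin \o cst 1)).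
        move=> x _; rewrite gee0_abs; last exact: measure_ge0.
        apply: (le_trans (probability_le1 (kern t x) bq)); by rewrite /= normr1.
      exact: finite_measure_integrable_cst.
    - move=> E _ mE; apply: (etrans (kern_Ft (ltnW tN) mE (@measurable_rc t q))).
      have mr : measurable (rc t q : set (FM (XB Y) t.+1)).
        have H' := measurable_FM_le (leqnSn t) (@measurable_rc t q); exact: H'.
      exact: (esym (kern_Ft tN mE mr)).
  by apply: filterS => x /(_ I).
apply: (filterS (F := almost_everywhere mu)) => x h _ q; have := h (pickle q); by rewrite pickleK.
Qed.

(* [kern t] and [kern t.+1] agree on [F_t] for almost every [x] only; truncating [y] at the
   first time of disagreement gives a kernel that is adapted at every [x]. *)
Let tau (x : prodsp X) : nat := find (fun s => x \notin agree s) (iota 0 N).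

Let tau_le x : (tau x <= N)%N.
Proof. by rewrite /tau -[X in (_ <= X)%N](size_iota 0 N) find_size. Qed.

Let tau_agree x s : (s < tau x)%N -> agree s x.
Proof.
move=> st; have sN := leq_trans st (tau_le x).
have := before_find 0%N st; rewrite (nth_iota _ _ sN) add0n => /negbFE/set_mem; exact.
Qed.

Let tau_nagree x : (tau x < N)%N -> ~ agree (tau x) x.
Proof.
move=> tN; have := @nth_find _ 0%N (fun s => x \notin agree s) (iota 0 N).
rewrite has_find size_iota -/(tau x) => /(_ tN); rewrite (nth_iota _ _ tN) add0n => /negP h.
by move=> /mem_set.
Qed.

Let pre s : set (prodsp X) := [set x | forall r, (r < s)%N -> agree r x].

Let measurable_pre s t : (s <= t)%N -> measurable (pre s : set (FM (XB X) t)).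
Proof.
move=> st.
rewrite (_ : pre s = \bigcap_(r in [set r | (r < s)%N]) (agree r)); last first.
  by apply/seteqP; split => x.
apply: bigcap_measurableType => r /= rs.
have H' := measurable_FM_le (leq_trans rs st) (@measurable_agree r); exact: H'.
Qed.

Let tau_ltE s : (s < N)%N -> [set x | tau x = s] = pre s `\` agree s.
Proof.
move=> sN; apply/seteqP; split => x /=.
  move=> e; split; first by move=> r; rewrite -e; exact: tau_agree.
  by rewrite -[X in agree X]e; apply: tau_nagree; rewrite e.
move=> [px nx]; case: (ltngtP (tau x) s) => // h.
  by have := tau_nagree (ltn_trans h sN); have := px _ h.
by have := tau_agree h.
Qed.

Let tau_N : [set x | tau x = N] = pre N.
Proof.
apply/seteqP; split => x /=; first by move=> <- r; exact: tau_agree.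
move=> px; apply/eqP; rewrite eqn_leq tau_le leqNgt; apply/negP => h.
by have := tau_nagree h; have := px _ h.
Qed.

Let measurable_tau s t : (s < N)%N -> (s < t)%N ->
  measurable ([set x | tau x = s] : set (FM (XB X) t)).
Proof.
move=> sN st; rewrite tau_ltE//; apply: measurableD; first exact: (measurable_pre (ltnW st)).
have H' := measurable_FM_le st (@measurable_agree s); exact: H'.
Qed.

Let Borel_tau s : Borel [set x | tau x = s].
Proof.
have [sN|sN|->] := ltngtP s N.
- exact: (Borel_Ft polX (measurable_tau sN sN)).
- rewrite (_ : mkset _ = set0); first exact: (@measurable0 _ XX).
  apply/seteqP; split => // x /= e; by move: (tau_le x); rewrite e leqNgt sN.
- by rewrite tau_N; exact: (Borel_Ft polX (measurable_pre (leqnn N))).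
Qed.

(** Truncation makes the coordinates from s on deterministic, so they need no information about x,
    and it does not affect events of F_t with t <= s. *)
Let trunc s (y : prodsp Y) : prodsp Y := fun r => if (r < s)%N then y r else point.

Let measurable_trunc s : measurable_fun setT (trunc s : YY -> YY).
Proof.
have m : measurable_fun setT (trunc s : YY -> FM (XB Y) N).
  apply: measurable_FM => r _; case: (boolP (r < s)%N) => rs; last first.
    rewrite (_ : (fun z : YY => trunc s z r) = cst point); first exact: measurable_cst.
    by apply/funext => y; rewrite /trunc (negbTE rs).
  rewrite (_ : (fun z : YY => trunc s z r) = (fun z : YY => z r)); last first.
    by apply/funext => y; rewrite /trunc rs.
  have mr := measurable_coord (X := XB Y) (ltn_ord r).
  exact: (measurableT_comp mr (@measurable_to_FM R N Y polY)).
exact: (measurableT_comp (@measurable_of_FM R N Y polY) m).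
Qed.

Let truncN y : trunc N y = y.
Proof. by apply/functional_extensionality_dep => r; rewrite /trunc ltn_ord. Qed.

Let trunc_Ft s t (B : set (prodsp Y)) y : (t <= s)%N -> measurable (B : set (FM (XB Y) t)) ->
  B (trunc s y) <-> B y.
Proof.
move=> ts mB; have e (r : 'I_N) : (r < t)%N -> trunc s y r = y r.
  by move=> rt; rewrite /trunc (leq_trans rt ts).
split; first exact: (FM_dep mB e).
by apply: (FM_dep mB) => r rt; rewrite e.
Qed.

Let kern' x : Prob R (prodsp Y) := imagep (kern (tau x) x) (@measurable_trunc (tau x)).

Let measurable_kern' (S : set (XX * YY)) : measurable S ->
  measurable_fun setT (fun x : XX => kern' x [set y | S (x, y)]).
Proof.
move=> mS _ C mC; rewrite setTI.
rewrite (_ : _ @^-1` _ = \bigcup_s ([set x | tau x = s] `&`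
    [set x | C (kern s x [set y | S (x, trunc s y)])])); last first.
  apply/seteqP; split => x /=; first by move=> Cx; exists (tau x).
  by move=> [s _ [/= <-]].
apply: bigcup_measurable => s _; apply: measurableI; first exact: Borel_tau.
have m : measurable_fun setT (fun z : XX * (XX * R) => (z.1, trunc s (hk s z.1 z.2) : YY)).
  apply: measurable_fun_pair => //.
  have m1 : measurable_fun setT (fun z : XX * (XX * R) => (z.1 : FM (XB X) s, z.2)).
    apply: measurable_fun_pair => //.
    exact: (measurableT_comp (@measurable_Ft_id R N X polX s) measurable_fst).
  have m2 := measurableT_comp (@measurable_hk s) m1.
  exact: (measurableT_comp (@measurable_trunc s) m2).
have m3 := measurable_section (prodp mu rho) (measurable_preim m mS).
exact: (measurable_preim m3 mC).
Qed.

Lemma causal_kern : causal mu (fun S => pi S).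
Proof.
exists kern'; split.
- move=> B bB C mC.
  have mB : measurable (setT `*` B : set (XX * YY)) by exact: measurableX.
  have := measurable_preim (measurable_kern' mB) mC.
  rewrite (_ : [set x | C (kern' x [set y | (setT `*` B) (x, y)])] = (fun x => kern' x B) @^-1` C)//.
  apply/seteqP; split => x /=.
    by rewrite (_ : [set y | _] = B)//; apply/seteqP; split => y // [].
  by rewrite (_ : [set y | setT x /\ B y] = B)//; apply/seteqP; split => y // [].
- move=> S bS; transitivity (\int[mu]_x kern N x [set y | S (x, y)])%E; first exact: kernN_disint.
  have mS : measurable (S : set (XX * YY)).
    by apply/Borel_pair => //; [exact: prodsp_cbase polX|exact: prodsp_cbase polY].
  apply: ge0_ae_eq_integral => //.
  + have m : measurable_fun setT (fun z : XX * (XX * R) => (z.1, hk N z.1 z.2)).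
      apply: measurable_fun_pair => //.
      have m1 : measurable_fun setT (fun z : XX * (XX * R) => (z.1 : FM (XB X) N, z.2)).
        apply: measurable_fun_pair => //.
        exact: (measurableT_comp (@measurable_Ft_id R N X polX N) measurable_fst).
      exact: (measurableT_comp (@measurable_hk N) m1).
    exact: (measurable_section (prodp mu rho) (measurable_preim m mS)).
  + exact: measurable_kern'.
  + have := agree_ae; apply: (filterS (F := almost_everywhere mu)) => x ag _.
    have tx : tau x = N by have : pre N x by []; rewrite -tau_N.
    rewrite /kern' imagepE tx; congr (kern N x _).
    by apply/seteqP; split => y /=; rewrite truncN.
- move=> t B mB C mC.
  (* On events of F_t the kernels from time t up to the first disagreement all coincide, so the
     stopped kernel can be replaced by [kern t]. *)
  have chain x s : (t <= s)%N -> (forall r, (r < s)%N -> agree r x) -> kern t x B = kern s x B.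
    move=> /subnKC <-; elim: (s - t)%N => [|n IH] ag; first by rewrite addn0.
    rewrite addnS IH; last by move=> r rn; apply: ag; rewrite addnS ltnS ltnW.
    apply: agreeP; first by apply: ag; rewrite addnS.
    have H' := measurable_FM_le (leq_addr n t) (mB : measurable (B : set (FM (XB Y) t))).
    exact: H'.
  suff : measurable ([set x | C (kern' x B)] : set (FM (XB X) t)) by [].
  (* Either there is no disagreement before t, and [kern t] decides the event, or the first
     disagreement is at some s < t. The latter is an event of F_{s+1}, hence known at time t, and
     the truncated [kern s] is already adapted. *)
  rewrite (_ : mkset _ = (pre t `&` [set x | C (kern t x B)]) `|`
     \bigcup_(s in [set s | (s < t)%N]) ([set x | tau x = s] `&`
        [set x | C (kern s x [set y | B (trunc s y)])])).
    have bB := Borel_Ft polY mB.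
    apply: measurableU.
      apply: measurableI; first exact: measurable_pre.
      exact: (measurable_preim (measurable_kern1 (t := t) bB) mC).
    apply: bigcup_measurable => s /= st; apply: measurableI.
      by apply: measurable_tau => //; exact: (ltn_trans st).
    have bB' : Borel [set y | B (trunc s y)] by exact: (measurable_preim (@measurable_trunc s) bB).
    apply: (measurable_FM_le (ltnW st)).
    exact: (measurable_preim (measurable_kern1 (t := s) bB') mC).
  have kE x : (t <= tau x)%N -> kern' x B = kern t x B.
    move=> tt; rewrite (chain x (tau x) tt (fun r => @tau_agree x r)).
    rewrite /kern' imagepE; congr (kern _ x _).
    by apply/seteqP; split => y /=; move/(trunc_Ft y tt mB).
  apply/seteqP; split => x /=.
    have [tt|tt] := leqP t (tau x).
      rewrite (kE _ tt) => Cx; left; split; last exact: Cx.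
      move=> r rt; apply: tau_agree.
      exact: leq_trans rt tt.
    by move=> Cx; right; exists (tau x).
  case=> [[px Cx]|[s st [/= <-]]//].
  rewrite kE//; rewrite leqNgt; apply/negP => h.
  by have := tau_nagree (ltn_trans h (ltn_ord t)); have := px _ h.
Qed.

End Kernels.

Lemma IC_causal : causal mu (fun S => pi S).
Proof.
by have [H [mH HE]] := rect_disintegration; exact: (causal_kern mH HE).
Qed.

End CausalKernel.

(** * Biadapted maps with prescribed cell masses *)

Lemma incr_cover (R : realType) (F : nat -> R) n (u : R) : F 0%N <= u -> u < F n ->
  exists2 j, (j < n)%N & F j <= u /\ u < F j.+1.
Proof.
move=> F0; elim: n => [|n IH] un; first by move: (le_lt_trans F0 un); rewrite ltxx.
by have [/IH[j jn h]|Fn] := ltP u (F n); [exists j => //; exact: ltnW|exists n].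
Qed.

Lemma incr_uniq (R : realType) (F : nat -> R) (u : R) j k : {homo F : x y / (x <= y)%N >-> x <= y} ->
  F j <= u < F j.+1 -> F k <= u < F k.+1 -> j = k.
Proof.
move=> hF /andP[j1 j2] /andP[k1 k2]; case: (ltngtP j k) => // h.
  by have := lt_le_trans j2 (le_trans (hF _ _ h) k1); rewrite ltxx.
by have := lt_le_trans k2 (le_trans (hF _ _ h) j1); rewrite ltxx.
Qed.

Lemma measure_bigcup_fin d (T : measurableType d) (R : realType)
  (mu : {measure set T -> \bar R}) (I : finType) (F : I -> set T) :
  (forall k, measurable (F k)) -> (forall x k l, F k x -> F l x -> k = l) ->
  mu (\bigcup_(k in [set: I]) F k) = (\sum_k mu (F k))%E.
Proof.
move=> mF dF; rewrite measure_fin_bigcup//; last 2 first.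
- exact: finite_finset.
- by move=> k l _ _ [x [? ?]]; exact: (dF x).
transitivity (\sum_(k <- enum I) mu (F k))%E; last by rewrite big_enum.
rewrite [RHS]fsbig_seq ?enum_uniq//.
rewrite (_ : [set` enum I] = setT)//; apply/seteqP; split => k // _.
by rewrite /= mem_enum.
Qed.

Lemma measure_split_fin d (T : measurableType d) (R : realType)
  (mu : {measure set T -> \bar R}) (I : finType) (h : T -> I) (A : set T) :
  (forall k, measurable (A `&` [set x | h x = k])) ->
  mu A = (\sum_k mu (A `&` [set x | h x = k]))%E.
Proof.
move=> mh; rewrite -measure_bigcup_fin//; last by move=> x k l [_ /= <-] [_ /= <-].
congr (mu _); apply/seteqP; split => x; first by move=> Ax; exists (h x).
by move=> [k _ []].
Qed.

(** * Interval exchanges with prescribed cell masses *)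

Section IntervalExchange.
Context (R : realType) (I : finType).

Definition piece (a p : I -> R) k : set R := `[a k, a k + p k[%classic.

Definition unit_partition (a p : I -> R) :=
  [/\ forall k, 0 <= a k /\ a k + p k <= 1,
      forall u, 0 <= u < 1 -> exists k, piece a p k u &
      forall u k l, piece a p k u -> piece a p l u -> k = l].

(** Piece k is translated from [a k] to [b k]. Fixing the points outside [0, 1) yields a bijection
    of the whole line. *)
Definition exchange (a b p : I -> R) (u : R) : R :=
  if [pick k | u \in piece a p k] is Some k then u - a k + b k else u.

Variables (a b p : I -> R).
Hypotheses (pa : unit_partition a p) (pb : unit_partition b p).

Lemma exchange_in k u : piece a p k u -> exchange a b p u = u - a k + b k.
Proof.
case: pa => _ _ un uk; rewrite /exchange; case: pickP => [l /set_mem ul|/(_ k)].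
  by rewrite (un _ _ _ uk ul).
by rewrite mem_set.
Qed.

Lemma exchange_piece k u : piece a p k u -> piece b p k (exchange a b p u).
Proof. by move=> uk; rewrite (exchange_in uk); move: uk; rewrite /piece/= !in_itv/=; lra. Qed.

Lemma exchange_out u : ~~ (0 <= u < 1) -> exchange a b p u = u.
Proof.
case: pa => h _ _ nu; rewrite /exchange; case: pickP => // k /set_mem.
by have [a0 a1] := h k; rewrite /piece/= in_itv/= => ua; exfalso; move/negP: nu; apply; lra.
Qed.

Lemma piece01 k u : piece a p k u -> 0 <= u < 1.
Proof. by case: pa => h _ _; have [a0 a1] := h k; rewrite /piece/= in_itv/=; lra. Qed.

Lemma measurable_exchange : measurable_fun setT (exchange a b p).
Proof.
have E k u : u - a k + b k = 1 * u + (b k - a k) by ring.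
move=> _ B mB; rewrite setTI.
rewrite (_ : _ @^-1` _ =
  \bigcup_(k in [set: I]) (piece a p k `&` [set u | B (1 * u + (b k - a k))]) `|`
  (~` `[0, 1[%classic `&` B)).
  apply: measurableU; last by apply: measurableI => //; apply: measurableC; exact: measurable_itv.
  apply: fin_bigcup_measurable; first exact: finite_finset.
  move=> k _; apply: measurableI; first exact: measurable_itv.
  have m : measurable_fun setT (fun u : R => 1 * u + (b k - a k)).
    by apply: measurable_funD => //; exact: measurable_funM.
  exact: (measurable_preim m mB).
apply/seteqP; split => u /=.
  have [u01|u01] := boolP (0 <= u < 1).
    case: pa => _ /(_ u u01)[k uk] _; rewrite (exchange_in uk) E => Bu.
    by left; exists k.
  rewrite exchange_out// => Bu; right; split => //.
  by rewrite /= in_itv/=; apply/negP.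
case=> [[k _ [uk]]|[]]; first by rewrite (exchange_in uk) E.
by rewrite /= in_itv/= => /negP u01; rewrite exchange_out.
Qed.

End IntervalExchange.

Section ExchangeLaw.
Context (R : realType) (I : finType) (a b p : I -> R).
Hypotheses (pa : unit_partition a p) (pb : unit_partition b p).

Lemma exchangeK : cancel (exchange a b p) (exchange b a p).
Proof.
move=> u; have [u01|u01] := boolP (0 <= u < 1); last first.
  by rewrite (exchange_out b pa)// (exchange_out a pb).
have [_ /(_ u u01)[k uk] _] := pa.
rewrite (exchange_in a pb (exchange_piece b pa uk)) (exchange_in b pa uk); ring.
Qed.

Lemma rho_pieces (c : I -> R) (B : set R) : unit_partition c p -> measurable B ->
  rho B = (\sum_k lebesgue_measure (piece c p k `&` B))%E.
Proof.
move=> pc mB; have [h cov un] := pc; rewrite rhoE.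
rewrite -measure_bigcup_fin//; last 2 first.
- by move=> k; apply: measurableI => //; exact: measurable_itv.
- by move=> x k l [xk _] [xl _]; exact: (un x).
congr (lebesgue_measure _); apply/seteqP; split => u /=; rewrite ?in_itv/=.
  by move=> [Bu /cov[k uk]]; exists k.
move=> [k _ [uk Bu]]; split => //; exact: (piece01 pc uk).
Qed.

Lemma exchange_law (B : set R) : measurable B -> rho [set u | B (exchange a b p u)] = rho B.
Proof.
move=> mB.
have mB' : measurable [set u | B (exchange a b p u)] by exact: (measurable_preim (measurable_exchange b pa) mB).
rewrite (rho_pieces pa mB') (rho_pieces pb mB); apply: eq_bigr => k _.
rewrite -(@lebesgue_affine _ 1 (b k - a k) (piece b p k `&` B)) ?mul1e//; last first.
  by apply: measurableI => //; exact: measurable_itv.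
congr (lebesgue_measure _); apply/seteqP; split => u /=.
  move=> [uk]; have := exchange_piece b pa uk; rewrite (exchange_in b pa uk).
  by rewrite (_ : u - a k + b k = 1 * u + (b k - a k)); [split|ring].
move=> [uk Bu]; have uk' : piece a p k u by move: uk; rewrite /piece/= !in_itv/=; lra.
split => //; rewrite (exchange_in b pa uk').
by rewrite (_ : u - a k + b k = 1 * u + (b k - a k)); [|ring].
Qed.

End ExchangeLaw.

Section Cells.
Context (R : realType) (m : nat).
Let M : R := m.+1%:R.

Definition idx (u : R) : 'I_m.+1 :=
  odflt ord0 [pick i : 'I_m.+1 | (i%:R / M <= u) && (u < i.+1%:R / M)].

Let cellF (n : nat) : R := n%:R / M.

Let cellF_homo : {homo cellF : x y / (x <= y)%N >-> x <= y}.
Proof. by move=> x y xy; rewrite ler_pM2r ?invr_gt0 ?ltr0n// ler_nat. Qed.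

Lemma idxP u (i : 'I_m.+1) : i%:R / M <= u < i.+1%:R / M -> idx u = i.
Proof.
move=> ui; rewrite /idx; case: pickP => [j uj /=|/(_ i)]; last by rewrite ui.
by apply: val_inj; exact: (incr_uniq cellF_homo uj ui).
Qed.

Lemma idx_in u : 0 <= u < 1 -> (idx u)%:R / M <= u < (idx u).+1%:R / M.
Proof.
move=> /andP[u0 u1]; have [||j jm [h1 h2]] := @incr_cover R cellF m.+1 u.
- by rewrite /cellF mul0r.
- by rewrite /cellF divff// pnatr_eq0.
have h : (Ordinal jm)%:R / M <= u < (Ordinal jm).+1%:R / M by apply/andP.
by rewrite (idxP h).
Qed.

Lemma measurable_idx i : measurable [set u | idx u = i].
Proof.
have mi (j : 'I_m.+1) : measurable [set` `[(j%:R / M : R), j.+1%:R / M[] by exact: measurable_itv.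
(* By the default value of [idx], cell 0 also collects the points outside [0, 1), so it is described
   as the complement of the other cells. *)
have [->|i0] := eqVneq i ord0.
  rewrite (_ : mkset _ = ~` \bigcup_(j in [set j : 'I_m.+1 | j != ord0])
      [set` `[(j%:R / M : R), j.+1%:R / M[]).
    by apply: measurableC; apply: fin_bigcup_measurable => //; exact: finite_finset.
  apply/seteqP; split => u /=.
    move=> u0 [j /= j0]; rewrite in_itv/= => /idxP uj; by rewrite -uj u0 eqxx in j0.
  move=> h; rewrite /idx; case: pickP => [j uj|//] /=.
  apply/eqP; apply: contrapT => /negP j0; apply: h; exists j => //; by rewrite /= in_itv.
rewrite (_ : mkset _ = [set` `[(i%:R / M : R), i.+1%:R / M[])//.
apply/seteqP; split => u /=; rewrite in_itv/=; last exact: idxP.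
rewrite /idx; case: pickP => [j uj /= <-//|_ /= e].
by rewrite -e eqxx in i0.
Qed.

Lemma rho_idx i : rho [set u | idx u = i] = M^-1%:E.
Proof.
rewrite rhoE (_ : _ `&` _ = [set` `[(i%:R / M : R), i.+1%:R / M[]).
  rewrite lebesgue_measure_itv/= lte_fin ltr_pM2r ?invr_gt0 ?ltr0n// ltr_nat ltnSn -EFinD.
  congr EFin; rewrite -mulrBl -natr1; ring.
apply/seteqP; split => u /=; rewrite !in_itv/=.
  by move=> [<- /idx_in].
move=> /[dup] h /idxP ->; split => //; move: h => /andP[h1 h2]; apply/andP; split.
  by apply: le_trans h1; rewrite divr_ge0.
by apply: lt_le_trans h2 _; rewrite ler_pdivrMr ?ltr0n// mul1r ler_nat.
Qed.

Section Rows.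
Variable p : nat -> nat -> R.
Hypotheses (p0 : forall i j, 0 <= p i j)
  (prow : forall i, (i < m.+1)%N -> \sum_(0 <= j < m.+1) p i j = M^-1).

(** Cell i is cut from left to right into intervals of widths p i 0, p i 1, and so on; the row sum
    makes them fill it exactly. *)
Let start (i j : nat) : R := i%:R / M + \sum_(0 <= l < j) p i l.

Let start_homo i : {homo start i : x y / (x <= y)%N >-> x <= y}.
Proof.
move=> x y xy; rewrite lerD2l [leRHS](@big_cat_nat _ _ _ x)//= lerDl.
by apply: sumr_ge0.
Qed.

Let startM i : (i < m.+1)%N -> start i m.+1 = i.+1%:R / M.
Proof. by move=> im; rewrite /start prow// -natr1; ring. Qed.

Definition row_start (k : 'I_m.+1 * 'I_m.+1) : R := start k.1 k.2.
Definition row_width (k : 'I_m.+1 * 'I_m.+1) : R := p k.1 k.2.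

Let row_endE k : row_start k + row_width k = start k.1 k.2.+1.
Proof. by rewrite /row_start /row_width /start big_nat_recr//= addrA. Qed.

Lemma row_piece_cell k u : piece row_start row_width k u -> k.1%:R / M <= u < k.1.+1%:R / M.
Proof.
rewrite /piece/= in_itv/= row_endE => /andP[h1 h2]; apply/andP; split.
  by apply: le_trans h1; rewrite lerDl sumr_ge0.
by apply: (lt_le_trans h2); rewrite -startM//; apply: start_homo.
Qed.

Lemma row_partition : unit_partition row_start row_width.
Proof.
split.
- move=> k; split; first by rewrite addr_ge0 ?divr_ge0 ?sumr_ge0.
  rewrite row_endE; apply: (@le_trans _ _ (start k.1 m.+1)); first exact: start_homo.
  by rewrite startM// ler_pdivrMr ?ltr0n// mul1r ler_nat.
- move=> u u01; have /andP[h1 h2] := idx_in u01; set i := idx u in h1 h2.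
  have [||j jm [j1 j2]] := @incr_cover R (start i) m.+1 u.
  + by rewrite /start big_geq// addr0.
  + by rewrite startM.
  by exists (i, Ordinal jm); rewrite /piece/= in_itv/= row_endE/= j1.
- move=> u k l uk ul; have e : k.1 = l.1.
    by rewrite -(idxP (row_piece_cell uk)) (idxP (row_piece_cell ul)).
  move: uk ul; rewrite /piece/= !in_itv/= !row_endE /row_start -e => uk ul.
  have e2 : k.2 = l.2 by apply: val_inj; exact: (incr_uniq (@start_homo k.1) uk ul).
  by rewrite (surjective_pairing k) e e2 -surjective_pairing.
Qed.

End Rows.

(** Cell i of the source is cut along row i, cell j of the target along column j, that is, along row
    j of the transpose. Piece (i, j) has the same width in both, so it can be translated. The row
    and column sums are what makes both families partitions. *)
Lemma interval_exchange (p : 'I_m.+1 -> 'I_m.+1 -> R) : (forall i j, 0 <= p i j) ->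
  (forall i, \sum_j p i j = M^-1) -> (forall j, \sum_i p i j = M^-1) ->
  exists s s' : R -> R, [/\ measurable_fun setT s, measurable_fun setT s',
    cancel s s', cancel s' s & forall B, measurable B -> rho [set u | B (s u)] = rho B] /\
    forall i j, rho [set u | idx u = i /\ idx (s u) = j] = (p i j)%:E.
Proof.
move=> p0 pr pc.
pose q (i j : nat) := p (inord i) (inord j); pose q' i j := q j i.
have rq i : (i < m.+1)%N -> \sum_(0 <= j < m.+1) q i j = M^-1.
  by move=> im; rewrite big_mkord -(pr (inord i)); apply: eq_bigr => j _; rewrite /q inord_val.
have rq' i : (i < m.+1)%N -> \sum_(0 <= j < m.+1) q' i j = M^-1.
  by move=> im; rewrite big_mkord -(pc (inord i)); apply: eq_bigr => j _; rewrite /q' /q inord_val.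
pose sw (k : 'I_m.+1 * 'I_m.+1) := (k.2, k.1).
pose w := row_width q; pose a := row_start q; pose b k := row_start q' (sw k).
have pa : unit_partition a w by apply: row_partition => // i j; exact: p0.
have pb' : unit_partition (row_start q') (row_width q').
  by apply: row_partition => // i j; exact: p0.
have wE k : w k = row_width q' (sw k) by [].
have pb : unit_partition b w.
  have [h1 h2 h3] := pb'; split.
  - by move=> k; exact: (h1 (sw k)).
  - by move=> u /h2[k uk]; exists (sw k); move: uk; rewrite /piece/= /b wE; case: k.
  - by move=> u k l uk ul; have := h3 u (sw k) (sw l) uk ul; case: k {uk}; case: l {ul} => ? ? ? ? [-> ->].
exists (exchange a b w), (exchange b a w); split; first split.
- exact: measurable_exchange.
- exact: measurable_exchange.
- exact: exchangeK.
- exact: exchangeK.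
- by move=> B; exact: exchange_law.
move=> i j; rewrite rhoE (_ : _ `&` _ = piece a w (i, j)).
  rewrite /piece lebesgue_measure_itv/= lte_fin ltrDl.
  case: ifPn => [_|]; first by rewrite -EFinD /w /row_width /q/= !inord_val; congr EFin; ring.
  rewrite -leNgt => h; congr EFin; apply/esym/eqP; rewrite eq_le p0 andbT.
  by move: h; rewrite /w /row_width /q/= !inord_val.
have q0 i' j' : 0 <= q i' j' by exact: p0.
have q0' i' j' : 0 <= q' i' j' by exact: p0.
have ci k u : piece a w k u -> idx u = k.1.
  by move=> h; apply: idxP; exact: (row_piece_cell q0 rq h).
have cj k u : piece a w k u -> idx (exchange a b w u) = k.2.
  move=> h; apply: idxP; exact: (row_piece_cell q0' rq' (exchange_piece b pa h)).
apply/seteqP; split => u /=; last first.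
  move=> h; split; first by split; [exact: (ci _ _ h)|exact: (cj _ _ h)].
  by rewrite in_itv/=; exact: (piece01 pa h).
rewrite in_itv/= => -[[ui uj] u01]; have [_ /(_ u u01)[k uk] _] := pa.
by rewrite -ui -uj (ci _ _ uk) (cj _ _ uk) -surjective_pairing.
Qed.

End Cells.

(** * The biadapted bijection built from exchanges *)

Section Model.
Context (R : realType) (N : nat) (X Y : 'I_N -> ptopologicalType).
Hypotheses (polX : forall t, polish R (X t)) (polY : forall t, polish R (Y t)).
Variables (mu : Prob R (prodsp X)) (Phi : prodsp X -> ('I_N -> R))
  (Psi : ('I_N -> R) -> prodsp X).
Hypothesis iso : unif_iso mu Phi Psi.
Variables (nu : Prob R (prodsp Y)) (PhiY : prodsp Y -> ('I_N -> R))
  (PsiY : ('I_N -> R) -> prodsp Y).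
Hypothesis isoY : unif_iso nu PhiY PsiY.
Variable m : nat.

Let I := 'I_m.+1.
Let path := {ffun 'I_N -> I * I}.

(** Padding from t on puts the histories of all times into one finite type while they depend on the
    first t coordinates only. *)
Definition cell_path t (v w : 'I_N -> R) : path :=
  [ffun s : 'I_N => if (s < t)%N then (idx m (v s), idx m (w s)) else (ord0, ord0)].

Definition cellX t (c : path) : set (prodsp X) :=
  [set x | forall s : 'I_N, (s < t)%N -> idx m (Phi x s) = (c s).1].
Definition cellY t (c : path) : set (prodsp Y) :=
  [set y | forall s : 'I_N, (s < t)%N -> idx m (PhiY y s) = (c s).2].

Lemma measurable_cellX t c : measurable (cellX t c : set (FM (XB X) t)).
Proof.
have [_ _ mPhi _ _] := iso.
have mc : measurable (cyl t (fun s => [set u | idx m u = (c s).1]) : set (FM (@RR R N) t)).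
  by apply: measurable_cyl => s; exact: measurable_idx.
exact: (measurable_preim (mPhi t) mc).
Qed.

Lemma measurable_cellY t c : measurable (cellY t c : set (FM (XB Y) t)).
Proof.
have [_ _ mPhi _ _] := isoY.
have mc : measurable (cyl t (fun s => [set u | idx m u = (c s).2]) : set (FM (@RR R N) t)).
  by apply: measurable_cyl => s; exact: measurable_idx.
exact: (measurable_preim (mPhi t) mc).
Qed.

Section AdaptedMap.
Variables (sg sg' : 'I_N -> path -> R -> R).
Hypothesis msg : forall t c, measurable_fun setT (sg t c).
Hypothesis msg' : forall t c, measurable_fun setT (sg' t c).
Hypothesis sgK : forall t c, cancel (sg t c) (sg' t c).
Hypothesis sgK' : forall t c, cancel (sg' t c) (sg t c).
Hypothesis sg_rho : forall t c B, measurable B -> rho [set u | B (sg t c u)] = rho B.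

Lemma cell_path_dep t v w v' w' : (forall s : 'I_N, (s < t)%N -> v s = v' s) ->
  (forall s : 'I_N, (s < t)%N -> w s = w' s) -> cell_path t v w = cell_path t v' w'.
Proof.
move=> hv hw; apply/ffunP => s; rewrite !ffunE; case: ifP => // st.
by rewrite hv ?hw.
Qed.

Lemma measurable_cell_path d (Z : measurableType d) t (f g : Z -> 'I_N -> R) c :
  (forall s : 'I_N, (s < t)%N -> measurable_fun setT (fun z => f z s)) ->
  (forall s : 'I_N, (s < t)%N -> measurable_fun setT (fun z => g z s)) ->
  measurable [set z | cell_path t (f z) (g z) = c].
Proof.
move=> mf mg.
rewrite (_ : mkset _ = \bigcap_(s in [set: 'I_N])
  [set z | (if (s < t)%N then (idx m (f z s), idx m (g z s)) else (ord0, ord0)) = c s]); last first.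
  apply/seteqP; split => z /=; first by move=> <- s _; rewrite /= ffunE.
  by move=> h; apply/ffunP => s; rewrite ffunE; exact: h.
apply: fin_bigcap_measurable; first exact: finite_finset.
move=> s _; case: (boolP (s < t)%N) => st; last first.
  by case: (pselect ((ord0, ord0) = c s)) => e; [rewrite (_ : mkset _ = setT)|rewrite (_ : mkset _ = set0)] => //;
    apply/seteqP; split.
rewrite (_ : mkset _ = [set z | idx m (f z s) = (c s).1] `&` [set z | idx m (g z s) = (c s).2]).
  apply: measurableI.
    exact: (measurable_preim (mf s st) (@measurable_idx R m (c s).1)).
  exact: (measurable_preim (mg s st) (@measurable_idx R m (c s).2)).
apply/seteqP; split => z /=; first by move=> <-.
by move=> [-> ->]; rewrite -surjective_pairing.
Qed.

(** The exchange at time t is chosen from the past cells of input and output together. Both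
    directions know this history, so the inverse solves a triangular system with the same history
    and the inverse exchanges. *)
Lemma adapted_map : exists S S' : ('I_N -> R) -> ('I_N -> R),
  [/\ cancel S S', cancel S' S,
     forall t, measurable_fun [set: FM (@RR R N) t] (S : FM (@RR R N) t -> FM (@RR R N) t),
     forall t, measurable_fun [set: FM (@RR R N) t] (S' : FM (@RR R N) t -> FM (@RR R N) t) &
     forall v t, S v t = sg t (cell_path t v (S v)) (v t)].
Proof.
pose g (t : 'I_N) (v w : 'I_N -> R) := sg t (cell_path t v w) (v t).
pose g' (t : 'I_N) (w v : 'I_N -> R) := sg' t (cell_path t v w) (w t).
have mgen (h : 'I_N -> path -> R -> R) (mh : forall t c, measurable_fun setT (h t c)) (t : 'I_N)
    (d : measure_display) (Z : measurableType d) (f1 f2 : Z -> 'I_N -> R) (f : Z -> R) :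
    (forall s : 'I_N, (s < t)%N -> measurable_fun setT (fun z => f1 z s)) ->
    (forall s : 'I_N, (s < t)%N -> measurable_fun setT (fun z => f2 z s)) ->
    measurable_fun setT f ->
    measurable_fun setT (fun z => h t (cell_path t (f1 z) (f2 z)) (f z)).
  move=> m1 m2 mf _ B mB; rewrite setTI.
  rewrite (_ : _ @^-1` _ = \bigcup_(c in [set: path]) ([set z | cell_path t (f1 z) (f2 z) = c] `&`
      [set z | B (h t c (f z))])).
    apply: fin_bigcup_measurable; first exact: finite_finset.
    move=> c _; apply: measurableI; first exact: measurable_cell_path.
    exact: (measurable_preim (measurableT_comp (mh t c) mf) mB).
  apply/seteqP; split => z /=; first by move=> Bz; exists (cell_path t (f1 z) (f2 z)).
  by move=> [c _ [/= <-]].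
have co1 (t s : 'I_N) (st : (s < t.+1)%N) :
    measurable_fun setT (fun p : FM (@RR R N) t.+1 * FM (@RR R N) t => (p.1 : 'I_N -> R) s).
  exact: (measurableT_comp (measurable_coord (X := @RR R N) st) measurable_fst).
have co2 (t s : 'I_N) (st : (s < t)%N) :
    measurable_fun setT (fun p : FM (@RR R N) t.+1 * FM (@RR R N) t => (p.2 : 'I_N -> R) s).
  exact: (measurableT_comp (measurable_coord (X := @RR R N) st) measurable_snd).
have mg (t : 'I_N) : measurable_fun setT (fun p : FM (@RR R N) t.+1 * FM (@RR R N) t => g t p.1 p.2).
  apply: (mgen sg msg t _ (FM (@RR R N) t.+1 * FM (@RR R N) t)%type fst snd (fun p => (p.1 : 'I_N -> R) t)).
  - by move=> s st; apply: co1; exact: ltnW.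
  - by move=> s st; exact: co2.
  - exact: co1.
have mg' (t : 'I_N) : measurable_fun setT (fun p : FM (@RR R N) t.+1 * FM (@RR R N) t => g' t p.1 p.2).
  apply: (mgen sg' msg' t _ (FM (@RR R N) t.+1 * FM (@RR R N) t)%type snd fst (fun p => (p.1 : 'I_N -> R) t)).
  - by move=> s st; exact: co2.
  - by move=> s st; apply: co1; exact: ltnW.
  - exact: co1.
have dg (t : 'I_N) v w w' : (forall s : 'I_N, (s < t)%N -> w s = w' s) -> g t v w = g t v w'.
  by move=> h; rewrite /g (@cell_path_dep t v w v w').
have dg' (t : 'I_N) v w w' : (forall s : 'I_N, (s < t)%N -> w s = w' s) -> g' t v w = g' t v w'.
  by move=> h; rewrite /g' (@cell_path_dep t w v w' v).
have [S [SE mS]] := triangular_map (X := @RR R N) (Y := @RR R N) mg dg.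
have [S' [SE' mS']] := triangular_map (X := @RR R N) (Y := @RR R N) mg' dg'.
exists S, S'; split => //.
- move=> v; apply: (triangular_uniq (X := @RR R N) (Y := @RR R N) dg' (x := S v)).
    by move=> t; exact: SE'.
  by move=> t; rewrite /g' SE /g sgK.
- move=> v; apply: (triangular_uniq (X := @RR R N) (Y := @RR R N) dg (x := S' v)).
    by move=> t; exact: SE.
  by move=> t; rewrite /g SE' /g' sgK'.
Qed.

Variables (S S' : ('I_N -> R) -> ('I_N -> R)).
Hypothesis mS : forall t, measurable_fun [set: FM (@RR R N) t] (S : FM (@RR R N) t -> FM (@RR R N) t).
Hypothesis SE : forall v t, S v t = sg t (cell_path t v (S v)) (v t).

Let xpath t (x : prodsp X) := cell_path t (Phi x) (S (Phi x)).

Lemma measurable_S_coord (s : 'I_N) t : (s < t)%N ->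
  measurable_fun setT (fun x : FM (XB X) t => S (Phi x) s).
Proof.
have [_ _ mPhi _ _] := iso; move=> st.
have m1 := measurable_coord (X := @RR R N) st.
have m2 := measurableT_comp m1 (@mS t).
exact: (measurableT_comp m2 (mPhi t)).
Qed.

Lemma measurable_xpath t c : measurable ([set x | xpath t x = c] : set (FM (XB X) t)).
Proof.
have [_ _ mPhi _ _] := iso.
apply: (@measurable_cell_path _ (FM (XB X) t)) => s st; last exact: measurable_S_coord.
have m1 := measurable_coord (X := @RR R N) st.
exact: (measurableT_comp m1 (mPhi t)).
Qed.

Lemma tail_step (t : 'I_N) (A : set (prodsp X)) D :
  measurable (A : set (FM (XB X) t)) -> measurable D ->
  mu (A `&` [set x | D (Phi x t)]) = (rho D * mu A)%E.
Proof.
move=> mA mD; pose C (s : 'I_N) := if s == t then D else setT.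
have mC s : measurable (C s) by rewrite /C; case: ifP.
have := tail_indep polX iso mA mC.
rewrite (_ : tail Phi t C = [set x | D (Phi x t)]); last first.
  apply/seteqP; split => x /=; first by move=> /(_ t (leqnn t)); rewrite /C eqxx.
  by move=> h s _; rewrite /C; case: eqP => // ->.
rewrite (_ : (wt t C)%:E = rho D)//.
rewrite /wt (bigD1 t)//= big1; last first.
  by move=> s /andP[_ st]; rewrite /C (negbTE st) probability_setT.
by rewrite mulr1 /C eqxx fineK// prob_fin.
Qed.

(** Given the history, the innovation at time t is uniform and each exchange preserves [rho]. The
    output at t is therefore uniform whatever the history, so independence survives the dependence
    of the exchange on the past. *)
Lemma S_law C : (forall t, measurable (C t)) ->
  mu [set x | forall t, C t (S (Phi x) t)] = (\prod_t fine (rho (C t)))%:E.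
Proof.
move=> mC.
pose V t : set (prodsp X) := [set x | forall s : 'I_N, (s < t)%N -> C s (S (Phi x) s)].
have mV t : measurable (V t : set (FM (XB X) t)).
  rewrite (_ : V t = \bigcap_(s in [set s : 'I_N | (s < t)%N]) [set x | C s (S (Phi x) s)]); last first.
    by apply/seteqP; split => x.
  apply: (@fin_bigcap_measurable _ (FM (XB X) t)); first exact: finite_finset.
  move=> s st; exact: (measurable_preim (measurable_S_coord st) (mC s)).
suff H t : (t <= N)%N -> mu (V t) = (\prod_(s < N | (s < t)%N) fine (rho (C s)))%:E.
  rewrite (_ : mkset _ = V N); last by apply/seteqP; split => x h s //; exact: h.
  by rewrite H//; congr EFin; apply: eq_bigl => s; rewrite ltn_ord.
elim: t => [_|t IH tN].
  rewrite big_pred0//; transitivity (mu setT); last exact: probability_setT.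
  by congr (mu _); apply/seteqP; split.
pose o := Ordinal tN.
have mVp c : measurable (V t `&` [set x | xpath t x = c] : set (FM (XB X) t)).
  by apply: measurableI => //; exact: measurable_xpath.
have e : V t.+1 = V t `&` [set x | C o (S (Phi x) o)].
  apply/seteqP; split => x /=.
    by move=> h; split; [move=> s st; apply: h; exact: ltnW|exact: (h o)].
  move=> [h h'] s; rewrite ltnS leq_eqVlt => /orP[/eqP st|]; last exact: h.
  by have -> : s = o by exact: val_inj.
have eo c : (V t `&` [set x | C o (S (Phi x) o)]) `&` [set x | xpath t x = c] =
    (V t `&` [set x | xpath t x = c]) `&` [set x | C o (sg o c (Phi x o))].
  apply/seteqP; split => x /=; rewrite SE.
    by move=> [[h1 h2] h3]; move: h2; rewrite -/(xpath o x) [xpath o x]h3.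
  by move=> [[h1 h2] h3]; rewrite -/(xpath o x) [xpath o x]h2.
have mo c : measurable [set u | C o (sg o c u)] by exact: (measurable_preim (@msg o c) (mC o)).
have ms c := @tail_step o _ _ (mVp c) (mo c).
have bV c := Borel_Ft polX (mVp c).
have bVo c : Borel ((V t `&` [set x | xpath t x = c]) `&` [set x | C o (sg o c (Phi x o))]).
  apply: (@measurableI _ (borel (prodsp X))); first exact: bV.
  exact: (measurable_preim (measurable_Phi_coord polX iso o) (mo c)).
rewrite e (@measure_split_fin _ (borel (prodsp X)) R mu _ (xpath t)); last first.
  by move=> c; rewrite eo; exact: bVo.
transitivity (\sum_c rho (C o) * mu (V t `&` [set x | xpath t x = c]))%E.
  by apply: eq_bigr => c _; rewrite eo; apply: (etrans (ms c)); rewrite sg_rho.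
rewrite -ge0_sume_distrr// -(@measure_split_fin _ (borel (prodsp X)) R mu _ (xpath t))//.
transitivity (rho (C o) * (\prod_(s < N | (s < t)%N) fine (rho (C s)))%:E)%E.
  by congr (_ * _)%E; exact: (IH (ltnW tN)).
rewrite -[X in (X * _)%E]fineK ?prob_fin// -EFinM; congr EFin.
rewrite [RHS](bigD1 o)//=; congr (_ * _); apply: eq_bigl => s.
by rewrite ltnS (leq_eqVlt s) -(inj_eq val_inj)/=; case: (ltngtP s t).
Qed.

(** The event up to time t says exactly that the history is the truncation of c, which fixes the
    exchange; the next innovation is independent of it. *)
Lemma S_cell (t : 'I_N) (c : path) :
  mu (cellX t.+1 c `&` [set x | forall s : 'I_N, (s < t.+1)%N -> idx m (S (Phi x) s) = (c s).2]) =
  (mu (cellX t c `&` [set x | forall s : 'I_N, (s < t)%N -> idx m (S (Phi x) s) = (c s).2]) *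
   rho [set u | idx m u = (c t).1 /\
      idx m (sg t [ffun s : 'I_N => if (s < t)%N then c s else (ord0, ord0)] u) = (c t).2])%E.
Proof.
set ct := [ffun s => _].
set A := (X in (mu X * _)%E); set D := (X in rho X).
have AE : A = [set x | xpath t x = ct].
  apply/seteqP; split => x.
    move=> [h1 h2]; apply/ffunP => s; rewrite !ffunE; case: ifP => // st.
    by rewrite h1// h2// -surjective_pairing.
  move=> h; split => s st; move/ffunP/(_ s): h; rewrite !ffunE st => <- //.
have mA : measurable (A : set (FM (XB X) t)) by rewrite AE; exact: measurable_xpath.
have mD : measurable D.
  apply: (@measurableI _ R [set u | idx m u = (c t).1]); first exact: measurable_idx.
  exact: (measurable_preim (@msg t ct) (@measurable_idx R m (c t).2)).
rewrite [RHS]muleC -(tail_step mA mD); congr (mu _).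
apply/seteqP; split => x.
  move=> [h1 h2]; have Ax : A x.
    by split => s st; [apply: h1|apply: h2]; exact: ltnW.
  split => //; split; first exact: h1.
  have := h2 t (ltnSn t); rewrite SE -/(xpath t x).
  by move: Ax; rewrite AE => ->.
move=> [Ax [d1 d2]]; have [a1 a2] := Ax; split => s.
  rewrite ltnS leq_eqVlt => /orP[/eqP st|]; last exact: a1.
  by have -> : s = t by exact: val_inj.
rewrite ltnS leq_eqVlt => /orP[/eqP st|]; last exact: a2.
have -> : s = t by exact: val_inj.
rewrite SE -/(xpath t x).
by move: Ax; rewrite AE => ->.
Qed.

End AdaptedMap.

Variable pi : Prob R (pairsp (prodsp X) (prodsp Y)).
Hypothesis ICX : IC Phi (fun S => pi S).
Hypothesis ICY : IC PhiY (fun S : set (pairsp (prodsp Y) (prodsp X)) => pi (swap_set S)).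

Let XX := borel (prodsp X).
Let YY := borel (prodsp Y).

Let ev (t : 'I_N) (c : path) (i j : I) : set (pairsp (prodsp X) (prodsp Y)) :=
  (cellX t c `&` [set x | idx m (Phi x t) = i]) `*` (cellY t c `&` [set y | idx m (PhiY y t) = j]).

Let bX (t : 'I_N) i : Borel [set x | idx m (Phi x t) = i].
Proof. exact: (measurable_preim (measurable_Phi_coord polX iso t) (@measurable_idx R m i)). Qed.
Let bY (t : 'I_N) i : Borel [set x | idx m (PhiY x t) = i].
Proof. exact: (measurable_preim (measurable_Phi_coord polY isoY t) (@measurable_idx R m i)). Qed.
Let bcX t c : Borel (cellX t c). Proof. exact: (Borel_Ft polX (@measurable_cellX t c)). Qed.
Let bcY t c : Borel (cellY t c). Proof. exact: (Borel_Ft polY (@measurable_cellY t c)). Qed.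

Let tail1 (t : 'I_N) (i : I) : exists C, [/\ forall s, measurable (C s),
  tail Phi t C = [set x | idx m (Phi x t) = i],
  tail PhiY t C = [set y | idx m (PhiY y t) = i] & wt t C = m.+1%:R^-1].
Proof.
pose C (s : 'I_N) := if s == t then [set u : R | idx m u = i] else setT.
exists C; split.
- by move=> s; rewrite /C; case: ifP => // _; exact: measurable_idx.
- apply/seteqP; split => x /=; first by move=> /(_ t (leqnn t)); rewrite /C eqxx.
  by move=> h s _; rewrite /C; case: eqP => // ->.
- apply/seteqP; split => x /=; first by move=> /(_ t (leqnn t)); rewrite /C eqxx.
  by move=> h s _; rewrite /C; case: eqP => // ->.
- rewrite /wt (bigD1 t)//= big1; last first.
    by move=> s /andP[_ st]; rewrite /C (negbTE st) probability_setT.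
  by rewrite mulr1 /C eqxx rho_idx.
Qed.

Let bev (t : 'I_N) (c : path) (i j : I) : Borel (ev t c i j).
Proof.
apply: (BorelX polX polY).
  exact: (@measurableI _ XX _ _ (@bcX t c) (@bX t i)).
exact: (@measurableI _ YY _ _ (@bcY t c) (@bY t j)).
Qed.

(** Summing over the cell of y leaves past events of x and y and a condition on the innovation of x
    at time t, to which [ICX] applies. *)
Let row_sum (t : 'I_N) c i : (\sum_j pi (ev t c i j) =
  (m.+1%:R^-1)%:E * pi (cellX t c `*` cellY t c))%E.
Proof.
have [C [mC CE _ wE]] := tail1 t i.
rewrite -wE -(ICX (@measurable_cellX t c) mC (@measurable_cellY t c)) CE.
rewrite [RHS](@measure_split_fin _ (borel (pairsp (prodsp X) (prodsp Y))) R pi _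
  (fun z => idx m (PhiY z.2 t))).
  apply: eq_bigr => j _; congr (pi _); apply/seteqP; split => z.
    by move=> [h1 [h2 h3]].
  by move=> [[h1 h2] h3].
move=> j; rewrite (_ : _ `&` _ = ev t c i j).
  exact: (@bev t c i j).
by apply/seteqP; split => z; [move=> [[h1 h2] h3]|move=> [h1 [h2 h3]]].
Qed.

Let col_sum (t : 'I_N) c j : (\sum_i pi (ev t c i j) =
  (m.+1%:R^-1)%:E * pi (cellX t c `*` cellY t c))%E.
Proof.
have [C [mC _ CE wE]] := tail1 t j.
have sw : cellX t c `*` cellY t c = swap_set (cellY t c `*` cellX t c).
  by apply/seteqP; split => z [? ?].
rewrite -wE sw -(ICY (@measurable_cellY t c) mC (@measurable_cellX t c)) CE.
rewrite [RHS](@measure_split_fin _ (borel (pairsp (prodsp X) (prodsp Y))) R pi _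
  (fun z => idx m (Phi z.1 t))).
  apply: eq_bigr => i _; congr (pi _); apply/seteqP; split => z.
    by move=> [[h1 h2] h3].
  by move=> [[h1 h2] h3].
move=> i; rewrite (_ : _ `&` _ = ev t c i j).
  exact: (@bev t c i j).
by apply/seteqP; split => z; [move=> [[h1 h2] h3]|move=> [[h1 h2] h3]].
Qed.

Let bE t c : Borel (cellX t c `*` cellY t c : set (pairsp (prodsp X) (prodsp Y))).
Proof. exact: (BorelX polX polY). Qed.

(* The conditional law of the pair of time-[t] cells given the past cells is realised by
   an interval exchange; its marginals are uniform by the two innovation conditions. *)
Let exchange_kernel (t : 'I_N) (c : path) : exists p : (R -> R) * (R -> R),
  [/\ measurable_fun setT p.1, measurable_fun setT p.2, cancel p.1 p.2, cancel p.2 p.1 &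
    forall B, measurable B -> rho [set u | B (p.1 u)] = rho B] /\
  forall i j, (pi (cellX t c `*` cellY t c) * rho [set u | idx m u = i /\ idx m (p.1 u) = j])%E =
    pi (ev t c i j).
Proof.
pose a := fine (pi (cellX t c `*` cellY t c)).
have aE : pi (cellX t c `*` cellY t c) = a%:E by rewrite fineK//; exact: (prob_fin pi (@bE t c)).
pose q i j := fine (pi (ev t c i j)).
have qE i j : pi (ev t c i j) = (q i j)%:E by rewrite fineK//; exact: (prob_fin pi (@bev t c i j)).
have M0 : (m.+1%:R : R) != 0 by rewrite pnatr_eq0.
(* A past of mass zero prescribes nothing, so the matrix with all entries 1/M^2 is used; otherwise
   the conditional matrix q / a has the right sums. *)
have [a0|a0] := eqVneq a 0.
  have [|i|j|s [s' [H1 H2]]] := @interval_exchange R m (fun _ _ => m.+1%:R^-1 * m.+1%:R^-1).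
  - by move=> i j; rewrite mulr_ge0.
  - by rewrite sumr_const card_ord -[LHS]mulr_natl mulrA divff// mul1r.
  - by rewrite sumr_const card_ord -[LHS]mulr_natl mulrA divff// mul1r.
  exists (s, s'); split => // i j; rewrite aE a0 mul0e; apply/esym/eqP; rewrite eq_le measure_ge0 andbT.
  have h : (pi (ev t c i j) <= pi (cellX t c `*` cellY t c))%E.
    by apply: (prob_le pi (@bev t c i j) (@bE t c)) => z [[h1 h2] [h3 h4]].
  by rewrite aE a0 in h.
have q0 i j : 0 <= q i j by exact: fine_ge0.
have qr i : \sum_j q i j = m.+1%:R^-1 * a.
  apply: EFin_inj; rewrite EFinM -aE -(row_sum t c i) -sumEFin.
  by apply: eq_bigr => j _.
have qc j : \sum_i q i j = m.+1%:R^-1 * a.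
  apply: EFin_inj; rewrite EFinM -aE -(col_sum t c j) -sumEFin.
  by apply: eq_bigr => i _.
have [|i|j|s [s' [H1 H2]]] := @interval_exchange R m (fun i j => q i j / a).
- by move=> i j; rewrite divr_ge0// fine_ge0.
- by rewrite -mulr_suml qr mulfK.
- by rewrite -mulr_suml qc mulfK.
by exists (s, s'); split => // i j; rewrite aE H2 -EFinM qE mulrCA divff// mulr1.
Qed.

(** [T] is [S] read through the two transforms. Its cell masses and those of [pi] obey the same
    recursion in time, with [S_cell] on one side and the choice of the exchanges on the other. *)
Lemma model_density : exists (T : prodsp X -> prodsp Y) (T' : prodsp Y -> prodsp X),
  [/\ cancel T T', cancel T' T,
    forall t, measurable_fun [set: FM (XB X) t] (T : FM (XB X) t -> FM (XB Y) t),
    forall t, measurable_fun [set: FM (XB Y) t] (T' : FM (XB Y) t -> FM (XB X) t) &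
    forall B, Borel B -> mu (T @^-1` B) = nu B] /\
  forall c, mu [set x | cellX N c x /\ cellY N c (T x)] = pi (cellX N c `*` cellY N c).
Proof.
have [PhiK PsiK mPhi mPsi law] := iso; have [PhiYK PsiYK mPhiY mPsiY lawY] := isoY.
have /choice[f fP] (tc : 'I_N * path) := exchange_kernel tc.1 tc.2.
pose sg t c := (f (t, c)).1; pose sg' t c := (f (t, c)).2.
have msg t c : measurable_fun setT (sg t c) by have [[]] := fP (t, c).
have msg' t c : measurable_fun setT (sg' t c) by have [[]] := fP (t, c).
have sgK t c : cancel (sg t c) (sg' t c) by have [[]] := fP (t, c).
have sgK' t c : cancel (sg' t c) (sg t c) by have [[]] := fP (t, c).
have sgr t c B : measurable B -> rho [set u | B (sg t c u)] = rho B.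
  by have [[_ _ _ _ h] _] := fP (t, c); exact: h.
have sgq (t : 'I_N) c i j : (pi (cellX t c `*` cellY t c) * rho [set u | idx m u = i /\ idx m (sg t c u) = j])%E =
    pi (ev t c i j) by have [_ h] := fP (t, c); exact: h.
have [S [S' [SK SK' mS mS' SE]]] := adapted_map msg msg' sgK sgK'.
pose T x := PsiY (S (Phi x)); pose T' y := Psi (S' (PhiY y)).
have mT t : measurable_fun [set: FM (XB X) t] (T : FM (XB X) t -> FM (XB Y) t).
  exact: (measurableT_comp (mPsiY t) (measurableT_comp (mS t) (mPhi t))).
have mT' t : measurable_fun [set: FM (XB Y) t] (T' : FM (XB Y) t -> FM (XB X) t).
  exact: (measurableT_comp (mPsi t) (measurableT_comp (mS' t) (mPhiY t))).
exists T, T'; split; first split => //.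
- by move=> x; rewrite /T' /T PsiYK SK PhiK.
- by move=> x; rewrite /T' /T PsiK SK' PhiYK.
- move=> B bB.
  have bT : measurable_fun setT (T : XX -> YY).
    have m1 := measurableT_comp (mT N) (@measurable_Ft_id R N X polX N).
    exact: (measurableT_comp (@measurable_of_FM R N Y polY) m1).
  suff : imagep mu bT B = nu B by [].
  apply: (iso_measure_unique polY isoY) bB.
    exact: (le_lt_trans (probability_le1 (imagep mu bT) measurableT) (ltry 1)).
  move=> C mC; apply: (etrans _ (esym (lawY C mC))).
  rewrite -(S_law msg sgr mS SE mC).
  change (mu [set x | forall s, C s (PhiY (T x) s)] = mu [set x | forall t, C t (S (Phi x) t)]).
  by congr (mu _); apply/seteqP; split => x h s; have := h s; rewrite /T PsiYK.
move=> c.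
pose W t := cellX t c `&` [set x | forall s : 'I_N, (s < t)%N -> idx m (S (Phi x) s) = (c s).2].
suff H t : (t <= N)%N -> mu (W t) = pi (cellX t c `*` cellY t c).
  rewrite -H//; congr (mu _); apply/seteqP; split => x [h1 h2]; split => // s sN.
    by have := h2 s sN; rewrite /T PsiYK.
  by rewrite /T PsiYK; exact: h2.
elim: t => [_|t IH tN].
  transitivity (mu setT); first by congr (mu _); apply/seteqP; split => // x _; split.
  apply: (etrans (probability_setT mu)); apply: (etrans (esym (probability_setT pi))).
  by congr (pi _); apply/seteqP; split => // z _; split.
pose o := Ordinal tN; pose ct : path := [ffun s : 'I_N => if (s < t)%N then c s else (ord0, ord0)].
have cXE : cellX t ct = cellX t c.
  by apply/seteqP; split => x h s st; have := h s st; rewrite ffunE st.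
have cYE : cellY t ct = cellY t c.
  by apply/seteqP; split => x h s st; have := h s st; rewrite ffunE st.
apply: (etrans (S_cell msg mS SE o c)).
transitivity (pi (cellX t ct `*` cellY t ct) *
   rho [set u | idx m u = (c o).1 /\ idx m (sg o ct u) = (c o).2])%E.
  by congr (_ * _)%E; rewrite cXE cYE; exact: (IH (ltnW tN)).
rewrite (sgq o ct) /ev [cellX o ct]cXE [cellY o ct]cYE; congr (pi _).
have ordS (s : 'I_N) : (s < t.+1)%N -> s = o \/ (s < t)%N.
  by rewrite ltnS leq_eqVlt => /orP[/eqP st|]; [left; exact: val_inj|right].
apply/seteqP; split => -[x y].
  move=> [[h1 h2] [h3 h4]]; split => s /ordS[->//|st]; [exact: h1|exact: h3].
move=> [h1 h2]; split; split.
- by move=> s st; apply: h1; exact: ltnW.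
- exact: (h1 o (ltnSn t)).
- by move=> s st; apply: h2; exact: ltnW.
- exact: (h2 o (ltnSn t)).
Qed.

End Model.

(** * Approximation by cells *)

Section CellApproximation.
Context (R : realType) (N : nat) (X : 'I_N -> ptopologicalType).
Hypothesis polX : forall t, polish R (X t).
Variables (mu : Prob R (prodsp X)) (Phi : prodsp X -> ('I_N -> R))
  (Psi : ('I_N -> R) -> prodsp X).
Hypothesis iso : unif_iso mu Phi Psi.

Definition cell_code m (x : prodsp X) : {ffun 'I_N -> 'I_m.+1} :=
  [ffun s => idx m (Phi x s)].

Definition symdiff (A B : set (prodsp X)) := (A `\` B) `|` (B `\` A).

Let XX := borel (prodsp X).

Lemma Borel_code m (G : set {ffun 'I_N -> 'I_m.+1}) : Borel [set x | G (cell_code m x)].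
Proof.
rewrite (_ : mkset _ = \bigcup_(c in G) \bigcap_(s in [set: 'I_N]) [set x | idx m (Phi x s) = c s]).
  apply: (@fin_bigcup_measurable _ XX); first exact: finite_finset.
  move=> c _; apply: (@fin_bigcap_measurable _ XX); first exact: finite_finset.
  move=> s _.
  exact: (measurable_preim (measurable_Phi_coord polX iso s) (@measurable_idx R m (c s))).
apply/seteqP; split => x /=.
  by move=> Gx; exists (cell_code m x) => // s _; rewrite /= ffunE.
move=> [c Gc h]; rewrite (_ : cell_code m x = c)//; apply/ffunP => s.
by rewrite ffunE; exact: h.
Qed.

(** Approximation is required for every large m: the partitions for different m are not nested in
    general, and a common m must serve several sets and both factors. *)
Definition cell_approx (D : set (prodsp X)) := Borel D /\ forall e : R, 0 < e ->
  exists m0, forall m, (m0 <= m)%N -> exists G : set {ffun 'I_N -> 'I_m.+1},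
    (mu (symdiff D [set x | G (cell_code m x)]) <= e%:E)%E.

Lemma Borel_symdiff (A B : set (prodsp X)) : Borel A -> Borel B -> Borel (symdiff A B).
Proof. by move=> mA mB; apply: (@measurableU _ XX); apply: (@measurableD _ XX). Qed.

Lemma cell_approxU D1 D2 : cell_approx D1 -> cell_approx D2 -> cell_approx (D1 `|` D2).
Proof.
move=> [b1 h1] [b2 h2]; split; first exact: (@measurableU _ XX).
move=> e e0; have e20 : 0 < e / 2 by lra.
have [m1 H1] := h1 _ e20; have [m2 H2] := h2 _ e20.
exists (maxn m1 m2) => m; rewrite geq_max => /andP[/H1[G1 g1] /H2[G2 g2]].
exists (G1 `|` G2).
have s1 := Borel_symdiff b1 (@Borel_code m G1); have s2 := Borel_symdiff b2 (@Borel_code m G2).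
have -> : e%:E = ((e / 2)%:E + (e / 2)%:E)%E by rewrite -EFinD; congr EFin; lra.
apply: (le_trans _ (leeD g1 g2)); apply: (le_trans _ (prob_U2 mu s1 s2)).
apply: (prob_le mu); [|exact: (@measurableU _ XX _ _ s1 s2)|].
  apply: Borel_symdiff; last exact: Borel_code.
  exact: (@measurableU _ XX).
move=> x [[[Dx|Dx] /= /not_orP[n1 n2]]|[/= [Gx|Gx] /not_orP[n1 n2]]].
- by left; left.
- by right; left.
- by left; right.
- by right; right.
Qed.

Lemma cell_approxC D : cell_approx D -> cell_approx (~` D).
Proof.
move=> [b h]; split; first exact: (@measurableC _ XX).
move=> e e0; have [m0 H] := h e e0; exists m0 => m /H[G g]; exists (~` G).
apply: le_trans g; rewrite le_eqVlt; apply/orP; left; apply/eqP; congr (mu _).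
apply/seteqP; split => x; rewrite /symdiff/=.
  by move=> [[Dx /contrapT Gx]|[Gx /contrapT Dx]]; [right|left].
by move=> [[Dx Gx]|[Gx Dx]]; [right; split => //; apply|left; split => //; apply].
Qed.

Lemma cell_approx_bigcup F : (forall n : nat, cell_approx (F n)) -> cell_approx (\bigcup_n F n).
Proof.
move=> hF; have bU : Borel (\bigcup_n F n).
  by apply: (@bigcup_measurable _ XX) => n _; have [] := hF n.
split => // e e0.
pose E n := \bigcup_(k in [set k | (k < n)%N]) F k.
have aE n : cell_approx (E n.+1).
  elim: n => [|n IH].
    rewrite (_ : E 1%N = F 0%N)//; apply/seteqP; split => x; last by exists 0%N.
    by move=> [[]].
  rewrite (_ : E n.+2 = E n.+1 `|` F n.+1); first exact: cell_approxU.
  apply/seteqP; split => x.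
    move=> [k /= kn Fx]; move: kn; rewrite ltnS leq_eqVlt => /orP[/eqP <-|kn]; first by right.
    by left; exists k.
  by move=> [[k /= kn Fx]|Fx]; [exists k => //=; exact: ltnW|exists n.+1 => /=].
have e20 : 0 < e / 2 by lra.
have UE : \bigcup_n F n = \bigcup_n E n.+1.
  apply/seteqP; split => x.
    by move=> [k _ Fx]; exists k => //; exists k => /=.
  by move=> [n _ [k _ Fx]]; exists k.
have [n hn] : exists n, (mu (\bigcup_n F n) - (e / 2)%:E < mu (E n.+1))%E.
  apply: (prob_bigcup_gt (P := mu) (E := fun n => E n.+1)).
  - by move=> n; have [] := aE n.
  - by move=> n m nm x [k /= kn Fx]; exists k => //=; exact: (leq_trans kn).
  - rewrite [X in (X - _ < _)%E](_ : _ = mu (\bigcup_n E n.+1)); last by congr (mu _).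
    have bE : Borel (\bigcup_n E n.+1) by rewrite -UE.
    by rewrite lteBlDr// lteDl ?lte_fin//; exact: prob_fin.
have [bn /(_ _ e20)[m0 H]] := aE n.
exists m0 => m /H[G g]; exists G.
have bG := @Borel_code m G; have s1 := Borel_symdiff bn bG.
have bD : Borel (\bigcup_n F n `\` E n.+1) by exact: (@measurableD _ XX).
have EU : E n.+1 `<=` \bigcup_n F n by move=> x [k _ Fx]; exists k.
have hd : (mu (\bigcup_n F n `\` E n.+1) <= (e / 2)%:E)%E.
  have -> : mu (\bigcup_n F n `\` E n.+1) = (mu (\bigcup_n F n) - mu (E n.+1))%E.
    rewrite (@measureD _ XX)//; last first.
      exact: (le_lt_trans (probability_le1 mu bU) (ltry 1)).
    by rewrite setIidr.
  have f1 := prob_fin mu bU; have f2 := prob_fin mu bn.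
  rewrite leeBlDr//.
  by rewrite addeC; apply: ltW; rewrite -lteBlDr.
have -> : e%:E = ((e / 2)%:E + (e / 2)%:E)%E by rewrite -EFinD; congr EFin; lra.
apply: (le_trans _ (leeD hd g)); apply: (le_trans _ (prob_U2 mu bD s1)).
apply: (prob_le mu); [exact: Borel_symdiff|exact: (@measurableU _ XX _ _ bD s1)|].
move=> x [[Dx Gx]|[Gx Dx]].
  by case: (pselect (E n.+1 x)) => Ex; [right; left|left].
by right; right; split => // /EU.
Qed.

Lemma Phi_law s (C : set R) : measurable C -> mu [set x | C (Phi x s)] = rho C.
Proof.
move=> mC; have mT : measurable (setT : set (FM (XB X) s)) by exact: measurableT.
have := tail_step polX iso mT mC; rewrite setTI => h; apply: (etrans h).
by rewrite -[RHS]mule1; congr (_ * _)%E; exact: probability_setT.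
Qed.

(** The union of the cells with right end at most a misses only part of one cell, of mass at most 1
    / m.+1. *)
Lemma cell_approx_ray (s : 'I_N) (a : R) : cell_approx [set x | Phi x s < a].
Proof.
have mi : measurable [set u : R | u < a].
  by rewrite (_ : mkset _ = `]-oo, a[%classic)//; apply/seteqP; split => u; rewrite /= in_itv.
split; first exact: (measurable_preim (measurable_Phi_coord polX iso s) mi).
move=> e e0; have [k ke] : exists k : nat, e^-1 < k%:R.
  by exists (Num.bound e^-1); apply: archi_boundP; rewrite invr_ge0 ltW.
exists k => m km; set M : R := m.+1%:R.
have M0 : 0 < M by rewrite ltr0n.
have Me : M^-1 <= e.
  rewrite invf_ple ?posrE//; apply: (le_trans (ltW ke)); rewrite ler_nat; exact: leqW.
pose G (c : {ffun 'I_N -> 'I_m.+1}) := (c s).+1%:R / M <= a.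
exists G.
pose V : set R := [set u | u < a] `\` [set u | (idx m u).+1%:R / M <= a] `|`
  ([set u | (idx m u).+1%:R / M <= a] `\` [set u | u < a]).
have mj : measurable [set u : R | (idx m u).+1%:R / M <= a].
  rewrite (_ : mkset _ = \bigcup_(i in [set i : 'I_m.+1 | i.+1%:R / M <= a]) [set u | idx m u = i]).
    by apply: fin_bigcup_measurable; [exact: finite_finset|move=> i _; exact: measurable_idx].
  by apply/seteqP; split => u /= => [h|[i hi ->]//]; exists (idx m u).
have mV : measurable V by apply: measurableU; exact: measurableD.
have -> : mu (symdiff [set x | Phi x s < a] [set x | G (cell_code m x)]) = rho V.
  rewrite -(Phi_law s mV); congr (mu _); rewrite /symdiff /G /V.
  by apply/seteqP; split => x /=; rewrite ffunE.
apply: (@le_trans _ _ (lebesgue_measure (`](a - M^-1), a[%classic : set R))); last first.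
  rewrite lebesgue_measure_itv/= lte_fin; case: ifPn => _; last by rewrite lee_fin ltW.
  by rewrite -EFinD lee_fin opprB addrC subrK.
rewrite rhoE; apply: le_measure; rewrite ?inE; try exact: measurable_itv.
  by apply: measurableI => //; exact: measurable_itv.
move=> u [Vu]; rewrite /= !in_itv/= => /(idx_in m)/andP[h1 h2].
have E : (idx m u).+1%:R / M = (idx m u)%:R / M + M^-1 by rewrite -natr1; ring.
case: Vu => -[/= v1 v2].
  move/negP: v2; rewrite -ltNge v1 andbT E => v2.
  by rewrite ltrBlDr; apply: (lt_le_trans v2); rewrite lerD2r.
by exfalso; apply: v2; exact: (lt_le_trans h2).
Qed.

Lemma Borel_cell_approx D : Borel D -> cell_approx D.
Proof.
have [PhiK PsiK mPhi mPsi law] := iso.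
move=> bD.
have sa : sigma_algebra setT cell_approx.
  split.
  - split; first exact: (@measurable0 _ XX).
    move=> e e0; exists 0%N => m _; exists set0; rewrite (_ : symdiff _ _ = set0) ?measure0 ?lee_fin ?ltW//.
    by apply/seteqP; split => // x [[]|[]].
  - by move=> A; rewrite setTD; exact: cell_approxC.
  - exact: cell_approx_bigcup.
pose GT := g_sigma_algebraType cell_approx.
have mP : measurable_fun setT (Phi : GT -> FM (@RR R N) N).
  apply: measurable_FM => s _; apply: (@measurable_fun_lt_rays _ GT) => a.
  by apply: sub_sigma_algebra; exact: cell_approx_ray.
have mD : measurable (D : set (FM (XB X) N)) by apply/Borel_FM.
have mD' : measurable ([set w | D (Psi w)] : set (FM (@RR R N) N)).
  exact: (measurable_preim (mPsi N) mD).
have := measurable_preim mP mD'.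
rewrite (_ : [set x : GT | _] = D); last by apply/seteqP; split => x /=; rewrite PhiK.
by move=> h; rewrite -(sigma_algebra_id sa).
Qed.

End CellApproximation.

(** * Coupling of laws with equal cell masses *)

Section CellCoupling.
Context d (T : measurableType d) (R : realType) (P Q : probability T R).
Variables (n : nat) (h : T -> nat).
Hypothesis hn : forall x, (h x < n)%N.
Hypothesis mh : forall k, measurable [set x | h x = k].
Hypothesis PQ : forall k, P [set x | h x = k] = Q [set x | h x = k].

Let D k : set (T * T) := [set x | h x = k] `*` [set x | h x = k].
Let mD k : measurable (D k). Proof. by apply: measurableX. Qed.
(** The reciprocal of the mass of the cell. As the inverse of 0 is 0, cells of mass zero contribute
    nothing. *)
Let w k : {nonneg R} := NngNum (divr_ge0 ler01 (fine_ge0 (measure_ge0 Q [set x | h x = k]))).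

(* The two components share their cell and are independent given it. *)
Definition coup_ : set (T * T) -> \bar R :=
  msum (fun k => mscale (w k) (mrestr (prodp P Q) (@mD k))) n.
HB.instance Definition _ := Measure.on coup_.

Let PE A : measurable A -> P A = (\sum_(k < n) P (A `&` [set x | h x = k]))%E.
Proof.
move=> mA; rewrite (@measure_split_fin _ T R P _ (fun x => Ordinal (hn x)) A).
  apply: eq_bigr => k _; congr (P (_ `&` _)); apply/seteqP; split => x /=; first by move=> <-.
  by move=> e; apply: val_inj.
move=> k; apply: measurableI => //; rewrite (_ : mkset _ = [set x | h x = k])//.
by apply/seteqP; split => x /=; [move=> <-|move=> e; apply: val_inj].
Qed.

Let QE A : measurable A -> Q A = (\sum_(k < n) Q (A `&` [set x | h x = k]))%E.
Proof.
move=> mA; rewrite (@measure_split_fin _ T R Q _ (fun x => Ordinal (hn x)) A).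
  apply: eq_bigr => k _; congr (Q (_ `&` _)); apply/seteqP; split => x /=; first by move=> <-.
  by move=> e; apply: val_inj.
move=> k; apply: measurableI => //; rewrite (_ : mkset _ = [set x | h x = k])//.
by apply/seteqP; split => x /=; [move=> <-|move=> e; apply: val_inj].
Qed.

Let wE k A (S : probability T R) : measurable A -> S [set x | h x = k] = Q [set x | h x = k] ->
  ((1 / fine (Q [set x | h x = k]))%:E * (S (A `&` [set x | h x = k]) * Q [set x | h x = k]) =
   S (A `&` [set x | h x = k]))%E.
Proof.
move=> mA SQ; set q := fine _.
have qE : Q [set x | h x = k] = q%:E by rewrite fineK// prob_fin.
have mAk : measurable (A `&` [set x | h x = k]) by exact: measurableI.
have pE : S (A `&` [set x | h x = k]) = (fine (S (A `&` [set x | h x = k])))%:E by rewrite fineK// prob_fin.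
have le : (S (A `&` [set x | h x = k]) <= q%:E)%E.
  by rewrite -qE -SQ; apply: (prob_le S) => // x [].
rewrite qE pE -!EFinM; congr EFin.
have [q0|q0] := eqVneq q 0; last by rewrite mulrC div1r mulfK.
rewrite q0 mulr0 mulr0; apply/eqP; rewrite eq_le fine_ge0//=.
by move: le; rewrite pE q0 lee_fin.
Qed.

Lemma coup1 A : measurable A -> coup_ (A `*` setT) = P A.
Proof.
move=> mA; rewrite /coup_/= /msum (PE mA); apply: eq_bigr => k _.
rewrite -[RHS](wE mA (PQ k)); congr (_ * _)%E.
rewrite /mrestr -prodpX//; last exact: measurableI.
congr (prodp P Q _); apply/seteqP; split => z; first by move=> [[? ?] [? ?]].
by move=> [[? ?] ?].
Qed.

Lemma coup2 A : measurable A -> coup_ (setT `*` A) = Q A.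
Proof.
move=> mA; rewrite /coup_/= /msum (QE mA); apply: eq_bigr => k _.
rewrite -[RHS](wE mA erefl) [X in (_ * X)%E]muleC; congr (_ * _)%E.
rewrite -PQ /mrestr -prodpX//; last exact: measurableI.
congr (prodp P Q _); apply/seteqP; split => z; first by move=> [[? ?] [? ?]].
by move=> [? [? ?]].
Qed.

Let coupT : coup_ setT = 1%E.
Proof. by rewrite -setXTT coup1// probability_setT. Qed.
HB.instance Definition _ := @Measure_isProbability.Build _ _ R coup_ coupT.
Definition coup : probability (T * T)%type R := coup_.

Lemma coup_diag S : measurable S -> S `<=` [set z | h z.1 <> h z.2] -> coup S = 0%E.
Proof.
move=> mS sS; rewrite /coup/= /coup_/= /msum big1// => k _.
have e : mrestr (prodp P Q) (@mD k) S = 0%E.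
  rewrite /mrestr (_ : _ `&` _ = set0) ?measure0//.
  by apply/seteqP; split => // z [/sS /= + [/= h1 h2]]; rewrite h1 h2.
change ((w k)%:num%:E * mrestr (prodp P Q) (@mD k) S = 0)%E.
by rewrite e mule0.
Qed.

End CellCoupling.

Lemma cell_coupling d (T : measurableType d) (R : realType) (P Q : probability T R)
  (I : finType) (c : T -> I) :
  (forall k, measurable [set x | c x = k]) ->
  (forall k, P [set x | c x = k] = Q [set x | c x = k]) ->
  exists g : probability (T * T)%type R,
    [/\ forall A, measurable A -> g (A `*` setT) = P A,
        forall A, measurable A -> g (setT `*` A) = Q A &
        forall S, measurable S -> S `<=` [set z | c z.1 <> c z.2] -> g S = 0%E].
Proof.
move=> mc PQ; pose h x : nat := enum_rank (c x).
have hn x : (h x < #|I|)%N by exact: ltn_ord.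
have hE k : [set x | h x = k] = set0 \/ exists i, [set x | h x = k] = [set x | c x = i].
  have [kI|kI] := ltnP k #|I|; last first.
    by left; apply/seteqP; split => // x /= e; move: (hn x); rewrite e ltnNge kI.
  right; exists (enum_val (Ordinal kI)); apply/seteqP; split => x /=.
    by move=> e; apply: enum_rank_inj; rewrite enum_valK; apply: val_inj.
  by rewrite /h => ->; rewrite enum_valK.
have mh k : measurable [set x | h x = k] by have [->|[i ->]] := hE k.
have PQh k : P [set x | h x = k] = Q [set x | h x = k].
  by have [->|[i ->]] := hE k; rewrite ?measure0.
exists (coup hn mh PQh); split.
- by move=> A; exact: coup1.
- by move=> A; exact: coup2.
- move=> S mS sS; apply: coup_diag => // z /sS /= nz e; apply: nz.
  exact: enum_rank_inj (val_inj e).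
Qed.

Lemma adapted_causal (R : realType) (N : nat) (X Y : 'I_N -> ptopologicalType)
  (mu : Prob R (prodsp X)) (pi : set (pairsp (prodsp X) (prodsp Y)) -> \bar R)
  (T : prodsp X -> prodsp Y) :
  (forall t, polish R (X t)) -> (forall t, polish R (Y t)) ->
  (forall t, measurable_fun [set: FM (XB X) t] (T : FM (XB X) t -> FM (XB Y) t)) ->
  (forall S, Borel S -> pi S = mu [set x | S (x, T x)]) -> causal mu pi.
Proof.
move=> polX polY mT piE.
have cX := prodsp_cbase polX; have cY := prodsp_cbase polY.
have mTN : measurable_fun setT (T : borel (prodsp X) -> borel (prodsp Y)).
  have m1 := measurableT_comp (mT N) (@measurable_Ft_id R N X polX N).
  exact: (measurableT_comp (@measurable_of_FM R N Y polY) m1).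
pose K (x : prodsp X) : Prob R (prodsp Y) := (\d_(T x : borel (prodsp Y)))%R.
have KE x B : K x B = (\1_B (T x))%:E by [].
exists K; split.
- move=> B bB C mC.
  have m : measurable_fun setT (fun y : borel (prodsp Y) => (\1_B y)%:E : \bar R).
    by apply/measurable_EFinP; exact: measurable_indic.
  exact: (measurable_preim (measurableT_comp m mTN) mC).
- move=> S bS; rewrite piE//.
  have mp : measurable_fun setT (fun x : borel (prodsp X) => (x, T x : borel (prodsp Y))).
    exact: measurable_fun_pair.
  have mS : measurable (S : set (borel (prodsp X) * borel (prodsp Y))) by apply/(Borel_pair cX cY).
  have mS' : measurable [set x : borel (prodsp X) | S (x, T x)] by exact: (measurable_preim mp mS).
  transitivity (\int[mu]_x (\1_[set x | S (x, T x)] x)%:E)%E.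
    by rewrite integral_indic// setIT.
  by apply: eq_integral => x _.
- move=> t B mB C mC.
  have m : measurable_fun setT (fun y : FM (XB Y) t => (\1_B y)%:E : \bar R).
    by apply/measurable_EFinP; exact: measurable_indic.
  exact: (measurable_preim (measurableT_comp m (mT t)) mC).
Qed.

Lemma prob_bigcup_le d (T : measurableType d) (R : realType) (P : probability T R)
  (A : nat -> set T) n (e : R) : (forall k, measurable (A k)) ->
  (forall k, (k < n)%N -> (P (A k) <= e%:E)%E) ->
  (P (\bigcup_(k in [set k | (k < n)%N]) A k) <= (n%:R * e)%:E)%E.
Proof.
move=> mA; elim: n => [|n IH] h.
  by rewrite (_ : \bigcup_(k in _) _ = set0) ?measure0 ?mul0r//; apply/seteqP; split => // x [].
have mB : measurable (\bigcup_(k in [set k | (k < n)%N]) A k) by exact: bigcup_measurable.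
rewrite (_ : \bigcup_(k in _) _ = (\bigcup_(k in [set k | (k < n)%N]) A k) `|` A n); last first.
  apply/seteqP; split => x.
    move=> [k /= kn Ax]; move: kn; rewrite ltnS leq_eqVlt => /orP[/eqP <-|kn]; first by right.
    by left; exists k.
  by move=> [[k /= kn Ax]|Ax]; [exists k => //=; exact: ltnW|exists n => /=].
apply: (le_trans (prob_U2 P mB (mA n))).
rewrite -natr1 mulrDl mul1r EFinD; apply: leeD; last exact: h.
by apply: IH => k kn; apply: h; exact: ltnW.
Qed.

Lemma measurable_metric (R : realType) (T : ptopologicalType) (d : T -> T -> R) :
  polish R T -> compatible_metric d ->
  measurable_fun setT (fun p : borel T * borel T => d p.1 p.2).
Proof.
move=> pT cd; have [q dq] := polish_seq pT cd; have [[d0 dE dC dT] dO] := cd.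
have mb k r : measurable ([set y | d (q k) y < r] : set (borel T)).
  by apply: sub_sigma_algebra; exact: compatible_ball_open.
apply: (@measurable_fun_lt_rays _ (borel T * borel T)%type) => a.
rewrite (_ : mkset _ = \bigcup_k \bigcup_(r : rat)
   ([set y : borel T | d (q k) y < ratr r] `*` [set y : borel T | d (q k) y < a - ratr r])).
  apply: bigcup_measurable => k _; apply: bigcupT_measurable_rat => r.
  by apply: measurableX.
apply/seteqP; split => -[x y] /=.
  move=> xya; pose e := a - d x y.
  have e0 : 0 < e by rewrite subr_gt0.
  have [k hk] := dq x (e / 2) ltac:(lra).
  have [r] := rat_in_itvoo (ltac:(rewrite dC; rewrite /e in hk *; have := dT (q k) x y; rewrite (dC (q k) x); lra) : d (q k) x < a - d (q k) y).
  rewrite in_itv/= => /andP[r1 r2]; exists k => //; exists r => //; split => //=.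
  by lra.
move=> [k _ [r _ [/= h1 h2]]]; have := dT x (q k) y; rewrite (dC x (q k)); lra.
Qed.

Section CloseCode.
Context (R : realType) (N : nat) (X : 'I_N -> ptopologicalType).
Hypothesis polX : forall t, polish R (X t).
Variables (mu : Prob R (prodsp X)) (Phi : prodsp X -> ('I_N -> R))
  (Psi : ('I_N -> R) -> prodsp X).
Hypothesis iso : unif_iso mu Phi Psi.
Variable d : prodsp X -> prodsp X -> R.
Hypothesis cd : compatible_metric d.

Let XX := borel (prodsp X).

(** Finitely many small balls carry almost all of [mu], and each is almost a union of cells. Outside
    these errors, two points with the same cell code lie in the same ball. The errors involve only
    the marginals, so [m0] is found before the coupling [g] is known. *)
Lemma close_code (de e : R) : 0 < de -> 0 < e -> exists m0, forall m, (m0 <= m)%N ->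
  forall (dT : measure_display) (T : measurableType dT) (f1 f2 : T -> XX) (g : probability T R),
    measurable_fun setT f1 -> measurable_fun setT f2 ->
    (forall A, measurable A -> g [set z | A (f1 z)] = mu A) ->
    (forall A, measurable A -> g [set z | A (f2 z)] = mu A) ->
    (forall S, measurable S -> S `<=` [set z | cell_code Phi m (f1 z) <> cell_code Phi m (f2 z)] ->
       g S = 0%E) ->
    (g [set z | (de <= d (f1 z) (f2 z))%R] <= e%:E)%E.
Proof.
move=> de0 e0; have pX := prodsp_polish polX.
have [q dq] := polish_seq pX cd; have [[d0 dE dC dT] dO] := cd.
pose B k : set XX := [set y | d (q k) y < de / 2].
have mB k : measurable (B k) by apply: sub_sigma_algebra; exact: compatible_ball_open.
pose U n := \bigcup_(k in [set k | (k < n)%N]) B k.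
have mU n : measurable (U n) by exact: bigcup_measurable.
have UT : \bigcup_n U n = setT.
  apply/seteqP; split => // x _; have [k hk] := dq x (de / 2) ltac:(lra).
  by exists k.+1 => //; exists k => //=; rewrite /B/= dC.
have [n hn] : exists n, ((1 - e / 4)%:E < mu (U n))%E.
  apply: (prob_bigcup_gt (P := mu)) => //.
    by move=> n m nm x [k /= kn Bx]; exists k => //=; exact: leq_trans nm.
  have -> : mu (\bigcup_n U n) = 1%E by rewrite UT; exact: probability_setT.
  by rewrite lte_fin; lra.
(* The n balls together cost at most e / 4 for each of the two marginals, and the mass outside the
   balls costs another e / 4. *)
pose et := e / (4 * n.+1%:R).
have et0 : 0 < et by rewrite divr_gt0// mulr_gt0.
have /choice[M0 HM] k : exists m0, forall m, (m0 <= m)%N -> exists G : set {ffun 'I_N -> 'I_m.+1},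
    (mu (symdiff (B k) [set x | G (cell_code Phi m x)]) <= et%:E)%E.
  by have [_ /(_ _ et0)] := Borel_cell_approx polX iso (mB k).
exists (\max_(k < n) M0 k) => m hm dT' T f1 f2 g mf1 mf2 g1 g2 g0.
have /choice[G HG] k : exists G : set {ffun 'I_N -> 'I_m.+1}, (k < n)%N ->
    (mu (symdiff (B k) [set x | G (cell_code Phi m x)]) <= et%:E)%E.
  case: (boolP (k < n)%N) => kn; last by exists set0.
  have [|G hG] := HM k m; last by exists G.
  exact: (leq_trans (leq_bigmax (Ordinal kn)) hm).
pose S k : set XX := symdiff (B k) [set x | G k (cell_code Phi m x)].
have mS k : measurable (S k) by exact: (Borel_symdiff (mB k) (@Borel_code R N X polX mu Phi Psi iso m (G k))).
pose V : set XX := \bigcup_(k in [set k | (k < n)%N]) S k.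
have mV : measurable V by exact: bigcup_measurable.
have hV : (mu V <= (e / 4)%:E)%E.
  apply: (le_trans (prob_bigcup_le mS HG)); rewrite lee_fin /et.
  rewrite [leLHS](_ : _ = e / 4 * (n%:R / n.+1%:R)); last by rewrite invfM; ring.
  rewrite ger_pMr; last by lra.
  by rewrite ler_pdivrMr ?ltr0n// mul1r ler_nat.
pose W : set XX := ~` U n.
have mW : measurable W by exact: measurableC.
have hW : (mu W <= (e / 4)%:E)%E.
  have -> : mu W = (1 - mu (U n))%E by exact: probability_setC.
  rewrite leeBlDr; last exact: prob_fin.
  move/ltW: hn; rewrite -(leeD2lE (x := (e / 4)%:E))// => /(le_trans _); apply.
  by rewrite -EFinD lee_fin; lra.
pose ne : set T := [set z | cell_code Phi m (f1 z) <> cell_code Phi m (f2 z)].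
have mne : measurable ne.
  rewrite (_ : ne = \bigcup_(c in [set: {ffun 'I_N -> 'I_m.+1}])
     ([set z | (fun c' => c' = c) (cell_code Phi m (f1 z))] `&`
      [set z | (fun c' => c' <> c) (cell_code Phi m (f2 z))])).
    apply: fin_bigcup_measurable; first exact: finite_finset.
    move=> c _; apply: measurableI.
      exact: (measurable_preim mf1 (Borel_code polX iso (fun c' => c' = c))).
    exact: (measurable_preim mf2 (Borel_code polX iso (fun c' => c' <> c))).
  apply/seteqP; split => z /=; first by move=> nz; exists (cell_code Phi m (f1 z)) => //; split => // /esym.
  by move=> [c _ [/= e1 nc]] e2; apply: nc; rewrite -e2.
have gne : g ne = 0%E by apply: g0.
have p1 := measurable_preim mf1 mW; have p2 := measurable_preim mf1 mV.
have p3 := measurable_preim mf2 mV.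
have p23 := measurableU _ _ p2 p3; have p123 := measurableU _ _ p1 p23.
have p := measurableU _ _ p123 mne.
have mbad : measurable [set z | de <= d (f1 z) (f2 z)].
  have mp : measurable_fun setT (fun z => (f1 z, f2 z)) by exact: measurable_fun_pair.
  have md := measurableT_comp (measurable_metric pX cd) mp.
  rewrite (_ : mkset _ = [set z | `[de, +oo[%classic (d (f1 z) (f2 z))]).
    exact: (measurable_preim md (measurable_itv _)).
  by apply/seteqP; split => z; rewrite /= in_itv/= andbT.
have sub : [set z | de <= d (f1 z) (f2 z)] `<=`
    ([set z | W (f1 z)] `|` ([set z | V (f1 z)] `|` [set z | V (f2 z)])) `|` ne.
  move=> z /= bz; apply: contrapT => /not_orP[/not_orP[nW /not_orP[nV1 nV2]] nn].
  move/contrapT: nW => -[k /= kn Bk].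
  have Gk : G k (cell_code Phi m (f1 z)).
    by apply: contrapT => nG; apply: nV1; exists k => //; left.
  move/contrapT: nn => ec; rewrite ec in Gk.
  have Bk2 : B k (f2 z).
    by apply: contrapT => nB; apply: nV2; exists k => //; right.
  have := dT (f1 z) (q k) (f2 z); rewrite (dC (f1 z) (q k)).
  by move: Bk Bk2; rewrite /B/= => h1 h2 h3; have := le_lt_trans (le_trans bz h3) (ltrD h1 h2);
    rewrite -splitr ltxx.
apply: (le_trans (prob_le g mbad p sub)).
apply: (le_trans (prob_U2 g p123 mne)); rewrite gne adde0.
apply: (le_trans (prob_U2 g p1 p23)).
have h1 : (g [set z | W (f1 z)] <= (e / 4)%:E)%E by rewrite g1.
have h2 : (g ([set z | V (f1 z)] `|` [set z | V (f2 z)]) <= (e / 4)%:E + (e / 4)%:E)%E.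
  by apply: (le_trans (prob_U2 g p2 p3)); apply: leeD; [rewrite g1|rewrite g2].
by apply: (le_trans (leeD h1 h2)); rewrite -!EFinD lee_fin; lra.
Qed.

End CloseCode.

Section CloseCoupling.
Context (R : realType) (N : nat) (X Y : 'I_N -> ptopologicalType).
Hypotheses (polX : forall t, polish R (X t)) (polY : forall t, polish R (Y t)).
Variables (mu : Prob R (prodsp X)) (nu : Prob R (prodsp Y)).
Hypotheses (dmu : cont_disint mu) (dnu : cont_disint nu).

Let Z := pairsp (prodsp X) (prodsp Y).

Lemma measurable_pair_fst : measurable_fun setT ((fun z => z.1) : borel Z -> borel (prodsp X)).
Proof.
exact: (measurableT_comp measurable_fst
  (measurable_to_pair (prodsp_cbase polX) (prodsp_cbase polY))).
Qed.

Lemma measurable_pair_snd : measurable_fun setT ((fun z => z.2) : borel Z -> borel (prodsp Y)).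
Proof.
exact: (measurableT_comp measurable_snd
  (measurable_to_pair (prodsp_cbase polX) (prodsp_cbase polY))).
Qed.

Lemma monge_bc (T : prodsp X -> prodsp Y) (T' : prodsp Y -> prodsp X) :
  cancel T T' -> cancel T' T ->
  (forall t, measurable_fun [set: FM (XB X) t] (T : FM (XB X) t -> FM (XB Y) t)) ->
  (forall t, measurable_fun [set: FM (XB Y) t] (T' : FM (XB Y) t -> FM (XB X) t)) ->
  (forall B, Borel B -> mu (T @^-1` B) = nu B) ->
  exists2 pi', (Cpl_bc mu nu `&` Cpl_biM mu nu) pi' &
    forall S, pi' S = mu [set x | S (x, T x)].
Proof.
move=> TK TK' mT mT' law.
have cX := prodsp_cbase polX; have cY := prodsp_cbase polY.
have mTN : measurable_fun setT (T : borel (prodsp X) -> borel (prodsp Y)).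
  have m1 := measurableT_comp (mT N) (@measurable_Ft_id R N X polX N).
  exact: (measurableT_comp (@measurable_of_FM R N Y polY) m1).
have mp : measurable_fun setT (fun x : borel (prodsp X) => (x, T x) : borel Z).
  have m : measurable_fun setT (fun x : borel (prodsp X) => (x, T x : borel (prodsp Y))).
    exact: measurable_fun_pair.
  exact: (measurableT_comp (measurable_of_pair cX cY) m).
pose pi' : Prob R Z := imagep mu mp.
have piE S : pi' S = mu [set x | S (x, T x)] by [].
exists pi' => //; split; last first.
  exists T; split => //; first by exists T'.
  by move=> B bB; exact: (measurable_preim mTN bB).
split.
  split.
    by move=> U bU; rewrite piE; congr (mu _); apply/seteqP; split => x /= => [[]|].
  move=> V bV; rewrite piE -(law V bV); congr (mu _).
  by apply/seteqP; split => x /= => [[]|].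
split.
  by apply: (adapted_causal polX polY mT) => S _.
apply: (adapted_causal polY polX mT') => S bS.
have bS' : Borel [set y | S (y, T' y)].
  have mTN' : measurable_fun setT (T' : borel (prodsp Y) -> borel (prodsp X)).
    have m1 := measurableT_comp (mT' N) (@measurable_Ft_id R N Y polY N).
    exact: (measurableT_comp (@measurable_of_FM R N X polX) m1).
  have m : measurable_fun setT (fun y : borel (prodsp Y) => (y, T' y : borel (prodsp X))).
    exact: measurable_fun_pair.
  have mS : measurable (S : set (borel (prodsp Y) * borel (prodsp X))) by apply/(Borel_pair cY cX).
  exact: (measurable_preim m mS).
rewrite piE -(law _ bS'); congr (mu _); apply/seteqP; split => x; rewrite /swap_set/= TK//.
Qed.

Lemma close_coupling pi (dX : prodsp X -> prodsp X -> R) (dY : prodsp Y -> prodsp Y -> R)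
  (de e : R) : Cpl_bc mu nu pi -> compatible_metric dX -> compatible_metric dY ->
  0 < de -> 0 < e ->
  exists2 pi', (Cpl_bc mu nu `&` Cpl_biM mu nu) pi' &
  exists g : probability (borel Z * borel Z)%type R,
    [/\ forall A, measurable A -> g (A `*` setT) = pi' A,
        forall A, measurable A -> g (setT `*` A) = pi A,
        (g [set w | (de <= dX w.1.1 w.2.1)%R] <= e%:E)%E &
        (g [set w | (de <= dY w.1.2 w.2.2)%R] <= e%:E)%E].
Proof.
move=> [[pi1 pi2] [caX caY]] cdX cdY de0 e0.
have cX := prodsp_cbase polX; have cY := prodsp_cbase polY.
have [Phi [Psi iso]] := uniformization polX dmu.
have [PhiY [PsiY isoY]] := uniformization polY dnu.
have ICX := causal_IC polX iso polY caX; have ICY := causal_IC polY isoY polX caY.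
have [m1 H1] := close_code polX iso cdX de0 e0.
have [m2 H2] := close_code polY isoY cdY de0 e0.
(* The cells of x and of y must have the same size, since the exchanges move cells of one to cells
   of the other. *)
pose m := maxn m1 m2.
have [T [T' [[TK TK' mT mT' law] cells]]] := model_density polX polY iso isoY m ICX ICY.
have [pi' bpi' piE] := monge_bc TK TK' mT mT' law.
exists pi' => //.
pose code (z : borel Z) : {ffun 'I_N -> 'I_m.+1 * 'I_m.+1} :=
  [ffun s => (idx m (Phi z.1 s), idx m (PhiY z.2 s))].
have codeE c : [set z | code z = c] = cellX Phi N c `*` cellY PhiY N c.
  apply/seteqP; split => z /=; first by move=> <-; split => s _; rewrite ffunE.
  move=> [h1 h2]; apply/ffunP => s; rewrite ffunE h1// h2//.
  by rewrite -surjective_pairing.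
have mcode c : measurable [set z | code z = c].
  rewrite codeE; apply: (BorelX polX polY).
    exact: (Borel_Ft polX (@measurable_cellX R N X mu Phi Psi iso m N c)).
  exact: (Borel_Ft polY (@measurable_cellY R N Y nu PhiY PsiY isoY m N c)).
have eqc c : pi' [set z | code z = c] = pi [set z | code z = c].
  by rewrite codeE piE; exact: cells.
have [g [g1 g2 g0]] := cell_coupling mcode eqc.
exists g; split => //.
- have [[[pi'1 pi'2] _] _] := bpi'.
  apply: (H1 m (leq_maxl _ _) _ (borel Z * borel Z)%type (fun w => w.1.1) (fun w => w.2.1)).
  + exact: (measurableT_comp measurable_pair_fst measurable_fst).
  + exact: (measurableT_comp measurable_pair_fst measurable_snd).
  + move=> A mA; rewrite -pi'1//.
    have mA' : Borel (A `*` setT : set Z) by apply: (BorelX polX polY) => //; exact: (@measurableT _ (borel (prodsp Y))).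
    rewrite -(g1 _ mA'); congr (g _); apply/seteqP; split => w /=; first by split.
    by move=> [[]].
  + move=> A mA; rewrite -pi1//.
    have mA' : Borel (A `*` setT : set Z) by apply: (BorelX polX polY) => //; exact: (@measurableT _ (borel (prodsp Y))).
    rewrite -(g2 _ mA'); congr (g _); apply/seteqP; split => w /=; first by split.
    by move=> [_ []].
  + move=> S mS sS; apply: g0 => // w /sS/= nw e'; apply: nw; apply/ffunP => s.
    by move/ffunP/(_ s): e'; rewrite !ffunE => -[].
- have [[[pi'1 pi'2] _] _] := bpi'.
  apply: (H2 m (leq_maxr _ _) _ (borel Z * borel Z)%type (fun w => w.1.2) (fun w => w.2.2)).
  + exact: (measurableT_comp measurable_pair_snd measurable_fst).
  + exact: (measurableT_comp measurable_pair_snd measurable_snd).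
  + move=> A mA; rewrite -pi'2//.
    have mA' : Borel (setT `*` A : set Z) by apply: (BorelX polX polY) => //; exact: (@measurableT _ (borel (prodsp X))).
    rewrite -(g1 _ mA'); congr (g _); apply/seteqP; split => w /=; first by split.
    by move=> [[]].
  + move=> A mA; rewrite -pi2//.
    have mA' : Borel (setT `*` A : set Z) by apply: (BorelX polX polY) => //; exact: (@measurableT _ (borel (prodsp X))).
    rewrite -(g2 _ mA'); congr (g _); apply/seteqP; split => w /=; first by split.
    by move=> [_ []].
  + move=> S mS sS; apply: g0 => // w /sS/= nw e'; apply: nw; apply/ffunP => s.
    by move/ffunP/(_ s): e'; rewrite !ffunE => -[].
Qed.

End CloseCoupling.

(** * Density *)

Lemma bounded_integrable d0 (T0 : measurableType d0) (R : realType) (Q : probability T0 R) (f : T0 -> R) (M : R) :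
  measurable_fun setT f -> (forall x, `|f x| <= M) -> Q.-integrable setT (EFin \o f).
Proof.
move=> mf fM; apply: (@le_integrable _ _ _ Q _ measurableT _ (EFin \o cst M)).
- exact/measurable_EFinP.
- move=> x _; rewrite /= lee_fin [leRHS]ger0_norm; first exact: fM.
  exact: (le_trans (normr_ge0 (f x))).
- exact: finite_measure_integrable_cst.
Qed.

Section Transfer.
Context d1 d2 (T : measurableType d1) (U : measurableType d2) (R : realType).
Variables (g : probability T R) (P : probability U R) (phi : T -> U).
Hypothesis mphi : measurable_fun setT phi.
Hypothesis gP : forall A, measurable A -> g [set z | A (phi z)] = P A.

Lemma ge0_integral_law (F : U -> \bar R) : measurable_fun setT F -> (forall x, 0 <= F x)%E ->
  (\int[P]_x F x = \int[g]_z F (phi z))%E.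
Proof.
move=> mF F0; transitivity (\int[imagem g mphi]_x F x)%E.
  by apply: eq_measure_integral => A mA _; exact: (esym (gP mA)).
by rewrite ge0_integral_imagem.
Qed.

Lemma bounded_integral_law (f : U -> R) (M : R) : measurable_fun setT f ->
  (forall x, `|f x| <= M) -> (\int[P]_x (f x)%:E = \int[g]_z (f (phi z))%:E)%E.
Proof.
move=> mf fM.
have mF : measurable_fun setT (fun x => (f x)%:E) by apply/measurable_EFinP.
have iF : g.-integrable (phi @^-1` setT) ((fun x => (f x)%:E) \o phi).
  rewrite preimage_setT; apply: (@bounded_integrable _ _ R g (f \o phi) M).
    exact: measurableT_comp.
  by move=> x; exact: fM.
have := integral_pushforward mphi mF iF measurableT; rewrite preimage_setT => <-.
transitivity (\int[imagem g mphi]_x (f x)%:E)%E; last by [].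
by apply: eq_measure_integral => A mA _; exact: (esym (gP mA)).
Qed.

End Transfer.

Lemma coupling_integral_close d (T : measurableType d) (R : realType)
  (P Q : probability T R) (g : probability (T * T)%type R) (f : T -> R) (M et e : R)
  (E : set (T * T)) :
  (forall A, measurable A -> g (A `*` setT) = P A) ->
  (forall A, measurable A -> g (setT `*` A) = Q A) ->
  measurable_fun setT f -> (forall x, `|f x| <= M) -> 0 <= et ->
  measurable E -> (g E <= e%:E)%E -> [set w | et < `|f w.1 - f w.2|] `<=` E ->
  (`| \int[P]_x (f x)%:E - \int[Q]_x (f x)%:E | <= (et + 2 * M * e)%:E)%E.
Proof.
move=> g1 g2 mf fM et0 mE gE sub.
have M0 : 0 <= M by exact: (le_trans (normr_ge0 (f point)) (fM _)).
have mf1 : measurable_fun setT (fun w : T * T => f w.1) by exact: measurableT_comp.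
have mf2 : measurable_fun setT (fun w : T * T => f w.2) by exact: measurableT_comp.
rewrite (@bounded_integral_law _ _ _ _ R g P fst measurable_fst _ f M)//; last first.
  by move=> A mA; rewrite -g1//; congr (g _); apply/seteqP; split => w /= => [|[]].
rewrite (@bounded_integral_law _ _ _ _ R g Q snd measurable_snd _ f M)//; last first.
  by move=> A mA; rewrite -g2//; congr (g _); apply/seteqP; split => w /= => [|[]].
have i1 : g.-integrable setT (fun w : T * T => (f w.1)%:E).
  exact: (@bounded_integrable _ _ R g (fun w : T * T => f w.1) M).
have i2 : g.-integrable setT (fun w : T * T => (f w.2)%:E).
  exact: (@bounded_integrable _ _ R g (fun w : T * T => f w.2) M).
rewrite -integralB//.
have mB : measurable_fun setT (fun w : T * T => ((f w.1)%:E - (f w.2)%:E)%E).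
  by apply: emeasurable_funB; exact/measurable_EFinP.
apply: (le_trans (le_abse_integral g measurableT mB)).
apply: (@le_trans _ _ (\int[g]_w ((et%:E + ((2 * M) * \1_E w)%:E)))%E).
  apply: ge0_le_integral => //.
  - exact: measurableT_comp.
  - apply: emeasurable_funD; first exact: measurable_cst.
    by apply/measurable_EFinP; apply: measurable_funM => //; exact: measurable_indic.
  - move=> w _; rewrite -EFinB /= -EFinD lee_fin indicE.
    have [wE|wE] := boolP (w \in E).
      rewrite mulr1; apply: (le_trans (ler_normB _ _)).
      by have := fM w.1; have := fM w.2; lra.
    rewrite mulr0 addr0 leNgt; apply/negP => h; move/negP: wE; apply; apply/mem_set.
    exact: sub.
rewrite ge0_integralD//; first last.
- by apply/measurable_EFinP; apply: measurable_funM => //; exact: measurable_indic.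
- by move=> w _; rewrite lee_fin mulr_ge0// mulr_ge0.
rewrite EFinD; apply: leeD.
  rewrite integral_cst// [X in (_ * X)%E](_ : _ = 1%E) ?mule1//; exact: probability_setT.
rewrite integral_cst_indic// ?mulr_ge0// [leRHS]EFinM; apply: lee_wpmul2l => //.
by rewrite lee_fin mulr_ge0.
Qed.

Section WeakDensity.
Context (R : realType) (N : nat) (X Y : 'I_N -> ptopologicalType).
Hypotheses (polX : forall t, polish R (X t)) (polY : forall t, polish R (Y t)).
Variables (mu : Prob R (prodsp X)) (nu : Prob R (prodsp Y)).
Hypotheses (dmu : cont_disint mu) (dnu : cont_disint nu).

Let Z := pairsp (prodsp X) (prodsp Y).

Lemma continuous_Borel (T : ptopologicalType) (f : T -> R) : continuous f ->
  measurable_fun setT (f : borel T -> R).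
Proof.
move=> cf; apply: (@measurable_fun_lt_rays _ (borel T)) => a.
apply: sub_sigma_algebra; have := (continuousP f).1 cf _ (@open_lt R a).
by [].
Qed.

Section Oscillation.
Variables (dX : prodsp X -> prodsp X -> R) (dY : prodsp Y -> prodsp Y -> R).
Hypotheses (cdX : compatible_metric dX) (cdY : compatible_metric dY).

(** The points where f varies by more than [et] at scale 2^-n. For continuous f these sets are open,
    decrease, and have empty intersection, so their mass under the fixed limit law tends to 0; this
    replaces uniform continuity. *)
Definition osc (f : Z -> R) (et : R) n : set Z :=
  \bigcup_(z in [set: Z]) [set w | [/\ dX z.1 w.1 < 2 ^- n, dY z.2 w.2 < 2 ^- n & et < `|f z - f w|]].

Lemma open_osc f et n : continuous f -> open (osc f et n).
Proof.
move=> cf; apply: bigcup_open => z _.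
rewrite (_ : mkset _ = [set w : Z | [set x | dX z.1 x < 2 ^- n] w.1] `&`
   ([set w : Z | [set y | dY z.2 y < 2 ^- n] w.2] `&` (f @^-1` [set r | et < `|f z - r|]))).
  apply: openI; first by apply: fst_preopen; exact: compatible_ball_open.
  apply: openI; first by apply: snd_preopen; exact: compatible_ball_open.
  move/continuousP: cf; apply.
  have c : continuous (fun r : R => `|f z - r|).
    move=> r; apply: cvg_norm; apply: cvgB; [exact: cvg_cst|exact: cvg_id].
  by have := (continuousP _).1 c _ (@open_gt R et).
by apply/seteqP; split => w => [[]|[? []]].
Qed.

Lemma osc_small (pi : Prob R Z) f et e : continuous f -> 0 < et -> 0 < e ->
  exists n, forall m, (n <= m)%N -> (pi (osc f et m) <= e%:E)%E.
Proof.
move=> cf et0 e0.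
have bo n : Borel (osc f et n) by apply: sub_sigma_algebra; exact: open_osc.
have dec n m : (n <= m)%N -> osc f et m `<=` osc f et n.
  move=> nm w [z _ [/= h1 h2 h3]]; exists z => //=.
  have le : (2 : R) ^- m <= 2 ^- n.
    by rewrite lef_pV2 ?posrE ?exprn_gt0// ler_weXn2l// ler1n.
  by split => //; [exact: lt_le_trans le|exact: lt_le_trans le].
have [n hn] : exists n, (pi (osc f et n) < e%:E)%E.
  apply: (prob_bigcap_lt (P := pi)) => //.
  have -> : pi (\bigcap_n osc f et n) = 0%E; last by rewrite lte_fin.
  transitivity (pi set0); last exact: measure0.
  congr (pi _); apply/seteqP; split => // w hw.
  have [U [V [oU oV Uw Vw UV]]] : exists U V, [/\ open U, open V, U w.1, V w.2 &
      U `*` V `<=` f @^-1` [set r | `|r - f w| < et]].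
    apply: pairsp_box; last by rewrite /= subrr normr0.
    move/continuousP: cf; apply.
    have c : continuous (fun r : R => `|r - f w|).
      move=> r; apply: cvg_norm; apply: cvgB; [exact: cvg_id|exact: cvg_cst].
    by have := (continuousP _).1 c _ (@open_lt R et).
  have [[dX0 dXE dXC dXT] dXO] := cdX; have [[dY0 dYE dYC dYT] dYO] := cdY.
  have [e1 e10 b1] := (dXO U).1 oU _ Uw; have [e2 e20 b2] := (dYO V).1 oV _ Vw.
  have e12 : 0 < Num.min e1 e2 by rewrite lt_min e10.
  have [n] := inv_expn_small e12; rewrite lt_min => /andP[n1 n2].
  have [z _ [/= h1 h2 h3]] := hw n I.
  have zU : U z.1 by apply: b1; rewrite /= dXC; exact: lt_trans n1.
  have zV : V z.2 by apply: b2; rewrite /= dYC; exact: lt_trans n2.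
  have /= := UV z (conj zU zV); by move=> /(lt_trans h3); rewrite ltxx.
exists n => m nm; apply: (le_trans _ (ltW hn)); apply: (prob_le pi); [exact: bo|exact: bo|exact: dec].
Qed.

End Oscillation.

Lemma weak_density pi : Cpl_bc mu nu pi ->
  weak_closure (Cpl_bc mu nu `&` Cpl_biM mu nu) pi.
Proof.
move=> bpi k f fb eps eps0.
have [dX cdX] := prodsp_compatible polX; have [dY cdY] := prodsp_compatible polY.
have /choice[M fM] i : exists M, forall z, `|f i z| <= M by have [] := fb i.
have cf i : continuous (f i) by have [] := fb i.
pose MM := 1 + \sum_i `|M i|.
have MM1 : 1 <= MM by rewrite lerDl sumr_ge0.
have fMM i z : `|f i z| <= MM.
  apply: (le_trans (fM i z)); apply: (le_trans (ler_norm _)).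
  by rewrite /MM (bigD1 i)//= addrCA lerDl addr_ge0// sumr_ge0.
(* Three bad events of mass e (far in x, far in y, large oscillation) yield the bound eps / 4 + 2 *
   MM * (3 * e) = 5 * eps / 8. *)
pose e := eps / (16 * MM).
have e0 : 0 < e by rewrite divr_gt0// mulr_gt0//; lra.
have et0 : 0 < eps / 4 by lra.
have /choice[n hn] i := osc_small cdX cdY pi (cf i) et0 e0.
pose m := \max_i n i.
have [||pi' bpi' [g [g1 g2 gX gY]]] := close_coupling polX polY dmu dnu bpi cdX cdY (de := 2 ^- m) (e := e) => //.
exists pi' => // i.
have cX := prodsp_cbase polX; have cY := prodsp_cbase polY.
pose ZZ := borel Z.
have mfst := measurable_pair_fst polX polY; have msnd := measurable_pair_snd polX polY.
have mdX : measurable_fun setT (fun w : ZZ * ZZ => dX w.1.1 w.2.1).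
  have m1 : measurable_fun setT (fun w : ZZ * ZZ => (w.1.1 : borel (prodsp X), w.2.1 : borel (prodsp X))).
    apply: measurable_fun_pair; first exact: (measurableT_comp mfst measurable_fst).
    exact: (measurableT_comp mfst measurable_snd).
  exact: (measurableT_comp (measurable_metric (prodsp_polish polX) cdX) m1).
have mdY : measurable_fun setT (fun w : ZZ * ZZ => dY w.1.2 w.2.2).
  have m1 : measurable_fun setT (fun w : ZZ * ZZ => (w.1.2 : borel (prodsp Y), w.2.2 : borel (prodsp Y))).
    apply: measurable_fun_pair; first exact: (measurableT_comp msnd measurable_fst).
    exact: (measurableT_comp msnd measurable_snd).
  exact: (measurableT_comp (measurable_metric (prodsp_polish polY) cdY) m1).
have mge (h : ZZ * ZZ -> R) a : measurable_fun setT h -> measurable [set w | a <= h w].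
  move=> mh; rewrite (_ : mkset _ = [set w | `[a, +oo[%classic (h w)]).
    exact: (measurable_preim mh (measurable_itv _)).
  by apply/seteqP; split => w; rewrite /= in_itv/= andbT.
have p1 := mge _ (2 ^- m) mdX; have p2 := mge _ (2 ^- m) mdY.
have bo : measurable (osc dX dY (f i) (eps / 4) m : set ZZ).
  by apply: sub_sigma_algebra; apply: (open_osc cdX cdY); exact: cf.
have p3 : measurable (setT `*` osc dX dY (f i) (eps / 4) m : set (ZZ * ZZ)) by exact: measurableX.
have p12 := measurableU _ _ p1 p2; have p := measurableU _ _ p12 p3.
set E := (X in measurable X) in p.
have gE : (g E <= (3 * e)%:E)%E.
  apply: (le_trans (prob_U2 g p12 p3)).
  have h1 := le_trans (prob_U2 g p1 p2) (leeD gX gY).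
  have h2 : (g (setT `*` osc dX dY (f i) (eps / 4) m) <= e%:E)%E.
    rewrite g2//; apply: (hn i); exact: leq_bigmax.
  apply: (le_trans (leeD h1 h2)); rewrite -!EFinD lee_fin; lra.
have sub : [set w : ZZ * ZZ | eps / 4 < `|f i w.1 - f i w.2|] `<=` E.
  move=> w /= hw; have [hX|hX] := leP (2 ^- m) (dX w.1.1 w.2.1); first by left; left.
  have [hY|hY] := leP (2 ^- m) (dY w.1.2 w.2.2); first by left; right.
  by right; split => //; exists w.1.
have := coupling_integral_close g1 g2 (continuous_Borel (cf i)) (fMM i) (ltW et0) p gE sub.
move/le_lt_trans; apply; rewrite lte_fin.
have -> : 2 * MM * (3 * e) = 6 / 16 * eps.
  by rewrite /e; field; rewrite gt_eqF//; lra.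
lra.
Qed.

End WeakDensity.

(** Dominated convergence, with [phi] itself as the dominating function. It provides the uniform
    integrability needed for moments. *)
Lemma tail_integral_small d (T : measurableType d) (R : realType) (P : probability T R)
  (phi : T -> R) (et : R) : measurable_fun setT phi -> (forall x, 0 <= phi x) ->
  (\int[P]_x (phi x)%:E < +oo)%E -> 0 < et ->
  exists n : nat, (\int[P]_x (phi x * \1_[set y | (n%:R < phi y)%R] x)%:E <= et%:E)%E.
Proof.
move=> mphi phi0 iphi et0; apply: contrapT => /forallNP h.
pose f_ (n : nat) x : \bar R := (phi x * \1_[set y | (n%:R < phi y)%R] x)%:E.
have mf_ n : measurable_fun setT (f_ n).
  apply/measurable_EFinP; apply: measurable_funM => //; apply: measurable_indic.
  rewrite (_ : mkset _ = [set y | `]n%:R, +oo[%classic (phi y)]).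
    exact: (measurable_preim mphi (measurable_itv _)).
  by apply/seteqP; split => y; rewrite /= in_itv/= andbT.
have cf x : setT x -> f_ n x @[n --> \oo] --> (0 : \bar R)%E.
  move=> _; apply: cvg_near_cst; exists (Num.bound (phi x)) => // n /= hn.
  rewrite /f_ indicE (_ : (x \in _) = false) ?mulr0//; apply/negP; rewrite inE /= => hx.
  have := lt_trans hx (archi_boundP (phi0 x)); by rewrite ltr_nat ltnNge hn.
have ig : P.-integrable setT (EFin \o phi).
  apply/integrableP; split; first exact/measurable_EFinP.
  apply: le_lt_trans iphi; rewrite le_eqVlt; apply/orP; left; apply/eqP.
  by apply: eq_integral => x _; rewrite /= ger0_norm.
have fg n x : setT x -> (`|f_ n x| <= (EFin \o phi) x)%E.
  move=> _; rewrite /f_ /= lee_fin normrM ger0_norm// ler_piMr// indicE.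
  by case: (_ \in _); rewrite ?normr1 ?normr0.
have cv := @dominated_cvg _ _ R P setT measurableT f_ (cst 0%E) (EFin \o phi) mf_ cf (fun _ _ => erefl) ig fg.
have lE := cvg_lim (@ereal_hausdorff R) cv.
have : (et%:E <= lim ((\int[P]_x f_ n x)%E @[n --> \oo]))%E.
  apply: lime_ge; first by apply/cvg_ex; eexists; exact: cv.
  by apply: nearW => n; apply: ltW; rewrite ltNge; apply/negP; exact: h.
by rewrite lE integral0 lee_fin leNgt et0.
Qed.

Lemma powRD_le (R : realType) (a b p : R) : 0 <= a -> 0 <= b -> 0 <= p ->
  (a + b) `^ p <= 2 `^ p * (a `^ p + b `^ p).
Proof.
move=> a0 b0 p0; have m0 : 0 <= Num.max a b by rewrite le_max a0.
apply: (@le_trans _ _ ((2 * Num.max a b) `^ p)).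
  apply: ge0_ler_powR => //; rewrite ?nnegrE ?addr_ge0 ?mulr_ge0//.
  by rewrite mulr2n mulrDl mul1r lerD// le_max lexx ?orbT.
rewrite powRM// ler_wpM2l ?powR_ge0//.
by case: (leP a b) => _; rewrite ?lerDl ?lerDr powR_ge0.
Qed.

Section MomentClose.
Context (R : realType) d (U : measurableType d) (mu : probability U R) (dist : U -> U -> R).
Hypothesis dm : is_metric dist.
Hypothesis md : measurable_fun setT (fun p : U * U => dist p.1 p.2).
Variables (p : R) (x0 : U).
Hypothesis p1 : 1 <= p.
Hypothesis mom : (\int[mu]_x ((dist x0 x) `^ p)%:E < +oo)%E.

(** Closeness in probability controls the p-th power of the distance because the marginals are
    fixed: the part of the moment above a level [K] is small uniformly over all couplings, and [de]
    and [e] depend on [mu] alone. *)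
Lemma moment_close (et : R) : 0 < et -> exists de e : R, [/\ 0 < de, 0 < e &
  forall (dT : measure_display) (T : measurableType dT) (f1 f2 : T -> U) (g : probability T R),
    measurable_fun setT f1 -> measurable_fun setT f2 ->
    (forall A, measurable A -> g [set z | A (f1 z)] = mu A) ->
    (forall A, measurable A -> g [set z | A (f2 z)] = mu A) ->
    (g [set z | (de <= dist (f1 z) (f2 z))%R] <= e%:E)%E ->
    (\int[g]_z ((dist (f1 z) (f2 z)) `^ p)%:E <= et%:E)%E].
Proof.
move=> et0; have [d0 dE dC dT] := dm.
have p0 : 0 <= p by exact: le_trans ler01 p1.
have pn0 : p != 0 by rewrite gt_eqF// (lt_le_trans ltr01 p1).
pose phi x := dist x0 x `^ p.
have phi0 x : 0 <= phi x by exact: powR_ge0.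
have mphi : measurable_fun setT phi.
  have m1 := measurableT_comp md (pair1_measurable x0).
  exact: (measurableT_comp (measurable_powR p) m1).
pose c := 2 `^ p : R.
have c0 : 0 < c by rewrite powR_gt0.
have ec : 0 < et / (4 * c) by rewrite divr_gt0// mulr_gt0.
have [n hn] := tail_integral_small mphi phi0 mom ec.
pose K : R := n%:R.
pose H x := phi x * \1_[set y | K < phi y] x.
have H0 x : 0 <= H x by rewrite mulr_ge0.
have mH : measurable_fun setT H.
  apply: measurable_funM => //; apply: measurable_indic.
  rewrite (_ : mkset _ = [set y | `]K, +oo[%classic (phi y)]).
    exact: (measurable_preim mphi (measurable_itv _)).
  by apply/seteqP; split => y; rewrite /= in_itv/= andbT.
have phiH x : phi x <= K + H x.
  rewrite /H indicE; have [hx|hx] := boolP (x \in _); first by rewrite mulr1 lerDr ler0n.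
  rewrite mulr0 addr0 leNgt; apply/negP => h; move/negP: hx; apply; exact/mem_set.
(* Four terms of at most et / 4 each: small distances, the bounded part on the bad event, and the
   two tails. Writing K + 1 in the denominator of [e] covers K = 0. *)
pose de := (et / 4) `^ p^-1; have de0 : 0 < de by rewrite powR_gt0//; lra.
have deE : de `^ p = et / 4.
  by rewrite -powRrM mulVf// powRr1//; lra.
pose e := et / (8 * c * (K + 1)).
have K0 : 0 <= K by rewrite ler0n.
have e0 : 0 < e by rewrite divr_gt0// mulr_gt0// ?mulr_gt0//; lra.
exists de, e; split => // dT' T f1 f2 g m1 m2 l1 l2 gE.
have mdf : measurable_fun setT (fun z => dist (f1 z) (f2 z)).
  have mm : measurable_fun setT (fun z => (f1 z, f2 z)) by exact: measurable_fun_pair.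
  exact: (measurableT_comp md mm).
set E := mkset _ in gE.
have mE : measurable E.
  rewrite (_ : E = [set z | `[de, +oo[%classic (dist (f1 z) (f2 z))]).
    exact: (measurable_preim mdf (measurable_itv _)).
  by apply/seteqP; split => z; rewrite /E/= in_itv/= andbT.
have pw z : dist (f1 z) (f2 z) `^ p <= de `^ p + (c * (2 * K)) * \1_E z + c * H (f1 z) + c * H (f2 z).
  rewrite indicE; have [zE|zE] := boolP (z \in E); last first.
    rewrite mulr0 addr0 -addrA; apply: ler_wpDr; first by rewrite addr_ge0// mulr_ge0// ltW.
    apply: ge0_ler_powR; rewrite ?nnegrE// ?(ltW de0)//.
    rewrite leNgt; apply/negP => h; move/negP: zE; apply; apply/mem_set; exact: ltW.
  rewrite mulr1.
  have h1 : dist (f1 z) (f2 z) `^ p <= c * (phi (f1 z) + phi (f2 z)).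
    apply: (le_trans _ (powRD_le (d0 x0 (f1 z)) (d0 x0 (f2 z)) p0)).
    apply: ge0_ler_powR; rewrite ?nnegrE ?addr_ge0//.
    by apply: (le_trans (dT _ x0 _)); rewrite (dC (f1 z)).
  apply: (le_trans h1).
  have h2 : c * (phi (f1 z) + phi (f2 z)) <= c * (K + H (f1 z) + (K + H (f2 z))).
    by rewrite ler_wpM2l ?(ltW c0)// lerD.
  apply: (le_trans h2); have : 0 <= de `^ p by exact: powR_ge0.
  by rewrite !mulrDr; lra.
have mHf1 := measurableT_comp mH m1; have mHf2 := measurableT_comp mH m2.
have mHe (h : T -> R) : measurable_fun setT h -> measurable_fun setT (fun z => (c * h z)%:E).
  by move=> mh; apply/measurable_EFinP; exact: measurable_funM.
have mI : measurable_fun setT (fun z : T => ((c * (2 * K)) * \1_E z)%:E).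
  by apply/measurable_EFinP; apply: measurable_funM => //; exact: measurable_indic.
have ci (h : T -> R) : measurable_fun setT h -> (forall z, 0 <= h z) ->
    (\int[g]_z (h z)%:E <= (et / (4 * c))%:E)%E -> (\int[g]_z (c * h z)%:E <= (et / 4)%:E)%E.
  move=> mh h0 hi; under eq_integral do rewrite EFinM.
  rewrite ge0_integralZl_EFin//; first last.
  - by rewrite ltW.
  - exact/measurable_EFinP.
  - by move=> z _; rewrite lee_fin.
  apply: (@le_trans _ _ (c%:E * (et / (4 * c))%:E)%E).
    by apply: lee_wpmul2l => //; rewrite lee_fin ltW.
  rewrite -EFinM lee_fin le_eqVlt; apply/orP; left; apply/eqP; field.
  by rewrite gt_eqF.
have iH f (mf : measurable_fun setT f) : (forall A, measurable A -> g [set z | A (f z)] = mu A) ->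
    (\int[g]_z (c * H (f z))%:E <= (et / 4)%:E)%E.
  move=> l; apply: (ci (fun z => H (f z))) => //; first exact: (measurableT_comp mH mf).
  have -> : (\int[g]_z (H (f z))%:E = \int[mu]_x (H x)%:E)%E; last exact: hn.
  apply: esym; apply: (ge0_integral_law mf l (F := fun x => (H x)%:E)).
    exact/measurable_EFinP.
  by move=> x; rewrite lee_fin.
apply: (@le_trans _ _ (\int[g]_z ((de `^ p)%:E + ((c * (2 * K)) * \1_E z)%:E
   + (c * H (f1 z))%:E + (c * H (f2 z))%:E))%E).
  apply: ge0_le_integral => //.
  - by move=> z _; rewrite lee_fin powR_ge0.
  - by apply/measurable_EFinP; exact: (measurableT_comp (measurable_powR p) mdf).
  - apply: emeasurable_funD; last exact: mHe.
    apply: emeasurable_funD; last exact: mHe.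
    by apply: emeasurable_funD => //; exact: measurable_cst.
  - by move=> z _; rewrite -!EFinD lee_fin.
have cK0 : 0 <= c * (2 * K) by rewrite mulr_ge0 ?(ltW c0) ?mulr_ge0.
have nn1 z : (0 <= ((c * (2 * K)) * \1_E z)%:E)%E by rewrite lee_fin mulr_ge0.
have nn2 f z : (0 <= (c * H (f z))%:E :> \bar R)%E by rewrite lee_fin mulr_ge0// ltW.
have nn3 : (0 <= (de `^ p)%:E)%E by rewrite lee_fin powR_ge0.
rewrite ge0_integralD//; first last.
- exact: mHe.
- apply: emeasurable_funD; last exact: mHe.
  by apply: emeasurable_funD => //; exact: measurable_cst.
- by move=> z _; rewrite !adde_ge0.
rewrite ge0_integralD//; first last.
- exact: mHe.
- by apply: emeasurable_funD => //; exact: measurable_cst.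
- by move=> z _; rewrite !adde_ge0.
rewrite ge0_integralD//.
have -> : (\int[g]_z (de `^ p)%:E = (et / 4)%:E)%E.
  rewrite integral_cst// deE [X in (_ * X)%E](_ : _ = 1%E) ?mule1//; exact: probability_setT.
have h3 : (\int[g]_z ((c * (2 * K)) * \1_E z)%:E <= (et / 4)%:E)%E.
  rewrite integral_cst_indic//; apply: (@le_trans _ _ ((c * (2 * K))%:E * e%:E)%E).
    by apply: lee_wpmul2l.
  rewrite -EFinM lee_fin /e.
  rewrite [leLHS](_ : _ = et / 4 * (K / (K + 1))); last by field; rewrite !gt_eqF//; lra.
  rewrite ger_pMr; last by lra.
  by rewrite ler_pdivrMr; lra.
apply: (le_trans (leeD (leeD (leeD (lexx _) h3) (iH _ m1 l1)) (iH _ m2 l2))).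
by rewrite -!EFinD lee_fin; lra.
Qed.

End MomentClose.

Section WassersteinDensity.
Context (R : realType) (N : nat) (X Y : 'I_N -> ptopologicalType).
Hypotheses (polX : forall t, polish R (X t)) (polY : forall t, polish R (Y t)).
Variables (mu : Prob R (prodsp X)) (nu : Prob R (prodsp Y)).
Hypotheses (dmu : cont_disint mu) (dnu : cont_disint nu).

Let Z := pairsp (prodsp X) (prodsp Y).
Let ZZ := borel Z.

Lemma Wp_density (p : R) (dX : prodsp X -> prodsp X -> R) (dY : prodsp Y -> prodsp Y -> R) :
  1 <= p -> compatible_metric dX -> compatible_metric dY ->
  finite_moment p dX mu -> finite_moment p dY nu ->
  forall pi, Cpl_bc mu nu pi -> forall eps : R, 0 < eps ->
    exists2 pi', (Cpl_bc mu nu `&` Cpl_biM mu nu) pi' &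
      (Wp p (prod_cost p dX dY) pi' pi < eps%:E)%E.
Proof.
move=> p1 cdX cdY [x0 mX] [y0 mY] pi bpi eps eps0.
have cX := prodsp_cbase polX; have cY := prodsp_cbase polY.
have cZ := pairsp_cbase cX cY.
have mmX := measurable_metric (prodsp_polish polX) cdX.
have mmY := measurable_metric (prodsp_polish polY) cdY.
(* Each factor may contribute half of (eps / 2)^p, so that the p-th root stays at eps / 2, strictly
   below eps. *)
pose et := (eps / 2) `^ p / 2.
have e20 : 0 < eps / 2 by lra.
have et0 : 0 < et by rewrite divr_gt0// powR_gt0.
have [deX [eX [deX0 eX0 HX]]] := @moment_close R _ (borel (prodsp X)) mu dX (proj1 cdX) mmX p x0 p1 mX et et0.
have [deY [eY [deY0 eY0 HY]]] := @moment_close R _ (borel (prodsp Y)) nu dY (proj1 cdY) mmY p y0 p1 mY et et0.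
pose de := Num.min deX deY; pose e := Num.min eX eY.
have de0 : 0 < de by rewrite lt_min deX0.
have e0 : 0 < e by rewrite lt_min eX0.
have [pi' bpi' [g [g1 g2 gX gY]]] := close_coupling polX polY dmu dnu bpi cdX cdY de0 e0.
exists pi' => //.
have [[[pi'1 pi'2] _] _] := bpi'; have [[pi1 pi2] _] := bpi.
have mfst := measurable_pair_fst polX polY; have msnd := measurable_pair_snd polX polY.
have mf1 : measurable_fun setT (fun w : ZZ * ZZ => w.1.1 : borel (prodsp X)).
  exact: (measurableT_comp mfst measurable_fst).
have mf2 : measurable_fun setT (fun w : ZZ * ZZ => w.2.1 : borel (prodsp X)).
  exact: (measurableT_comp mfst measurable_snd).
have ms1 : measurable_fun setT (fun w : ZZ * ZZ => w.1.2 : borel (prodsp Y)).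
  exact: (measurableT_comp msnd measurable_fst).
have ms2 : measurable_fun setT (fun w : ZZ * ZZ => w.2.2 : borel (prodsp Y)).
  exact: (measurableT_comp msnd measurable_snd).
have bTX A : Borel A -> measurable (A `*` setT : set ZZ).
  by move=> bA; apply: (BorelX polX polY) => //; exact: (@measurableT _ (borel (prodsp Y))).
have bTY A : Borel A -> measurable (setT `*` A : set ZZ).
  by move=> bA; apply: (BorelX polX polY) => //; exact: (@measurableT _ (borel (prodsp X))).
have mdX : measurable_fun setT (fun w : ZZ * ZZ => dX w.1.1 w.2.1).
  have m1 : measurable_fun setT (fun w : ZZ * ZZ => (w.1.1 : borel (prodsp X), w.2.1 : borel (prodsp X))).
    exact: measurable_fun_pair.
  exact: (measurableT_comp mmX m1).
have mdY : measurable_fun setT (fun w : ZZ * ZZ => dY w.1.2 w.2.2).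
  have m1 : measurable_fun setT (fun w : ZZ * ZZ => (w.1.2 : borel (prodsp Y), w.2.2 : borel (prodsp Y))).
    exact: measurable_fun_pair.
  exact: (measurableT_comp mmY m1).
have mge (h : ZZ * ZZ -> R) a : measurable_fun setT h -> measurable [set w | a <= h w].
  move=> mh; rewrite (_ : mkset _ = [set w | `[a, +oo[%classic (h w)]).
    exact: (measurable_preim mh (measurable_itv _)).
  by apply/seteqP; split => w; rewrite /= in_itv/= andbT.
have bndX : (\int[g]_w (dX w.1.1 w.2.1 `^ p)%:E <= et%:E)%E.
  apply: (HX _ (ZZ * ZZ)%type (fun w => w.1.1) (fun w => w.2.1)) => //.
  - move=> A mA; rewrite -pi'1// -(g1 _ (bTX _ mA)); congr (g _).
    by apply/seteqP; split => w /= => [|[[]]].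
  - move=> A mA; rewrite -pi1// -(g2 _ (bTX _ mA)); congr (g _).
    by apply/seteqP; split => w /= => [|[_ []]].
  - have l : (e%:E <= eX%:E)%E by rewrite lee_fin ge_min lexx.
    apply: (le_trans _ (le_trans gX l)); apply: (prob_le g); [exact: mge|exact: mge|].
    by move=> w /=; apply: le_trans; rewrite ge_min lexx.
have bndY : (\int[g]_w (dY w.1.2 w.2.2 `^ p)%:E <= et%:E)%E.
  apply: (HY _ (ZZ * ZZ)%type (fun w => w.1.2) (fun w => w.2.2)) => //.
  - move=> A mA; rewrite -pi'2// -(g1 _ (bTY _ mA)); congr (g _).
    by apply/seteqP; split => w /= => [|[[]]].
  - move=> A mA; rewrite -pi2// -(g2 _ (bTY _ mA)); congr (g _).
    by apply/seteqP; split => w /= => [|[_ []]].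
  - have l : (e%:E <= eY%:E)%E by rewrite lee_fin ge_min lexx orbT.
    apply: (le_trans _ (le_trans gY l)); apply: (prob_le g); [exact: mge|exact: mge|].
    by move=> w /=; apply: le_trans; rewrite ge_min lexx orbT.
have mof := measurable_of_pair cZ cZ.
pose G : Prob R (pairsp Z Z) := imagep g mof.
have cG : is_cpl pi' pi G.
  by split => A bA; [exact: (g1 A bA)|exact: (g2 A bA)].
have mcX : measurable_fun setT (fun w : ZZ * ZZ => (dX w.1.1 w.2.1 `^ p)%:E).
  by apply/measurable_EFinP; exact: (measurableT_comp (measurable_powR p) mdX).
have mcY : measurable_fun setT (fun w : ZZ * ZZ => (dY w.1.2 w.2.2 `^ p)%:E).
  by apply/measurable_EFinP; exact: (measurableT_comp (measurable_powR p) mdY).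
have cost : (\int[G]_w (prod_cost p dX dY w.1 w.2)%:E <= ((eps / 2) `^ p)%:E)%E.
  have mc : measurable_fun setT (fun w : ZZ * ZZ => (prod_cost p dX dY w.1 w.2)%:E).
    rewrite (_ : (fun w => _) = (fun w : ZZ * ZZ => (dX w.1.1 w.2.1 `^ p)%:E + (dY w.1.2 w.2.2 `^ p)%:E)%E)//.
    exact: emeasurable_funD.
  have mc' : measurable_fun setT ((fun w => (prod_cost p dX dY w.1 w.2)%:E) : borel (pairsp Z Z) -> \bar R).
    exact: (measurableT_comp mc (measurable_to_pair cZ cZ)).
  have -> : (\int[G]_w (prod_cost p dX dY w.1 w.2)%:E = \int[g]_w (prod_cost p dX dY w.1 w.2)%:E)%E.
    rewrite (@ge0_integral_imagem _ _ _ _ R g _ mof (fun w => (prod_cost p dX dY w.1 w.2)%:E))//.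
    by move=> w; rewrite lee_fin addr_ge0// powR_ge0.
  have -> : (\int[g]_w (prod_cost p dX dY w.1 w.2)%:E =
      \int[g]_w (dX w.1.1 w.2.1 `^ p)%:E + \int[g]_w (dY w.1.2 w.2.2 `^ p)%:E)%E.
    by rewrite -ge0_integralD// => w _; rewrite lee_fin powR_ge0.
  by apply: (le_trans (leeD bndX bndY)); rewrite -EFinD lee_fin /et -splitr.
rewrite /Wp; apply: (@le_lt_trans _ _ (((eps / 2) `^ p)%:E `^ p^-1)%E).
  have pV : 0 <= p^-1 by rewrite invr_ge0 (le_trans ler01 p1).
  apply: (gt0_ler_poweR pV).
  - rewrite in_itv/= leey andbT; apply: le_ereal_inf_tmp => _ [h _ <-].
    by apply: integral_ge0 => w _; rewrite lee_fin addr_ge0// powR_ge0.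
  - by rewrite in_itv/= leey andbT lee_fin powR_ge0.
  - by apply: le_trans cost; apply: ereal_inf_lbound; exists G.
rewrite poweR_EFin -powRrM mulfV; last by rewrite gt_eqF// (lt_le_trans ltr01 p1).
by rewrite powRr1 ?lte_fin ?(ltW e20)// ltr_pdivrMr// ltr_pMr// ltr1n.
Qed.

End WassersteinDensity.

(** * Weak limits of bicausal couplings *)

Lemma metric_continuous (R : realType) (T : ptopologicalType) (d : T -> T -> R) (q : T) :
  compatible_metric d -> continuous (d q : T -> R).
Proof.
move=> cd; have [[d0 dE dC dT] dO] := cd.
move=> x; apply/cvgrPdist_lt => e e0.
have ob : open [set y | d x y < e] by exact: compatible_ball_open.
have nb : nbhs x [set y | d x y < e].
  by apply: open_nbhs_nbhs; split => //=; rewrite (dE x x).2.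
apply: filterS nb => y /= xy; rewrite ltr_norml; apply/andP; split.
  by have := dT q x y; lra.
by have := dT q y x; rewrite (dC y x); lra.
Qed.

Section ContinuousApproximation.
Context (R : realType) (T : ptopologicalType).
Hypothesis polT : polish R T.
Variable P : bool -> Prob R T.

Let TT := borel T.

(** One function has to work for two laws at once: [weak_closure_law] compares the expected marginal
    with that of the limit before they are known to coincide. *)
Definition cont_approx (D : set T) := Borel D /\ forall e : R, 0 < e ->
  exists f : T -> R, [/\ continuous f, forall x, 0 <= f x <= 1 &
    forall b, (\int[P b]_x (`|f x - \1_D x|)%:E <= e%:E)%E].

Lemma measurable_approx (f : T -> R) (D : set T) : continuous f -> Borel D ->
  measurable_fun setT ((fun x => (`|f x - \1_D x|)%:E) : TT -> \bar R).
Proof.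
move=> cf bD; have mf := continuous_Borel cf.
have mD : measurable_fun setT (\1_D : TT -> R) by exact: measurable_indic.
have mB : measurable_fun setT ((fun x => f x - \1_D x) : TT -> R) by exact: measurable_funB.
by apply/measurable_EFinP; exact: measurableT_comp.
Qed.

Lemma cont_approxC D : cont_approx D -> cont_approx (~` D).
Proof.
move=> [bD h]; split; first exact: (@measurableC _ TT).
move=> e e0; have [f [cf f01 fi]] := h e e0; exists (fun x => 1 - f x); split.
- by move=> x; apply: cvgB; [exact: cvg_cst|exact: cf].
- by move=> x; have := f01 x; lra.
- move=> b; apply: le_trans (fi b); rewrite le_eqVlt; apply/orP; left; apply/eqP.
  apply: eq_integral => x _; rewrite !indicE in_setC; case: (x \in D) => /=; congr EFin.
    by rewrite subr0 distrC.
  by rewrite subr0 addrAC subrr add0r normrN.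
Qed.

Lemma cont_approxI D1 D2 : cont_approx D1 -> cont_approx D2 -> cont_approx (D1 `&` D2).
Proof.
move=> [b1 h1] [b2 h2]; have b12 : Borel (D1 `&` D2) by exact: (@measurableI _ TT).
split => // e e0; have e20 : 0 < e / 2 by lra.
have [f1 [c1 f1b f1i]] := h1 _ e20; have [f2 [c2 f2b f2i]] := h2 _ e20.
have c12 : continuous (fun x => f1 x * f2 x) by move=> x; apply: cvgM; [exact: c1|exact: c2].
exists (fun x => f1 x * f2 x); split => //.
  by move=> x; have := f1b x; have := f2b x => /andP[? ?] /andP[? ?]; rewrite mulr_ge0//= mulr_ile1.
move=> b; have -> : e%:E = ((e / 2)%:E + (e / 2)%:E)%E by rewrite -EFinD; congr EFin; lra.
apply: (le_trans _ (leeD (f1i b) (f2i b))); rewrite -ge0_integralD//; first last.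
- exact: measurable_approx.
- exact: measurable_approx.
apply: ge0_le_integral => //.
- exact: measurable_approx.
- by apply: emeasurable_funD; exact: measurable_approx.
- move=> x _; rewrite -EFinD lee_fin !indicE in_setI.
  have /andP[a1 a2] := f1b x; have /andP[a3 a4] := f2b x.
  case: (x \in D1); case: (x \in D2); rewrite /= ?subr0.
  + rewrite -(normrN (f1 x - 1)) -(normrN (f2 x - 1)) -(normrN (_ - _)) !opprB.
    rewrite !ger0_norm ?subr_ge0//; last by rewrite mulr_ile1.
    rewrite -subr_ge0 (_ : _ - _ = (1 - f1 x) * (1 - f2 x)); last by ring.
    by rewrite mulr_ge0 ?subr_ge0.
  + rewrite ger0_norm ?mulr_ge0// (ger0_norm a3); apply: (le_trans (ler_piMl a3 a2)).
    by rewrite lerDr.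
  + rewrite ger0_norm ?mulr_ge0// (ger0_norm a1); apply: (le_trans (ler_piMr a1 a4)).
    by rewrite lerDl.
  + rewrite ger0_norm ?mulr_ge0// (ger0_norm a1) (ger0_norm a3); apply: (le_trans (ler_piMr a1 a4)).
    by rewrite lerDl.
Qed.

Lemma cont_approxU D1 D2 : cont_approx D1 -> cont_approx D2 -> cont_approx (D1 `|` D2).
Proof.
move=> /cont_approxC h1 /cont_approxC h2; rewrite -[X in cont_approx X]setCK setCU.
by apply: cont_approxC; exact: cont_approxI.
Qed.

Lemma cont_approx_close D D' (e : R) : Borel D -> cont_approx D' -> 0 < e ->
  (forall b, (P b ((D `\` D') `|` (D' `\` D)) <= e%:E)%E) ->
  exists f : T -> R, [/\ continuous f, forall x, 0 <= f x <= 1 &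
    forall b, (\int[P b]_x (`|f x - \1_D x|)%:E <= (2 * e)%:E)%E].
Proof.
move=> bD [bD' h] e0 hP; have [f [cf f01 fi]] := h e e0; exists f; split => // b.
pose S := (D `\` D') `|` (D' `\` D).
have bS : Borel S by apply: (@measurableU _ TT); apply: (@measurableD _ TT).
have -> : (2 * e)%:E = (e%:E + e%:E)%E by rewrite -EFinD; congr EFin; lra.
have iS : (\int[P b]_x (\1_S x)%:E <= e%:E)%E by rewrite integral_indic// setIT; exact: hP.
have mS : measurable_fun setT ((fun x => (\1_S x)%:E) : TT -> \bar R).
  by apply/measurable_EFinP; exact: measurable_indic.
apply: (le_trans _ (leeD (fi b) iS)); rewrite -ge0_integralD//; last exact: measurable_approx.
apply: ge0_le_integral => //.
- exact: measurable_approx.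
- by apply: emeasurable_funD => //; exact: measurable_approx.
- move=> x _; rewrite -EFinD lee_fin.
  have -> : f x - \1_D x = (f x - \1_D' x) + (\1_D' x - \1_D x) by ring.
  apply: (le_trans (ler_normD _ _)); rewrite lerD2l !indicE in_setU !in_setD.
  by case: (x \in D); case: (x \in D') => /=; rewrite ?subrr ?subr0 ?sub0r ?normrN ?normr0 ?normr1.
Qed.

Lemma cont_approx_bigcup F : (forall n : nat, cont_approx (F n)) -> cont_approx (\bigcup_n F n).
Proof.
move=> hF; have bU : Borel (\bigcup_n F n).
  by apply: (@bigcup_measurable _ TT) => n _; have [] := hF n.
split => // e e0.
pose E n := \bigcup_(k in [set k | (k < n)%N]) F k.
have aE n : cont_approx (E n.+1).
  elim: n => [|n IH].
    rewrite (_ : E 1%N = F 0%N)//; apply/seteqP; split => x; last by exists 0%N.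
    by move=> [[]].
  rewrite (_ : E n.+2 = E n.+1 `|` F n.+1); first exact: cont_approxU.
  apply/seteqP; split => x.
    move=> [k /= kn Fx]; move: kn; rewrite ltnS leq_eqVlt => /orP[/eqP <-|kn]; first by right.
    by left; exists k.
  by move=> [[k /= kn Fx]|Fx]; [exists k => //=; exact: ltnW|exists n.+1 => /=].
have bE n : Borel (E n.+1) by have [] := aE n.
have Em n m : (n <= m)%N -> E n.+1 `<=` E m.+1.
  by move=> nm x [k /= kn Fx]; exists k => //=; exact: (leq_trans kn).
have [n hn] : exists n, forall b, (P b (\bigcup_n F n `\` E n.+1) <= (e / 2)%:E)%E.
  have /choice[n hn] b : exists n, (P b (\bigcup_n F n `\` E n.+1) < (e / 2)%:E)%E.
    apply: (prob_bigcap_lt (P := P b) (E := fun n => \bigcup_n F n `\` E n.+1)).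
    - by move=> n; exact: (@measurableD _ TT _ _ bU (bE n)).
    - by move=> n m nm x [Ux nE]; split => // /(Em _ _ nm).
    - have -> : P b (\bigcap_n (\bigcup_n F n `\` E n.+1)) = 0%E; last by rewrite lte_fin; lra.
      transitivity (P b set0); last exact: measure0.
      congr (P b _); apply/seteqP; split => // x hx.
      have [[k _ Fx] _] := hx 0%N I; have [_ nE] := hx k I; apply: nE; exists k => //=.
  exists (maxn (n true) (n false)) => b; apply: (le_trans _ (ltW (hn b))).
  apply: (prob_le (P b)); [exact: (@measurableD _ TT _ _ bU (bE _))|exact: (@measurableD _ TT _ _ bU (bE _))|].
  by move=> x [Ux nE]; split => // /Em xE; apply: nE; apply: xE; case: b; rewrite leq_max leqnn ?orbT.
have [||f hf] := @cont_approx_close (\bigcup_n F n) (E n.+1) (e / 2) bU (aE n).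
- by lra.
- move=> b; apply: (le_trans _ (hn b)); rewrite le_eqVlt; apply/orP; left; apply/eqP; congr (P b _).
  apply/seteqP; split => x; last by left.
  by case=> // -[[k _ Fx] nU]; exfalso; apply: nU; exists k.
by exists f; move: hf; rewrite mulrC divfK.
Qed.

Lemma cont_approx_ball (d : T -> T -> R) q r : compatible_metric d ->
  cont_approx [set y | d q y < r].
Proof.
move=> cd; have [[d0 dE dC dT] dO] := cd.
have cq := @metric_continuous R T d q cd.
have ball_borel a : Borel [set y | d q y < a].
  by apply: sub_sigma_algebra; exact: compatible_ball_open.
split => // e e0.
pose E (n : nat) : set T := [set y | d q y < r] `\` [set y | d q y < r - n.+1%:R^-1].
have bE n : Borel (E n) by exact: (@measurableD _ TT _ _ (ball_borel r) (ball_borel _)).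
have mE n m : (n <= m)%N -> E m `<=` E n.
  move=> nm y [/= h1 h2]; split => //= h3; apply: h2; apply: (lt_le_trans h3).
  by rewrite lerD2l lerN2 lef_pV2 ?posrE// ler_nat ltnS.
have [n hn] : exists n, forall b, (P b (E n) <= e%:E)%E.
  have /choice[n hn] b : exists n, (P b (E n) < e%:E)%E.
    apply: (prob_bigcap_lt (P := P b)) => //.
    have -> : P b (\bigcap_n E n) = 0%E; last by rewrite lte_fin.
    transitivity (P b set0); last exact: measure0.
    congr (P b _); apply/seteqP; split => // y hy.
    have [/= yr _] := hy 0%N I.
    have s0 : 0 < r - d q y by rewrite subr_gt0.
    have [k hk] : exists k : nat, (r - d q y)^-1 < k%:R.
      by exists (Num.bound (r - d q y)^-1); apply: archi_boundP; rewrite invr_ge0 ltW.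
    have [_ /= nE] := hy k I; apply: nE; rewrite ltrBrDl -ltrBrDr invf_plt ?posrE//.
    by apply: (lt_trans hk); rewrite ltr_nat.
  exists (maxn (n true) (n false)) => b; apply: (le_trans _ (ltW (hn b))).
  apply: (prob_le (P b)); try exact: bE.
  by apply: mE; case: b; rewrite leq_max leqnn ?orbT.
pose K : R := n.+1%:R.
pose g y := K * (r - d q y).
have cg : continuous g.
  by move=> x; apply: cvgM; [exact: cvg_cst|apply: cvgB; [exact: cvg_cst|exact: cq]].
(* A clamped tent: 1 up to radius r - 1/K, 0 from radius r on. It differs from the indicator only on
   the shell [E n], whose mass is small. *)
pose f y : R := Num.max 0 (Num.min 1 (g y)).
have cf : continuous f.
  move=> x.
  have c1 : {for x, continuous (cst 1 : T -> R^o)} by exact: cvg_cst.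
  have c0 : {for x, continuous (cst 0 : T -> R^o)} by exact: cvg_cst.
  have h1 := @continuous_min R T (cst 1) g x c1 (cg x).
  have h2 := @continuous_max R T (cst 0) _ x c0 h1; exact: h2.
have f01 x : 0 <= f x <= 1.
  rewrite /f; case: (leP 1 (g x)) => h; last by case: (leP 0 (g x)) => // h'; rewrite ?lexx ?ler01// h' ltW.
  by rewrite max_r// ler01 lexx.
exists f; split => // b; apply: (le_trans _ (hn b)).
have -> : P b (E n) = (\int[P b]_x (\1_(E n) x)%:E)%E.
  by rewrite integral_indic// ?setIT//; exact: bE.
have mE' : measurable_fun setT ((fun x => (\1_(E n) x)%:E) : TT -> \bar R).
  by apply/measurable_EFinP; apply: measurable_indic; exact: bE.
apply: ge0_le_integral => //; first exact: measurable_approx.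
move=> x _; rewrite lee_fin !indicE.
have /andP[fx0 fx1] := f01 x.
have K0 : 0 < K by rewrite ltr0n.
have [xE|xE] := boolP (x \in E n).
  by move/set_mem: xE => [/= h _]; rewrite mem_set//= distrC ger0_norm ?subr_ge0// lerBlDr lerDl.
have [xD|xD] := boolP (x \in [set y | d q y < r]).
  have h : d q x < r - K^-1.
    apply: contrapT => nh; move/negP: xE; apply; apply/mem_set; split => //; exact: set_mem xD.
  have : 1 <= g x by rewrite /g mulrC -ler_pdivrMr// div1r lerBrDl -lerBrDr (ltW h).
  by rewrite /f => h1; rewrite min_l// max_r ?subrr ?normr0.
have : g x <= 0.
  rewrite /g pmulr_rle0// subr_le0 leNgt; apply/negP => h; move/negP: xD; apply; exact/mem_set.
by move=> h; rewrite /f max_l ?subr0 ?normr0// ge_min h orbT.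
Qed.

Lemma Borel_cont_approx D : Borel D -> cont_approx D.
Proof.
have [_ [d [cd _]]] := polT; have [q dq] := polish_seq polT cd.
have [[d0 dE dC dT] dO] := cd.
have sa : sigma_algebra setT cont_approx.
  split.
  - split; first exact: (@measurable0 _ TT).
    move=> e e0; exists (fun=> 0); split.
    + by move=> x; exact: cvg_cst.
    + by move=> x; rewrite lexx ler01.
    + move=> b; under eq_integral do rewrite indic0 subr0 normr0.
      by rewrite integral0 lee_fin ltW.
  - by move=> A; rewrite setTD; exact: cont_approxC.
  - exact: cont_approx_bigcup.
move: D; apply: smallest_sub => // O oO.
rewrite (_ : O = \bigcup_n \bigcup_k [set y | ([set y | d (q n) y < 2 ^- k] `<=` O) /\ d (q n) y < 2 ^- k]).
  apply: cont_approx_bigcup => n; apply: cont_approx_bigcup => k.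
  have [h|h] := pselect ([set y | d (q n) y < 2 ^- k] `<=` O).
    rewrite (_ : mkset _ = [set y | d (q n) y < 2 ^- k]); first exact: cont_approx_ball.
    by apply/seteqP; split => y /= => [[]|].
  rewrite (_ : mkset _ = set0); last by apply/seteqP; split => y // [].
  by have [h0 _ _] := sa.
apply/seteqP; split => x; last by move=> [n _ [k _ [/= h1 h2]]]; exact: h1.
move=> Ox; have [e e0 he] := (dO O).1 oO x Ox.
have [k hk] : exists k, (2 : R) ^- k < e / 2 by apply: inv_expn_small; lra.
have k0 : 0 < (2 : R) ^- k by rewrite invr_gt0 exprn_gt0.
have [n hn] := dq x _ k0.
exists n => //; exists k => //=; split; last by rewrite dC.
move=> y /= hy; apply: he => /=; have := dT x (q n) y; lra.
Qed.

End ContinuousApproximation.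

Lemma indic_approx (R : realType) d (T : measurableType d) (P : probability T R)
  (f g : T -> R) : measurable_fun setT f -> measurable_fun setT g ->
  (forall x, 0 <= f x <= 1) -> (forall x, 0 <= g x <= 1) ->
  (`| \int[P]_x (f x)%:E - \int[P]_x (g x)%:E | <= \int[P]_x (`|f x - g x|)%:E)%E.
Proof.
move=> mf mg f01 g01.
have nb (h : T -> R) : (forall x, 0 <= h x <= 1) -> forall x, `|h x| <= 1.
  by move=> h01 x; have /andP[h0 h1] := h01 x; rewrite ger0_norm.
have i1 : P.-integrable setT (EFin \o f) by apply: bounded_integrable mf (nb f f01).
have i2 : P.-integrable setT (EFin \o g) by apply: bounded_integrable mg (nb g g01).
rewrite -(integralB measurableT i1 i2).
have mB : measurable_fun setT (fun x => ((f x)%:E - (g x)%:E)%E).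
  by apply: emeasurable_funB; exact/measurable_EFinP.
exact: (le_trans (le_abse_integral P measurableT mB)).
Qed.

Section WeakClosure.
Context (R : realType).

Lemma continuous_fst_comp (A B : ptopologicalType) (f : A -> R) : continuous f ->
  continuous (fun z : pairsp A B => f z.1).
Proof.
move=> cf; apply/continuousP => U oU.
by apply: (@fst_preopen A B (f @^-1` U)); move/continuousP: cf; apply.
Qed.

Lemma continuous_snd_comp (A B : ptopologicalType) (f : B -> R) : continuous f ->
  continuous (fun z : pairsp A B => f z.2).
Proof.
move=> cf; apply/continuousP => U oU.
by apply: (@snd_preopen A B (f @^-1` U)); move/continuousP: cf; apply.
Qed.

Lemma ereal_dist_EFin (a b : \bar R) : a \is a fin_num -> b \is a fin_num ->
  (`|a - b|)%E = `|fine a - fine b|%:E.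
Proof. by move=> fa fb; rewrite -[in LHS](fineK fa) -[in LHS](fineK fb). Qed.

Lemma eq_of_dist (a b : R) : (forall e, 0 < e -> `|a - b| <= e) -> a = b.
Proof.
move=> h; apply/eqP; rewrite -subr_eq0 -normr_le0 leNgt; apply/negP => p.
by have := h _ (divr_gt0 p (@ltr0n R 2)); lra.
Qed.

Lemma unit_integral_fin d (T : measurableType d) (P : probability T R) (f : T -> R) :
  measurable_fun setT f -> (forall x, 0 <= f x <= 1) ->
  (\int[P]_x (f x)%:E)%E \is a fin_num.
Proof.
move=> mf f01; apply: (@integrable_fin_num _ _ R P setT measurableT (fun x => (f x)%:E)).
apply: (@bounded_integrable _ _ R P f 1) => // x.
by have /andP[f0 f1] := f01 x; rewrite ger0_norm.
Qed.

Lemma indic01 d (T : measurableType d) (D : set T) x : 0 <= (\1_D x : R) <= 1.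
Proof. by rewrite indicE; case: (x \in D); rewrite ?lexx ?ler01. Qed.

(** Three errors of size e / 3: replacing the indicator by one continuous function under [mu] and
    under the image of [pi], and passing from [pi] to a nearby member of [S]. *)
Lemma weak_closure_law (Z T : ptopologicalType) (S : set (Prob R Z)) (phi : Z -> T)
  (mu : Prob R T) (pi : Prob R Z) : polish R T ->
  (forall U, open U -> open (phi @^-1` U)) ->
  (forall pi', S pi' -> forall A, Borel A -> pi' (phi @^-1` A) = mu A) ->
  weak_closure S pi -> forall A, Borel A -> pi (phi @^-1` A) = mu A.
Proof.
move=> polT op law wpi A bA.
have mphi : measurable_fun setT (phi : borel Z -> borel T).
  apply: (@measurability _ _ (borel Z) (borel T) setT phi (@open T)) => //.
  by move=> _ [U oU <-]; rewrite setTI; apply: sub_sigma_algebra; exact: op.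
pose P b : Prob R T := if b then mu else imagep pi mphi.
have PA : forall b, (P b A) \is a fin_num by move=> b; exact: prob_fin.
suff e : fine (P false A) = fine (P true A).
  exact: (etrans (esym (fineK (PA false))) (etrans (congr1 EFin e) (fineK (PA true)))).
apply: eq_of_dist => e e0; have e30 : 0 < e / 3 by lra.
have [_ /(_ _ e30)[f [cf f01 fi]]] := Borel_cont_approx polT P bA.
have mf := continuous_Borel cf.
have mA : measurable_fun setT (\1_A : borel T -> R) by exact: measurable_indic.
have ff b := unit_integral_fin (P b) mf f01.
have hb b : `|fine (\int[P b]_x (f x)%:E) - fine (P b A)| <= e / 3.
  have := le_trans (indic_approx (P b) mf mA f01 (@indic01 _ (borel T) A)) (fi b).
  rewrite integral_indic// setIT ereal_dist_EFin//; exact: PA.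
have cF : continuous (f \o phi).
  by apply/continuousP => U oU; apply: (op (f @^-1` U)); move/continuousP: cf; apply.
have fn x : `|f x| <= 1 by have /andP[h0 h1] := f01 x; rewrite ger0_norm.
have [|pi' Spi' /(_ ord0)] := wpi 1%N (fun=> f \o phi) _ _ e30.
  by move=> _; split => //; exists 1 => z; exact: fn.
rewrite -(bounded_integral_law (g := pi') (P := P true) mphi (law pi' Spi') mf fn).
rewrite -(bounded_integral_law (g := pi) (P := P false) mphi (fun _ _ => erefl) mf fn).
rewrite ereal_dist_EFin// lte_fin => h.
have h1 := hb true; have h2 := hb false.
move: h h1 h2; rewrite !ltr_norml !ler_norml; lra.
Qed.

Context (N : nat) (X Y : 'I_N -> ptopologicalType).
Hypotheses (polX : forall t, polish R (X t)) (polY : forall t, polish R (Y t)).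
Variables (mu : Prob R (prodsp X)) (nu : Prob R (prodsp Y)).
Let Z := pairsp (prodsp X) (prodsp Y).

(** From fk - 1_A 1_B = (f - 1_A) k + 1_A (k - 1_B) the error is controlled by the two marginals
    alone, so it is uniform over all couplings. *)
Lemma rect_close (pi : Prob R Z) (f : prodsp X -> R) (k : prodsp Y -> R) A B (e : R) :
  is_cpl mu nu pi -> continuous f -> continuous k ->
  (forall x, 0 <= f x <= 1) -> (forall x, 0 <= k x <= 1) -> Borel A -> Borel B ->
  (\int[mu]_x (`|f x - \1_A x|)%:E <= e%:E)%E -> (\int[nu]_x (`|k x - \1_B x|)%:E <= e%:E)%E ->
  `|fine (\int[pi]_z (f z.1 * k z.2)%:E) - fine (pi (A `*` B))| <= 2 * e.
Proof.
move=> [pi1 pi2] cf ck f01 k01 bA bB fi ki.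
have mfst := measurable_pair_fst polX polY; have msnd := measurable_pair_snd polX polY.
have mf := continuous_Borel cf; have mk := continuous_Borel ck.
have bAB := BorelX polX polY bA bB.
have mF : measurable_fun setT ((fun z => f z.1 * k z.2) : borel Z -> R).
  apply: measurable_funM; [exact: (measurableT_comp mf mfst)|exact: (measurableT_comp mk msnd)].
have mAB : measurable_fun setT (\1_(A `*` B) : borel Z -> R) by exact: measurable_indic.
have F01 z : 0 <= f z.1 * k z.2 <= 1.
  by have /andP[? ?] := f01 z.1; have /andP[? ?] := k01 z.2; rewrite mulr_ge0//= mulr_ile1.
have fF := unit_integral_fin pi mF F01.
have l1 U (mU : measurable (U : set (borel (prodsp X)))) : pi [set z | U z.1] = mu U.
  by rewrite -pi1//; congr (pi _); apply/seteqP; split => z /= => [|[]].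
have l2 U (mU : measurable (U : set (borel (prodsp Y)))) : pi [set z | U z.2] = nu U.
  by rewrite -pi2//; congr (pi _); apply/seteqP; split => z /= => [|[]].
have ma := measurable_approx cf bA; have mb := measurable_approx ck bB.
have h := indic_approx pi mF mAB F01 (@indic01 _ (borel Z) (A `*` B)).
have fin := prob_fin pi bAB.
rewrite integral_indic// setIT ereal_dist_EFin// in h.
rewrite -lee_fin; apply: (le_trans h).
have -> : (2 * e)%:E = (e%:E + e%:E)%E by rewrite -EFinD; congr EFin; lra.
apply: (le_trans _ (leeD fi ki)).
rewrite (ge0_integral_law mfst l1 ma); last by move=> x; rewrite lee_fin.
rewrite (ge0_integral_law msnd l2 mb); last by move=> x; rewrite lee_fin.
have ma' := measurableT_comp ma mfst; have mb' := measurableT_comp mb msnd.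
rewrite -ge0_integralD//.
apply: ge0_le_integral => //.
- have mB : measurable_fun setT ((fun z => f z.1 * k z.2 - \1_(A `*` B) z) : borel Z -> R).
    exact: measurable_funB.
  by apply/measurable_EFinP; exact: measurableT_comp.
- exact: emeasurable_funD.
move=> z _; rewrite -EFinD lee_fin.
have /andP[a1 a2] := f01 z.1; have /andP[a3 a4] := k01 z.2.
have -> : (\1_(A `*` B) z : R) = \1_A z.1 * \1_B z.2.
  rewrite !indicE -natrM mulnb; congr (_%:R); congr nat_of_bool.
  by apply/idP/andP => [/set_mem[? ?]|[/set_mem ? /set_mem ?]]; [split; exact/mem_set|exact/mem_set].
have -> : f z.1 * k z.2 - \1_A z.1 * \1_B z.2 =
    (f z.1 - \1_A z.1) * k z.2 + \1_A z.1 * (k z.2 - \1_B z.2) by ring.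
apply: (le_trans (ler_normD _ _)); rewrite !normrM; apply: lerD.
  by rewrite ler_piMr// ger0_norm.
rewrite ler_piMl//; have /andP[i0 i1] := @indic01 _ (borel (prodsp X)) A z.1.
by rewrite ger0_norm.
Qed.

(** The innovation condition relates two rectangles under the same coupling, so a single [pi'] must
    serve a finite family. The share e / 5 is spent twice for [pi'], twice for [pi] and once between
    their integrals. *)
Lemma rect_limit (S : set (Prob R Z)) (pi : Prob R Z) k (A : 'I_k -> set (prodsp X))
  (B : 'I_k -> set (prodsp Y)) (e : R) : S `<=` is_cpl mu nu -> is_cpl mu nu pi ->
  weak_closure S pi -> (forall i, Borel (A i)) -> (forall i, Borel (B i)) -> 0 < e ->
  exists2 pi', S pi' & forall i, `|fine (pi' (A i `*` B i)) - fine (pi (A i `*` B i))| <= e.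
Proof.
move=> SC cpi wpi bA bB e0; have e50 : 0 < e / 5 by lra.
have /choice[f hf] i : exists f : prodsp X -> R, [/\ continuous f, forall x, 0 <= f x <= 1 &
    (\int[mu]_x (`|f x - \1_(A i) x|)%:E <= (e / 5)%:E)%E].
  have [_ /(_ _ e50)[f [cf f01 fi]]] := Borel_cont_approx (prodsp_polish polX) (fun=> mu) (bA i).
  by exists f; split => //; exact: (fi true).
have /choice[h hh] i : exists f : prodsp Y -> R, [/\ continuous f, forall x, 0 <= f x <= 1 &
    (\int[nu]_x (`|f x - \1_(B i) x|)%:E <= (e / 5)%:E)%E].
  have [_ /(_ _ e50)[f' [cf f01 fi]]] := Borel_cont_approx (prodsp_polish polY) (fun=> nu) (bB i).
  by exists f'; split => //; exact: (fi true).
pose F i (z : Z) := f i z.1 * h i z.2.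
have F01 i z : 0 <= F i z <= 1.
  have [_ f01 _] := hf i; have [_ h01 _] := hh i.
  by have /andP[? ?] := f01 z.1; have /andP[? ?] := h01 z.2; rewrite mulr_ge0//= mulr_ile1.
have cF i : continuous (F i).
  have [cf _ _] := hf i; have [ch _ _] := hh i.
  by move=> z; apply: cvgM; [exact: (continuous_fst_comp cf)|exact: (continuous_snd_comp ch)].
have [|pi' Spi' hpi'] := wpi k F _ _ e50.
  move=> i; split => //; exists 1 => z; have /andP[g0 g1] := F01 i z; by rewrite ger0_norm.
exists pi' => // i; have := hpi' i.
have fin (Q : Prob R Z) := unit_integral_fin Q (continuous_Borel (cF i)) (F01 i).
rewrite ereal_dist_EFin// lte_fin => h3.
have [cf f01 fi] := hf i; have [ch h01 hi] := hh i.
have h1 := rect_close (SC _ Spi') cf ch f01 h01 (bA i) (bB i) fi hi.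
have h2 := rect_close cpi cf ch f01 h01 (bA i) (bB i) fi hi.
move: h1 h2 h3; rewrite -/(F i) !ltr_norml !ler_norml; lra.
Qed.

Hypotheses (dmu : cont_disint mu) (dnu : cont_disint nu).

Lemma weak_closure_bc (S : set (Prob R Z)) : S `<=` Cpl_bc mu nu ->
  weak_closure S `<=` Cpl_bc mu nu.
Proof.
move=> SC pi wpi.
have [Phi [Psi iso]] := uniformization polX dmu.
have [PhiY [PsiY isoY]] := uniformization polY dnu.
have cpi : is_cpl mu nu pi.
  split => U bU.
    rewrite -(@weak_closure_law Z (prodsp X) S fst mu pi (prodsp_polish polX) _ _ wpi U bU).
    - by congr (pi _); apply/seteqP; split => z /= => [[]|].
    - by move=> V oV; exact: (@fst_preopen _ _ V).
    - move=> pi' /SC[[h _] _] V bV; rewrite -h//.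
      by congr (pi' _); apply/seteqP; split => z /= => [|[]].
  rewrite -(@weak_closure_law Z (prodsp Y) S snd nu pi (prodsp_polish polY) _ _ wpi U bU).
  - by congr (pi _); apply/seteqP; split => z /= => [[]|].
  - by move=> V oV; exact: (@snd_preopen _ _ V).
  - move=> pi' /SC[[_ h] _] V bV; rewrite -h//.
    by congr (pi' _); apply/seteqP; split => z /= => [|[]].
have SC' : S `<=` is_cpl mu nu by move=> pi' /SC[].
(* The innovation condition is a linear relation between the masses of two rectangles. An accuracy
   of e / (1 + c) for each gives total error e. *)
have lim2 (A1 A2 : set (prodsp X)) (B1 B2 : set (prodsp Y)) (c : R) :
    Borel A1 -> Borel A2 -> Borel B1 -> Borel B2 -> 0 <= c ->
    (forall pi', S pi' -> pi' (A1 `*` B1) = (c%:E * pi' (A2 `*` B2))%E) ->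
    pi (A1 `*` B1) = (c%:E * pi (A2 `*` B2))%E.
  move=> bA1 bA2 bB1 bB2 c0 hS.
  have fin (Q : Prob R Z) A B (bA : Borel A) (bB : Borel B) : Q (A `*` B) \is a fin_num.
    exact: (prob_fin Q (BorelX polX polY bA bB)).
  rewrite -(fineK (fin pi _ _ bA1 bB1)) -(fineK (fin pi _ _ bA2 bB2)) -EFinM; congr EFin.
  apply: eq_of_dist => e e0.
  have e'0 : 0 < e / (1 + c) by rewrite divr_gt0//; lra.
  pose A (i : 'I_2) := if i == ord0 then A1 else A2.
  pose B (i : 'I_2) := if i == ord0 then B1 else B2.
  have [||pi' Spi' h] := rect_limit (A := A) (B := B) SC' cpi wpi _ _ e'0.
  - by move=> i; rewrite /A; case: ifP.
  - by move=> i; rewrite /B; case: ifP.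
  have h1 := h ord0; have h2 := h ord_max; rewrite /A /B /= in h1 h2.
  have e1 : fine (pi' (A1 `*` B1)) = c * fine (pi' (A2 `*` B2)).
    by apply: EFin_inj; rewrite EFinM !fineK//; [exact: hS|exact: fin|exact: fin].
  rewrite e1 in h1.
  set a := fine (pi _) in h1 *; set b := fine (pi _) in h2 *; set b' := fine (pi' _) in h1 h2.
  have -> : a - c * b = - (c * b' - a) + c * (b' - b) by ring.
  apply: (le_trans (ler_normD _ _)); rewrite normrN normrM (ger0_norm c0).
  apply: (@le_trans _ _ (e / (1 + c) + c * (e / (1 + c)))).
    by apply: lerD => //; rewrite ler_wpM2l.
  rewrite le_eqVlt; apply/orP; left; apply/eqP; field; lra.
have ICX : IC Phi (fun W => pi W).
  move=> t A C B mA mC mB.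
  have bA := Borel_Ft polX mA; have bB := Borel_Ft polY mB; have bT := Borel_tail polX iso t mC.
  apply: lim2 => //; [exact: (@measurableI _ (borel (prodsp X)))|exact: wt_ge0|].
  by move=> pi' /SC[_ [ca _]]; exact: (causal_IC polX iso polY ca).
have ICY : IC PhiY (fun W : set (pairsp (prodsp Y) (prodsp X)) => pi (swap_set W)).
  move=> t A C B mA mC mB.
  have bA := Borel_Ft polY mA; have bB := Borel_Ft polX mB; have bT := Borel_tail polY isoY t mC.
  have sw (U : set (prodsp Y)) (V : set (prodsp X)) : swap_set (U `*` V) = V `*` U.
    by apply/seteqP; split => z [? ?].
  rewrite !sw; apply: lim2 => //; [exact: (@measurableI _ (borel (prodsp Y)))|exact: wt_ge0|].
  move=> pi' /SC[_ [_ ca]]; rewrite -!sw; exact: (causal_IC polY isoY polX ca).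
split => //; have [pi1 pi2] := cpi; split; first exact: (IC_causal polX polY iso isoY pi1 ICX).
have cX := prodsp_cbase polX; have cY := prodsp_cbase polY.
have msw : measurable_fun setT ((fun z => (z.2, z.1)) : borel Z -> borel (pairsp (prodsp Y) (prodsp X))).
  have m : measurable_fun setT ((fun z => (z.2, z.1)) : borel Z -> (borel (prodsp Y) * borel (prodsp X))%type).
    by apply: measurable_fun_pair; [exact: measurable_pair_snd|exact: measurable_pair_fst].
  exact: (measurableT_comp (measurable_of_pair cY cX) m).
(* Causality from [nu] to [mu] is obtained from [IC_causal] applied to the coupling with exchanged
   factors. *)
pose pis : Prob R (pairsp (prodsp Y) (prodsp X)) := imagep pi msw.
have pis1 U : Borel U -> pis (U `*` setT) = nu U.
  move=> bU; rewrite -pi2//; change (pi [set z | (U `*` setT) (z.2, z.1)] = pi (setT `*` U)).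
  by congr (pi _); apply/seteqP; split => z [? ?].
exact: (IC_causal (pi := pis) polY polX isoY iso pis1 ICY).
Qed.

End WeakClosure.

Theorem theorem3p11 (R : realType) (N : nat) (X Y : 'I_N -> ptopologicalType)
  (mu : Prob R (prodsp X)) (nu : Prob R (prodsp Y)) :
  (forall t, polish R (X t)) -> (forall t, polish R (Y t)) ->
  cont_disint mu -> cont_disint nu ->
  weak_closure (Cpl_bc mu nu `&` Cpl_biM mu nu) = Cpl_bc mu nu /\
  (forall (p : R) (dX : prodsp X -> prodsp X -> R) (dY : prodsp Y -> prodsp Y -> R),
    1 <= p -> compatible_metric dX -> compatible_metric dY ->
    finite_moment p dX mu -> finite_moment p dY nu ->
    forall pi, Cpl_bc mu nu pi -> forall eps : R, 0 < eps ->
      exists2 pi', (Cpl_bc mu nu `&` Cpl_biM mu nu) pi' &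
        (Wp p (prod_cost p dX dY) pi' pi < eps%:E)%E).
Proof.
move=> polX polY dmu dnu; split; last first.
  by move=> p dX dY p1 cdX cdY mX mY pi; exact: (Wp_density polX polY dmu dnu).
apply/seteqP; split; last by move=> pi; exact: weak_density.
by apply: weak_closure_bc => // pi [].
Qed.
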